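(* Let $D\subseteq\mathbb{C}$ be a domain and let $\mathscr{F}$ be a family of analytic functions in $D$. Let $k\ge 1$, $q_0\ge 2$, $q_i\ge 0$ $(i=1,2,\dots,k-1)$ and $q_k\ge 1$ be integers. Suppose that for each $f\in\mathscr{F}$: (a) $f$ has only zeros of multiplicity at least $k$, and (b) $f^{q_0}(f')^{q_1}\cdots (f^{(k)})^{q_k}\neq 1$ in $D$, i.e. $f(z)^{q_0}(f'(z))^{q_1}\cdots (f^{(k)}(z))^{q_k}\ne 1$ for every $z\in D$. Then $\mathscr{F}$ is normal on $D$.
   Context: A family $\mathscr{G}$ of meromorphic functions in a domain $D$ is said to be normal in $D$ if every sequence $\{g_n\}\subset\mathscr{G}$ contains a subsequence which converges spherically (i.e. with respect to the spherical metric on $\mathbb{C}\cup\{\infty\}$) uniformly on every compact subset of $D$; the limit function may be identically $\infty$. *)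

(* Defs.v *)
From Stdlib Require Import Reals List.
From Coquelicot Require Import Coquelicot.

Open Scope R_scope.

Definition C_connected (D : C -> Prop) : Prop :=
  forall U V : C -> Prop,
    open U -> open V ->
    (forall z, D z -> U z \/ V z) ->
    (exists z, D z /\ U z) ->
    (exists z, D z /\ V z) ->
    exists z, D z /\ U z /\ V z.

Definition C_domain (D : C -> Prop) : Prop :=
  (exists z, D z) /\ open D /\ C_connected D.

Definition C_compact (K : C -> Prop) : Prop :=
  forall cover : (C -> Prop) -> Prop,
    (forall U, cover U -> open U) ->
    (forall z, K z -> exists U, cover U /\ U z) ->
    exists l : list (C -> Prop),
      (forall U, In U l -> cover U) /\
      (forall z, K z -> exists U, In U l /\ U z).

(* Functions on [D] are represented by total functions [C -> C]; only the
   values on [D] are constrained.  [is_derive] is taken over the field [C]. *)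
Definition analytic_on (D : C -> Prop) (f : C -> C) : Prop :=
  forall z, D z -> ex_derive (K := C_AbsRing) (V := C_NormedModule) f z.

(* [C_derive] is a limit along the real direction; by [C_derive_correct] it is
   the complex derivative wherever [ex_derive] holds over [C]. *)
Definition C_derive_n (f : C -> C) (n : nat) : C -> C := Nat.iter n C_derive f.

Definition multiplicity_at (f : C -> C) (a : C) (m : nat) : Prop :=
  exists g : C -> C,
    locally a (fun z => ex_derive (K := C_AbsRing) (V := C_NormedModule) g z) /\
    g a <> 0%C /\
    locally a (fun z => f z = ((z - a) ^ m * g z)%C).

(* At a zero of infinite order (on a domain: [f] identically zero) no [m]
   satisfies [multiplicity_at f a m], so such zeros are allowed. *)
Definition zeros_of_multiplicity_ge (D : C -> Prop) (f : C -> C) (k : nat) : Prop :=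
  forall a, D a -> f a = 0%C ->
  forall m, multiplicity_at f a m -> (k <= m)%nat.

(* Product of [a 0], ..., [a (n - 1)]. *)
Fixpoint C_prod (a : nat -> C) (n : nat) : C :=
  match n with
  | O => 1%C
  | S m => (C_prod a m * a m)%C
  end.

Definition diff_monomial (k : nat) (q : nat -> nat) (f : C -> C) (z : C) : C :=
  C_prod (fun i => (C_derive_n f i z ^ q i)%C) (S k).

Inductive C_sphere : Type :=
  | Fin : C -> C_sphere
  | Infty : C_sphere.

(* Great-circle distance on the unit sphere: a central angle [t] has chord
   [2 * sin (t / 2)], and under stereographic projection the chord between
   [z] and [w] is [2 * |z - w| / (sqrt (1 + |z|^2) * sqrt (1 + |w|^2))]. *)
Definition spherical_dist (p p' : C_sphere) : R :=
  match p, p' with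
  | Fin z, Fin w =>
      2 * asin (Cmod (z - w) / (sqrt (1 + Cmod z ^ 2) * sqrt (1 + Cmod w ^ 2)))
  | Fin z, Infty | Infty, Fin z => 2 * asin (1 / sqrt (1 + Cmod z ^ 2))
  | Infty, Infty => 0
  end.

Definition spherically_uniform_cvg
    (K : C -> Prop) (g : nat -> C -> C_sphere) (h : C -> C_sphere) : Prop :=
  forall eps : R, 0 < eps ->
  exists N : nat, forall n : nat, (N <= n)%nat ->
  forall z, K z -> spherical_dist (g n z) (h z) < eps.

Definition normal_family (D : C -> Prop) (G : (C -> C_sphere) -> Prop) : Prop :=
  forall g : nat -> C -> C_sphere, (forall n, G (g n)) ->
  exists phi : nat -> nat,
    (forall n, (phi n < phi (S n))%nat) /\
    exists h : C -> C_sphere,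
      forall K : C -> Prop, C_compact K -> (forall z, K z -> D z) ->
      spherically_uniform_cvg K (fun n => g (phi n)) h.

Definition sphere_valued (F : (C -> C) -> Prop) (g : C -> C_sphere) : Prop :=
  exists f, F f /\ g = (fun z => Fin (f z)).

(* Main.v *)
Require Import Defs.
From Stdlib Require Import Reals ZArith Lra Lia List Classical ClassicalEpsilon Cantor.
From Coquelicot Require Import Coquelicot.
Open Scope R_scope.

(** Normality follows from a rescaling argument in the spirit of Zalcman and Pang.
    Write [M f] for the differential monomial, [gam] for its degree and [Gam] for its
    weight, the sum of the [i * q i]. The substitution
    [g w = f (z + rho w) / rho^(Gam / gam)] preserves [M]: the function [M g] at [w] is
    [M f] at [z + rho w]. Moreover [Gam / gam < k], because [q 0 > 0].

    A disc of radius [rho] is called bad for [f] if, after this substitution, [|g|]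
    takes on it values below 1 and values above 2 ([bad]). If near every point of
    [D] the discs below some fixed relative size are bad for no member of the family
    ([uniformly_not_bad]), then on a fixed disc each member [f] is bounded above or
    bounded away from 0 by a common constant; hence [f] or [1 / f] is Lipschitz,
    [f] is Lipschitz as a map into the sphere ([half_chord_Lipschitz]), and the
    theorem of Arzela and Ascoli gives normality ([equicontinuous_normal]).

    Otherwise there are members with arbitrarily small bad discs. For a single [f] the
    sizes of bad discs have a positive lower bound, because its zeros have
    multiplicity at least [k > Gam / gam] ([small_not_bad]). So a bad disc can be chosen
    of nearly minimal relative size ([nearly_minimal_bad]); rescaled to the unit disc
    it gives a function [g] on a large disc for which all discs of some fixed radius are
    not bad ([rescaled_functions]). Harnack's inequality for [ln |g|] then bounds [|g|] by
    [exp (K (1 + |w|))] ([tame_growth]). By Montel's theorem a subsequence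
    converges to an entire function [h] of exponential type, which is not constant
    because the unit disc is bad for each [g].

    No such [h] exists ([no_nonconstant_limit]). A zero-free entire function of
    exponential type satisfies [W' = e W] for a constant [e] ([zero_free_exp_type]),
    so no value distribution theory is needed: this is applied to [M h - 1], zero-free
    by Hurwitz, and to [h].

    Since differentiability is assumed at each point only, the theory of holomorphic
    functions used here is developed from Goursat's theorem: primitives on
    convex sets, Cauchy's formula on circles ([Cauchy_formula]), holomorphy of
    derivatives, the maximum principle, the lemmas of Schwarz and Harnack, and the
    theorems of Liouville, Weierstrass and Hurwitz. *)


(** * Continuity and complex differentiability *)

Lemma Cmod_tri_sub (a b c : C) : Cmod (a - c) <= Cmod (a - b) + Cmod (b - c).
Proof.
  replace (a - c)%C with ((a - b) + (b - c))%C by ring. apply Cmod_triangle.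
Qed.

Lemma Cmod_sym (a b : C) : Cmod (a - b) = Cmod (b - a).
Proof. rewrite <- (Cmod_opp (a - b)). f_equal. ring. Qed.

Lemma Cmod_rev (a b : C) : Cmod a - Cmod b <= Cmod (a - b).
Proof.
  assert (H := Cmod_triangle (a - b) b).
  replace (a - b + b)%C with a in H by ring. lra.
Qed.

Lemma Cmod_add (w z : C) : Cmod w <= Cmod (w - z) + Cmod z.
Proof. generalize (Cmod_rev w z). lra. Qed.

Lemma Cmod_arbitrarily_small (z : C) : (forall eps, 0 < eps -> Cmod z <= eps) -> z = RtoC 0.
Proof.
  intros H. apply Cmod_eq_0, Rle_antisym; [| apply Cmod_ge_0]. apply le_epsilon.
  intros eps He. rewrite Rplus_0_l. auto.
Qed.

Lemma Rmin_lt (a b x : R) : x < Rmin a b -> x < a /\ x < b.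
Proof. generalize (Rmin_l a b), (Rmin_r a b). lra. Qed.

(** The common end of the arguments that let an exponent tend to infinity. *)
Lemma geom_small (A x eps : R) : 0 <= x < 1 -> 0 < eps -> exists n, A * x ^ n < eps.
Proof.
  intros Hx He.
  assert (L : is_lim_seq (fun n => A * x ^ n) (A * 0)).
  { apply (is_lim_seq_scal_l _ A 0), is_lim_seq_geom. rewrite Rabs_pos_eq; lra. }
  rewrite Rmult_0_r in L. apply is_lim_seq_spec in L.
  destruct (L (mkposreal eps He)) as [N HN]. exists N. specialize (HN N (le_n _)). simpl in HN.
  apply Rabs_lt_between in HN. lra.
Qed.

Lemma ratio_lt_1 (a b : R) : 0 <= a < b -> 0 <= a / b < 1.
Proof. intros H. split; [apply Rle_div_r | apply Rlt_div_l]; lra. Qed.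

Lemma Cmod_self (a : C) : Cmod (a - a) = 0.
Proof. replace (a - a)%C with (RtoC 0) by ring. apply Cmod_0. Qed.

Lemma Cmod_sub_eq0 (a b : C) : Cmod (a - b) = 0 -> a = b.
Proof.
  intros H. apply Cmod_eq_0 in H. replace a with ((a - b) + b)%C by ring.
  rewrite H. ring.
Qed.

Lemma Cmod_sub_pos (a b : C) : a <> b -> 0 < Cmod (a - b).
Proof.
  intros H. destruct (Cmod_ge_0 (a - b)) as [H1 | H1]; [exact H1 |].
  exfalso. apply H. apply Cmod_sub_eq0. auto.
Qed.

Lemma Csub_neq (a b : C) : a <> b -> (a - b)%C <> RtoC 0.
Proof.
  intros H E. apply H. apply Cmod_sub_eq0. rewrite E. apply Cmod_0.
Qed.

Lemma Cmod_RtoC_pos (t : R) : 0 <= t -> Cmod (RtoC t) = t.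
Proof. intros H. rewrite Cmod_R. apply Rabs_pos_eq, H. Qed.

Lemma locally_C_iff (z : C) (P : C -> Prop) :
  locally z P <-> exists d, 0 < d /\ forall w, Cmod (w - z) < d -> P w.
Proof.
  split.
  - intros [d H]. exists d. split; [apply cond_pos |].
    intros w Hw. apply H. apply C_NormedModule_mixin_compat1. exact Hw.
  - intros [d [Hd H]].
    assert (Hd' : 0 < d / 2) by lra.
    exists (mkposreal _ Hd'). intros w Hw. apply H.
    apply (C_NormedModule_mixin_compat2 z w (mkposreal _ Hd')) in Hw.
    simpl in Hw. change (minus w z) with (w - z)%C in Hw.
    assert (sqrt 2 < 2).
    { rewrite <- (sqrt_square 2) at 2 by lra. apply sqrt_lt_1; lra. }
    nra.
Qed.

(** The source is an arbitrary uniform space, so that the rules below serve both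
    curves and functions of a complex variable. *)
Definition cont_at {T : UniformSpace} (f : T -> C) (t : T) : Prop :=
  forall eps, 0 < eps -> locally t (fun s => Cmod (f s - f t) < eps).

Lemma cont_at_C (f : C -> C) (z : C) :
  cont_at f z <->
  (forall eps, 0 < eps -> exists d, 0 < d /\
     forall w, Cmod (w - z) < d -> Cmod (f w - f z) < eps).
Proof.
  split; intros H eps He; specialize (H eps He); apply locally_C_iff in H; exact H.
Qed.

Lemma cont_at_const {T : UniformSpace} (c : C) (t : T) : cont_at (fun _ => c) t.
Proof.
  intros eps He. apply filter_forall. intros s. rewrite Cmod_self. exact He.
Qed.

Lemma cont_at_id (z : C) : cont_at (fun w : C => w) z.
Proof. apply cont_at_C. intros eps He. exists eps. auto. Qed.

Lemma cont_at_RtoC (t : R) : cont_at (fun s : R => RtoC s) t.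
Proof.
  intros eps He. exists (mkposreal eps He). intros s Hs.
  rewrite <- RtoC_minus, Cmod_R. exact Hs.
Qed.

Lemma cont_at_plus {T : UniformSpace} (f g : T -> C) (t : T) :
  cont_at f t -> cont_at g t -> cont_at (fun s => f s + g s)%C t.
Proof.
  intros Hf Hg eps He.
  assert (He2 : 0 < eps / 2) by lra.
  generalize (filter_and _ _ (Hf _ He2) (Hg _ He2)). apply filter_imp.
  intros s [H1 H2].
  replace (f s + g s - (f t + g t))%C with ((f s - f t) + (g s - g t))%C by ring.
  eapply Rle_lt_trans; [apply Cmod_triangle |]. lra.
Qed.

Lemma cont_at_mult {T : UniformSpace} (f g : T -> C) (t : T) :
  cont_at f t -> cont_at g t -> cont_at (fun s => f s * g s)%C t.
Proof.
  intros Hf Hg eps He.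
  set (A := Cmod (f t)). set (B := Cmod (g t)).
  assert (HA : 0 <= A) by apply Cmod_ge_0. assert (HB : 0 <= B) by apply Cmod_ge_0.
  set (e := Rmin 1 (eps / (A + B + 2))).
  assert (He0 : 0 < e) by (unfold e; apply Rmin_glb_lt; [lra | apply Rdiv_lt_0_compat; lra]).
  assert (He1 : e <= 1) by apply Rmin_l.
  assert (He2 : e * (A + B + 2) <= eps) by (apply Rle_div_r; [lra | apply Rmin_r]).
  generalize (filter_and _ _ (Hf e He0) (Hg e He0)). apply filter_imp. intros s [H1 H2].
  replace (f s * g s - f t * g t)%C
    with ((f s - f t) * (g s - g t) + ((f s - f t) * g t + f t * (g s - g t)))%C by ring.
  eapply Rle_lt_trans; [apply Cmod_triangle |].
  assert (T1 := Cmod_triangle ((f s - f t) * g t) (f t * (g s - g t))).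
  rewrite !Cmod_mult in *. fold A B in T1 |- *.
  assert (P1 := Cmod_ge_0 (f s - f t)). assert (P2 := Cmod_ge_0 (g s - g t)). nra.
Qed.

Lemma cont_at_comp {T : UniformSpace} (f : C -> C) (g : T -> C) (t : T) :
  cont_at f (g t) -> cont_at g t -> cont_at (fun s => f (g s)) t.
Proof.
  intros Hf Hg eps He. apply cont_at_C with (eps := eps) in Hf; [| exact He].
  destruct Hf as [d [Hd H]].
  generalize (Hg d Hd). apply filter_imp. intros s Hs. apply H, Hs.
Qed.

Lemma cont_at_Cinv (z : C) : z <> RtoC 0 -> cont_at Cinv z.
Proof.
  intros Hz. apply cont_at_C. intros eps He.
  assert (Hp : 0 < Cmod z) by (apply Cmod_gt_0; exact Hz).
  set (p := Cmod z) in *.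
  assert (Hq : 0 < eps * (p * p / 2)) by (apply Rmult_lt_0_compat; nra).
  exists (Rmin (p / 2) (eps * (p * p / 2))). split.
  - apply Rmin_glb_lt; lra.
  - intros w Hw.
    assert (H1 : Cmod (w - z) < p / 2) by (eapply Rlt_le_trans; [apply Hw | apply Rmin_l]).
    assert (H2 : Cmod (w - z) < eps * (p * p / 2))
      by (eapply Rlt_le_trans; [apply Hw | apply Rmin_r]).
    assert (H3 : p / 2 < Cmod w).
    { generalize (Cmod_rev z w). rewrite Cmod_sym. fold p. lra. }
    assert (Hw0 : w <> RtoC 0) by (apply Cmod_gt_0; lra).
    replace (/ w - / z)%C with (- (w - z) / (w * z))%C by (field; auto).
    rewrite Cmod_div by (apply Cmult_neq_0; auto).
    rewrite Cmod_opp, Cmod_mult. fold p.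
    apply Rlt_div_l; nra.
Qed.

Lemma cont_at_inv {T : UniformSpace} (f : T -> C) (t : T) :
  f t <> RtoC 0 -> cont_at f t -> cont_at (fun s => / f s)%C t.
Proof. intros H0 Hf. apply (cont_at_comp Cinv); [apply cont_at_Cinv, H0 | exact Hf]. Qed.

Lemma cont_at_opp {T : UniformSpace} (f : T -> C) (t : T) :
  cont_at f t -> cont_at (fun s => - f s)%C t.
Proof.
  intros Hf eps He. generalize (Hf eps He). apply filter_imp. intros s Hs.
  replace (- f s - - f t)%C with (- (f s - f t))%C by ring. rewrite Cmod_opp. exact Hs.
Qed.

Lemma cont_at_minus {T : UniformSpace} (f g : T -> C) (t : T) :
  cont_at f t -> cont_at g t -> cont_at (fun s => f s - g s)%C t.
Proof. intros Hf Hg. apply cont_at_plus; [exact Hf | apply cont_at_opp, Hg]. Qed.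

(** Closes goals built by ring operations from functions known to be continuous. *)
Ltac cont :=
  repeat first [ assumption | apply cont_at_const | apply cont_at_id | apply cont_at_RtoC
               | apply cont_at_minus | apply cont_at_plus | apply cont_at_mult ]; auto.

Lemma cont_at_ext_loc {T : UniformSpace} (f g : T -> C) (t : T) :
  locally t (fun s => f s = g s) -> cont_at f t -> cont_at g t.
Proof.
  intros He Hf eps Hp. assert (E := locally_singleton _ _ He).
  generalize (filter_and _ _ He (Hf eps Hp)). apply filter_imp.
  intros s [E1 H]. rewrite <- E1, <- E. exact H.
Qed.

(** Caratheodory's form of differentiability: the chain, product and quotient
    rules become rules about continuity. *)
Definition cdiff (f : C -> C) (z l : C) : Prop :=
  exists p : C -> C, cont_at p z /\ p z = l /\
    forall w, (f w = f z + p w * (w - z))%C.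

Lemma cdiff_eps (f : C -> C) (z l : C) :
  cdiff f z l <->
  (forall eps, 0 < eps -> exists d, 0 < d /\ forall w, Cmod (w - z) < d ->
     Cmod (f w - f z - l * (w - z)) <= eps * Cmod (w - z)).
Proof.
  split.
  - intros [p [Hc [Hl E]]] eps He. apply cont_at_C with (eps := eps) in Hc; [| exact He].
    destruct Hc as [d [Hd H]]. exists d. split; [exact Hd |].
    intros w Hw. rewrite (E w).
    replace (f z + p w * (w - z) - f z - l * (w - z))%C
      with ((p w - p z) * (w - z))%C by (rewrite Hl; ring).
    rewrite Cmod_mult. apply Rmult_le_compat_r; [apply Cmod_ge_0 |].
    apply Rlt_le, H, Hw.
  - intros H.
    exists (fun w => if excluded_middle_informative (w = z) then l
                     else ((f w - f z) / (w - z))%C).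
    split; [| split].
    + apply cont_at_C. intros eps He. destruct (H (eps / 2)) as [d [Hd H1]]; [lra |].
      exists d. split; [exact Hd |]. intros w Hw.
      destruct (excluded_middle_informative (z = z)) as [_ | n]; [| exfalso; auto].
      destruct (excluded_middle_informative (w = z)) as [e | n].
      * rewrite Cmod_self. exact He.
      * assert (Hp := Cmod_sub_pos w z n). assert (Hn := Csub_neq w z n).
        specialize (H1 w Hw).
        replace ((f w - f z) / (w - z) - l)%C
          with ((f w - f z - l * (w - z)) / (w - z))%C by (field; exact Hn).
        rewrite Cmod_div by exact Hn.
        apply Rlt_div_l; [exact Hp | nra].
    + destruct (excluded_middle_informative (z = z)) as [_ | n]; [reflexivity | exfalso; auto].
    + intros w. destruct (excluded_middle_informative (w = z)) as [e | n].
      * rewrite e. ring.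
      * field. apply Csub_neq, n.
Qed.

(** The filters of neighbourhoods on the two sides come from the modulus and from
    the product structure of [C]; they agree by [locally_C]. *)
Lemma cdiff_is_derive (f : C -> C) (z l : C) :
  is_derive (K := C_AbsRing) (V := C_NormedModule) f z l <-> cdiff f z l.
Proof.
  rewrite cdiff_eps. split.
  - intros [_ H] eps He.
    specialize (H z (fun P HP => HP) (mkposreal eps He)).
    apply locally_C in H. apply locally_C_iff in H. destruct H as [d [Hd H]].
    exists d. split; [exact Hd |]. intros w Hw. specialize (H w Hw).
    change (Cmod (f w - f z - (w - z) * l) <= eps * Cmod (w - z)) in H.
    rewrite (Cmult_comm l). exact H.
  - intros H. split; [apply is_linear_scal_l |].
    intros x Hx. assert (E := is_filter_lim_locally_unique (V := AbsRing_NormedModule C_AbsRing) z x Hx). subst x. clear Hx.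
    intros [eps He]. apply locally_C, locally_C_iff.
    destruct (H eps He) as [d [Hd H1]]. exists d. split; [exact Hd |].
    intros w Hw.
    change (Cmod (f w - f z - (w - z) * l) <= eps * Cmod (w - z)).
    rewrite (Cmult_comm _ l). apply H1, Hw.
Qed.

Lemma cdiff_unique (f : C -> C) (z l : C) : cdiff f z l -> C_derive f z = l.
Proof. intros H. apply is_C_derive_unique, cdiff_is_derive, H. Qed.

Lemma cdiff_cont (f : C -> C) (z l : C) : cdiff f z l -> cont_at f z.
Proof.
  intros [p [Hc [_ E]]].
  apply cont_at_ext_loc with (f := fun w => (f z + p w * (w - z))%C).
  - apply filter_forall. intros w. symmetry. apply E.
  - cont.
Qed.

Lemma cdiff_ext_loc (f g : C -> C) (z l : C) :
  locally z (fun w => f w = g w) -> cdiff f z l -> cdiff g z l.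
Proof.
  intros He Hf. assert (E := locally_singleton _ _ He).
  apply locally_C_iff in He. destruct He as [d [Hd He]].
  rewrite cdiff_eps in Hf |- *. intros eps Hp.
  destruct (Hf eps Hp) as [d' [Hd' H]]. exists (Rmin d d'). split; [apply Rmin_glb_lt; auto |].
  intros w Hw. rewrite <- (He w), <- E.
  - apply H. eapply Rlt_le_trans; [apply Hw | apply Rmin_r].
  - eapply Rlt_le_trans; [apply Hw | apply Rmin_l].
Qed.

Lemma cdiff_const (c z : C) : cdiff (fun _ => c) z 0.
Proof. exists (fun _ => RtoC 0). repeat split; [apply cont_at_const | intros; ring]. Qed.

Lemma cdiff_id (z : C) : cdiff (fun w => w) z 1.
Proof. exists (fun _ => RtoC 1). repeat split; [apply cont_at_const | intros; ring]. Qed.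

Lemma cdiff_plus (f g : C -> C) (z l m : C) :
  cdiff f z l -> cdiff g z m -> cdiff (fun w => f w + g w)%C z (l + m).
Proof.
  intros [p [Hp [Lp Ep]]] [q [Hq [Lq Eq]]].
  exists (fun w => p w + q w)%C. split; [apply cont_at_plus; auto | split].
  - rewrite Lp, Lq. reflexivity.
  - intros w. rewrite (Ep w), (Eq w). ring.
Qed.

Lemma cdiff_mult (f g : C -> C) (z l m : C) :
  cdiff f z l -> cdiff g z m -> cdiff (fun w => f w * g w)%C z (l * g z + f z * m).
Proof.
  intros Hf Hg. assert (Cg := cdiff_cont _ _ _ Hg).
  destruct Hf as [p [Hp [Lp Ep]]]. destruct Hg as [q [Hq [Lq Eq]]].
  exists (fun w => p w * g w + f z * q w)%C. split; [| split].
  - cont.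
  - rewrite Lp, Lq. reflexivity.
  - intros w. rewrite (Ep w). rewrite (Eq w). ring.
Qed.

Lemma cdiff_comp (f g : C -> C) (z l m : C) :
  cdiff f (g z) l -> cdiff g z m -> cdiff (fun w => f (g w)) z (l * m).
Proof.
  intros Hf Hg. assert (Cg := cdiff_cont _ _ _ Hg).
  destruct Hf as [p [Hp [Lp Ep]]]. destruct Hg as [q [Hq [Lq Eq]]].
  exists (fun w => p (g w) * q w)%C. split; [| split].
  - apply cont_at_mult; [apply (cont_at_comp p g); assumption | exact Hq].
  - rewrite Lp, Lq. reflexivity.
  - intros w. rewrite (Ep (g w)) at 1. rewrite (Eq w) at 2. ring.
Qed.

Lemma cdiff_Cinv (z : C) : z <> RtoC 0 -> cdiff Cinv z (- / (z * z)).
Proof.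
  (* [/ w = / z - (w - z) / (w z)] can fail only at [w = 0] *)
  intros Hz. apply cdiff_ext_loc with (fun w => / z + - / (w * z) * (w - z))%C.
  - apply locally_C_iff. exists (Cmod z). split; [apply Cmod_gt_0, Hz |]. intros w Hw.
    assert (Hw0 : w <> RtoC 0) by (apply Cmod_gt_0; generalize (Cmod_rev z w); rewrite Cmod_sym; lra).
    field; auto.
  - exists (fun w => - / (w * z))%C. split; [| split; [reflexivity | intros; ring]].
    apply cont_at_opp, cont_at_inv; [apply Cmult_neq_0; auto | cont].
Qed.

Lemma cdiff_inv (f : C -> C) (z l : C) :
  f z <> RtoC 0 -> cdiff f z l -> cdiff (fun w => / f w)%C z (- l / (f z * f z)).
Proof.
  intros H0 Hf. replace (- l / (f z * f z))%C with (- / (f z * f z) * l)%C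
    by (field; exact H0).
  apply (cdiff_comp Cinv); [apply cdiff_Cinv, H0 | exact Hf].
Qed.

Lemma cdiff_opp (f : C -> C) (z l : C) : cdiff f z l -> cdiff (fun w => - f w)%C z (- l).
Proof.
  intros [p [Hp [Lp Ep]]]. exists (fun w => - p w)%C. split; [apply cont_at_opp, Hp | split].
  - rewrite Lp. reflexivity.
  - intros w. rewrite (Ep w). ring.
Qed.

Lemma cdiff_minus (f g : C -> C) (z l m : C) :
  cdiff f z l -> cdiff g z m -> cdiff (fun w => f w - g w)%C z (l - m).
Proof. intros Hf Hg. apply cdiff_plus; [exact Hf | apply cdiff_opp, Hg]. Qed.

Lemma cdiff_eq (f : C -> C) (z l m : C) : l = m -> cdiff f z l -> cdiff f z m.
Proof. intros ->. auto. Qed.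

(** * Holomorphic functions on open sets *)

Definition Disc (c : C) (r : R) : C -> Prop := fun z => Cmod (z - c) < r.
Definition plane : C -> Prop := fun _ => True.

Definition Cconvex (U : C -> Prop) : Prop :=
  forall a b t, U a -> U b -> 0 <= t <= 1 -> U (a + t * (b - a))%C.

Definition Hol (U : C -> Prop) (f : C -> C) : Prop :=
  forall z, U z -> exists l, cdiff f z l.

Lemma open_C_iff (U : C -> Prop) :
  open U <-> forall z, U z -> exists d, 0 < d /\ forall w, Cmod (w - z) < d -> U w.
Proof. split; intros H z Hz; specialize (H z Hz); apply locally_C_iff in H; exact H. Qed.

Lemma open_locally (U : C -> Prop) (z : C) : open U -> U z -> locally z U.
Proof. intros H Hz. exact (H z Hz). Qed.

Lemma open_disc (c : C) (r : R) : open (Disc c r).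
Proof.
  apply open_C_iff. intros z Hz. exists (r - Cmod (z - c)). split; unfold Disc in *; [lra |].
  intros w Hw. generalize (Cmod_tri_sub w z c). lra.
Qed.

Lemma open_plane : open plane.
Proof. apply open_C_iff. intros z _. exists 1. split; [lra | intros; exact I]. Qed.

Lemma convex_disc (c : C) (r : R) : Cconvex (Disc c r).
Proof.
  intros a b t Ha Hb Ht. unfold Disc in *.
  replace (a + t * (b - a) - c)%C with ((1 - t)%R * (a - c) + t * (b - c))%C
    by (rewrite RtoC_minus; ring).
  eapply Rle_lt_trans; [apply Cmod_triangle |].
  rewrite !Cmod_mult, !Cmod_RtoC_pos by lra.
  destruct (Req_dec t 0) as [-> | Ht0]; nra.
Qed.

Lemma convex_plane : Cconvex plane.
Proof. intros a b t _ _ _. exact I. Qed.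

Lemma Hol_analytic (U : C -> Prop) (f : C -> C) : Hol U f <-> analytic_on U f.
Proof.
  split; intros H z Hz; destruct (H z Hz) as [l Hl]; exists l; apply cdiff_is_derive, Hl.
Qed.

Lemma Hol_derive (U : C -> Prop) (f : C -> C) (z : C) :
  Hol U f -> U z -> cdiff f z (C_derive f z).
Proof.
  intros H Hz. destruct (H z Hz) as [l Hl]. rewrite (cdiff_unique _ _ _ Hl). exact Hl.
Qed.

Lemma Hol_cont (U : C -> Prop) (f : C -> C) (z : C) : Hol U f -> U z -> cont_at f z.
Proof. intros H Hz. destruct (H z Hz) as [l Hl]. apply (cdiff_cont _ _ _ Hl). Qed.

Lemma Hol_subset (U V : C -> Prop) (f : C -> C) :
  (forall z, V z -> U z) -> Hol U f -> Hol V f.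
Proof. intros HVU H z Hz. apply H, HVU, Hz. Qed.

Lemma Hol_plane_sub (U : C -> Prop) (f : C -> C) : Hol plane f -> Hol U f.
Proof. apply Hol_subset. intros; exact I. Qed.

Lemma Hol_ext (U : C -> Prop) (f g : C -> C) :
  open U -> (forall z, U z -> f z = g z) -> Hol U f -> Hol U g.
Proof.
  intros Ho E H z Hz. destruct (H z Hz) as [l Hl]. exists l.
  apply cdiff_ext_loc with f; [| exact Hl].
  apply filter_imp with U; [exact E | apply open_locally; auto].
Qed.

Lemma Hol_const (U : C -> Prop) (c : C) : Hol U (fun _ => c).
Proof. intros z _. eexists. apply cdiff_const. Qed.

Lemma Hol_id (U : C -> Prop) : Hol U (fun z => z).
Proof. intros z _. eexists. apply cdiff_id. Qed.

Lemma Hol_plus (U : C -> Prop) (f g : C -> C) :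
  Hol U f -> Hol U g -> Hol U (fun z => f z + g z)%C.
Proof.
  intros Hf Hg z Hz. destruct (Hf z Hz), (Hg z Hz). eexists. apply cdiff_plus; eauto.
Qed.

Lemma Hol_minus (U : C -> Prop) (f g : C -> C) :
  Hol U f -> Hol U g -> Hol U (fun z => f z - g z)%C.
Proof.
  intros Hf Hg z Hz. destruct (Hf z Hz), (Hg z Hz). eexists. apply cdiff_minus; eauto.
Qed.

Lemma Hol_mult (U : C -> Prop) (f g : C -> C) :
  Hol U f -> Hol U g -> Hol U (fun z => f z * g z)%C.
Proof.
  intros Hf Hg z Hz. destruct (Hf z Hz), (Hg z Hz). eexists. apply cdiff_mult; eauto.
Qed.

Lemma Hol_inv (U : C -> Prop) (f : C -> C) :
  (forall z, U z -> f z <> RtoC 0) -> Hol U f -> Hol U (fun z => / f z)%C.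
Proof.
  intros H0 Hf z Hz. destruct (Hf z Hz). eexists. apply cdiff_inv; eauto.
Qed.

Lemma Hol_div (U : C -> Prop) (f g : C -> C) :
  (forall z, U z -> g z <> RtoC 0) -> Hol U f -> Hol U g -> Hol U (fun z => f z / g z)%C.
Proof. intros H0 Hf Hg. apply Hol_mult; [exact Hf | apply Hol_inv; auto]. Qed.

Lemma Hol_pow (U : C -> Prop) (f : C -> C) (n : nat) :
  Hol U f -> Hol U (fun z => f z ^ n)%C.
Proof.
  intros Hf. induction n as [| n IH]; simpl; [apply Hol_const | apply Hol_mult; auto].
Qed.

(** * Integrals of complex-valued functions of a real variable *)

(** Componentwise, which makes the theory of the real integral available. *)
Definition CInt (f : R -> C) (a b : R) : C :=
  (RInt (fun t => fst (f t)) a b, RInt (fun t => snd (f t)) a b).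

Definition cont_on (f : R -> C) (a b : R) : Prop :=
  forall t, a <= t <= b -> cont_at f t.

Lemma abs_fst_le (z : C) : Rabs (fst z) <= Cmod z.
Proof. eapply Rle_trans; [apply Rmax_l | apply Rmax_Cmod]. Qed.

Lemma abs_snd_le (z : C) : Rabs (snd z) <= Cmod z.
Proof. eapply Rle_trans; [apply Rmax_r | apply Rmax_Cmod]. Qed.

Lemma Cmod_le_abs (z : C) : Cmod z <= Rabs (fst z) + Rabs (snd z).
Proof.
  replace z with (RtoC (fst z) + Ci * RtoC (snd z))%C at 1.
  - eapply Rle_trans; [apply Cmod_triangle |].
    rewrite Cmod_mult, Cmod_Ci, !Cmod_R. lra.
  - apply injective_projections; simpl; ring.
Qed.

Lemma cont_at_fst (f : R -> C) (t : R) : cont_at f t -> continuous (fun s => fst (f s)) t.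
Proof.
  intros H. apply filterlim_locally. intros eps.
  generalize (H eps (cond_pos eps)). apply filter_imp. intros s Hs.
  change (Rabs (fst (f s - f t)%C) < eps). eapply Rle_lt_trans; [apply abs_fst_le | exact Hs].
Qed.

Lemma cont_at_snd (f : R -> C) (t : R) : cont_at f t -> continuous (fun s => snd (f s)) t.
Proof.
  intros H. apply filterlim_locally. intros eps.
  generalize (H eps (cond_pos eps)). apply filter_imp. intros s Hs.
  change (Rabs (snd (f s - f t)%C) < eps). eapply Rle_lt_trans; [apply abs_snd_le | exact Hs].
Qed.

Lemma cont_at_pair (f : R -> C) (t : R) :
  continuous (fun s => fst (f s)) t -> continuous (fun s => snd (f s)) t -> cont_at f t.
Proof.
  intros H1 H2 eps He. assert (He2 : 0 < eps / 2) by lra.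
  assert (K1 := proj1 (filterlim_locally _ _) H1). assert (K2 := proj1 (filterlim_locally _ _) H2).
  generalize (filter_and _ _ (K1 (mkposreal _ He2)) (K2 (mkposreal _ He2))).
  apply filter_imp. intros s [A B].
  change (Rabs (fst (f s - f t)%C) < eps / 2) in A.
  change (Rabs (snd (f s - f t)%C) < eps / 2) in B.
  eapply Rle_lt_trans; [apply Cmod_le_abs | lra].
Qed.

Lemma ex_RInt_fst (f : R -> C) (a b : R) :
  a <= b -> cont_on f a b -> ex_RInt (fun t => fst (f t)) a b.
Proof.
  intros Hab H. apply (ex_RInt_continuous (V := R_CompleteNormedModule)).
  rewrite Rmin_left, Rmax_right by exact Hab. intros t Ht. apply cont_at_fst, H, Ht.
Qed.

Lemma ex_RInt_snd (f : R -> C) (a b : R) :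
  a <= b -> cont_on f a b -> ex_RInt (fun t => snd (f t)) a b.
Proof.
  intros Hab H. apply (ex_RInt_continuous (V := R_CompleteNormedModule)).
  rewrite Rmin_left, Rmax_right by exact Hab. intros t Ht. apply cont_at_snd, H, Ht.
Qed.

Lemma CInt_ext (f g : R -> C) (a b : R) :
  a <= b -> (forall t, a <= t <= b -> f t = g t) -> CInt f a b = CInt g a b.
Proof.
  intros Hab H. unfold CInt. f_equal; apply RInt_ext;
    rewrite Rmin_left, Rmax_right by exact Hab; intros t Ht; rewrite H; auto; lra.
Qed.

Lemma CInt_const (c : C) (a b : R) : CInt (fun _ => c) a b = ((b - a)%R * c)%C.
Proof.
  unfold CInt. rewrite !RInt_const. unfold scal; simpl; unfold mult; simpl.
  apply injective_projections; simpl; ring.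
Qed.

Lemma CInt_plus (f g : R -> C) (a b : R) :
  a <= b -> cont_on f a b -> cont_on g a b ->
  CInt (fun t => f t + g t)%C a b = (CInt f a b + CInt g a b)%C.
Proof.
  intros Hab Hf Hg. unfold CInt. apply injective_projections; simpl.
  - apply (RInt_plus (V := R_CompleteNormedModule)); apply ex_RInt_fst; auto.
  - apply (RInt_plus (V := R_CompleteNormedModule)); apply ex_RInt_snd; auto.
Qed.

Lemma CInt_scal (c : C) (f : R -> C) (a b : R) :
  a <= b -> cont_on f a b -> CInt (fun t => c * f t)%C a b = (c * CInt f a b)%C.
Proof.
  intros Hab Hf. assert (H1 := ex_RInt_fst _ _ _ Hab Hf). assert (H2 := ex_RInt_snd _ _ _ Hab Hf).
  unfold CInt. apply injective_projections; simpl.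
  - transitivity (RInt (fun t => minus (scal (fst c) (fst (f t))) (scal (snd c) (snd (f t)))) a b).
    + apply RInt_ext. intros; reflexivity.
    + etransitivity; [apply (RInt_minus (V := R_CompleteNormedModule));
        apply (ex_RInt_scal (V := R_NormedModule)); assumption |].
      rewrite !(RInt_scal (V := R_CompleteNormedModule)) by assumption. reflexivity.
  - transitivity (RInt (fun t => plus (scal (fst c) (snd (f t))) (scal (snd c) (fst (f t)))) a b).
    + apply RInt_ext. intros; reflexivity.
    + etransitivity; [apply (RInt_plus (V := R_CompleteNormedModule));
        apply (ex_RInt_scal (V := R_NormedModule)); assumption |].
      rewrite !(RInt_scal (V := R_CompleteNormedModule)) by assumption. reflexivity.
Qed.

Lemma CInt_bound (f : R -> C) (a b M : R) :
  a <= b -> cont_on f a b -> (forall t, a <= t <= b -> Cmod (f t) <= M) ->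
  Cmod (CInt f a b) <= (b - a) * M.
Proof.
  intros Hab Hf HM.
  (* the modulus is the Euclidean norm of the product module *)
  assert (E : forall z : C, Cmod z = @norm R_AbsRing (prod_NormedModule R_AbsRing R_NormedModule R_NormedModule) z).
  { intros z. unfold norm; simpl. unfold prod_norm, Cmod, norm; simpl. unfold abs; simpl.
    f_equal. rewrite !Rmult_1_r, <- !Rabs_mult, !Rabs_pos_eq by apply Rle_0_sqr. reflexivity. }
  rewrite E. apply (norm_RInt_le_const f).
  - exact Hab.
  - intros t Ht. rewrite <- E. apply HM, Ht.
  - apply (is_RInt_fct_extend_pair (U := R_NormedModule) (V := R_NormedModule));
      apply (RInt_correct (V := R_CompleteNormedModule)).
    + apply ex_RInt_fst; auto.
    + apply ex_RInt_snd; auto.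
Qed.

Lemma CInt_Chasles (f : R -> C) (a b c : R) :
  a <= b <= c -> cont_on f a c -> (CInt f a b + CInt f b c)%C = CInt f a c.
Proof.
  intros Hab Hf. 
  assert (cont_on f a b) by (intros t Ht; apply Hf; lra).
  assert (cont_on f b c) by (intros t Ht; apply Hf; lra).
  unfold CInt. apply injective_projections; simpl;
    apply (RInt_Chasles (V := R_CompleteNormedModule)).
  - apply ex_RInt_fst; [lra | assumption].
  - apply ex_RInt_fst; [lra | assumption].
  - apply ex_RInt_snd; [lra | assumption].
  - apply ex_RInt_snd; [lra | assumption].
Qed.

Lemma cont_at_lin (u v t : R) : continuous (fun y : R => u * y + v) t.
Proof.
  apply (continuous_plus (V := R_NormedModule) (fun y => u * y) (fun _ => v)).
  - apply (continuous_scal_r (V := R_NormedModule) u (fun y : R => y)). apply continuous_id.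
  - apply continuous_const.
Qed.

Lemma cont_at_Rcomp (f : R -> C) (g : R -> R) (t : R) :
  cont_at f (g t) -> continuous g t -> cont_at (fun s => f (g s)) t.
Proof.
  intros Hf Hg eps He. exact (Hg _ (Hf eps He)).
Qed.

Lemma CInt_lin (f : R -> C) (u v a b : R) :
  0 <= u -> a <= b -> cont_on f (u * a + v) (u * b + v) ->
  (u * CInt (fun t => f (u * t + v)%R) a b)%C = CInt f (u * a + v) (u * b + v).
Proof.
  intros Hu Hab Hf.
  assert (Hle : u * a + v <= u * b + v) by nra.
  assert (Hg : cont_on (fun t => f (u * t + v)) a b).
  { intros t Ht. apply (cont_at_Rcomp f); [apply Hf; nra | apply cont_at_lin]. }
  rewrite <- CInt_scal by auto. unfold CInt. apply injective_projections; simpl.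
  - rewrite <- (RInt_comp_lin (V := R_CompleteNormedModule)) by (apply (ex_RInt_fst f); auto).
    apply RInt_ext. intros t _. unfold scal; simpl; unfold mult; simpl. ring.
  - rewrite <- (RInt_comp_lin (V := R_CompleteNormedModule)) by (apply (ex_RInt_snd f); auto).
    apply RInt_ext. intros t _. unfold scal; simpl; unfold mult; simpl. ring.
Qed.

(** Velocity of a curve, componentwise for the real fundamental theorem of calculus. *)
Definition vdiff (g : R -> C) (t : R) (d : C) : Prop :=
  is_derive (fun s => fst (g s)) t (fst d) /\ is_derive (fun s => snd (g s)) t (snd d).

Lemma CInt_derive (g d : R -> C) (a b : R) :
  a <= b -> (forall t, a <= t <= b -> vdiff g t (d t)) -> cont_on d a b ->
  CInt d a b = (g b - g a)%C.
Proof.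
  intros Hab Hd Hc. unfold CInt. apply injective_projections; simpl.
  - apply is_RInt_unique. apply (is_RInt_derive (V := R_CompleteNormedModule) (fun s => fst (g s)) (fun s => fst (d s)));
      rewrite Rmin_left, Rmax_right by exact Hab; intros t Ht.
    + apply Hd, Ht.
    + apply cont_at_fst, Hc, Ht.
  - apply is_RInt_unique. apply (is_RInt_derive (V := R_CompleteNormedModule) (fun s => snd (g s)) (fun s => snd (d s)));
      rewrite Rmin_left, Rmax_right by exact Hab; intros t Ht.
    + apply Hd, Ht.
    + apply cont_at_snd, Hc, Ht.
Qed.

Lemma vdiff_eps (g : R -> C) (t : R) (d : C) :
  vdiff g t d <->
  (forall eps, 0 < eps -> exists del, 0 < del /\ forall s, Rabs (s - t) < del ->
     Cmod (g s - g t - (s - t)%R * d) <= eps * Rabs (s - t)).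
Proof.
  assert (Hr : forall (f : R -> R) l, is_derive f t l <->
    (forall eps, 0 < eps -> exists del, 0 < del /\ forall s, Rabs (s - t) < del ->
     Rabs (f s - f t - (s - t) * l) <= eps * Rabs (s - t))).
  { intros f l. split.
    - intros [_ H] eps He.
      specialize (H t (fun P HP => HP) (mkposreal eps He)). destruct H as [del H].
      exists del. split; [apply cond_pos |]. intros s Hs. exact (H s Hs).
    - intros H. split; [apply is_linear_scal_l |].
      intros x Hx. assert (E := is_filter_lim_locally_unique (V := R_NormedModule) t x Hx). subst x.
      intros [eps He]. destruct (H eps He) as [del [Hd H1]].
      exists (mkposreal del Hd). intros s Hs. exact (H1 s Hs). }
  unfold vdiff. rewrite !Hr. split.
  - intros [H1 H2] eps He. assert (He2 : 0 < eps / 2) by lra.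
    destruct (H1 _ He2) as [d1 [Hd1 K1]]. destruct (H2 _ He2) as [d2 [Hd2 K2]].
    exists (Rmin d1 d2). split; [apply Rmin_glb_lt; auto |]. intros s Hs.
    specialize (K1 s (Rlt_le_trans _ _ _ Hs (Rmin_l _ _))).
    specialize (K2 s (Rlt_le_trans _ _ _ Hs (Rmin_r _ _))).
    eapply Rle_trans; [apply Cmod_le_abs |]. simpl.
    match goal with |- Rabs ?x + Rabs ?y <= _ =>
      replace x with (fst (g s) - fst (g t) - (s - t) * fst d) by ring;
      replace y with (snd (g s) - snd (g t) - (s - t) * snd d) by ring end.
    lra.
  - intros H. split; intros eps He; destruct (H eps He) as [del [Hd K]];
      exists del; (split; [exact Hd |]); intros s Hs; specialize (K s Hs);
      (eapply Rle_trans; [| exact K]).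
    + match type of K with Cmod ?z <= _ => replace (fst (g s) - fst (g t) - (s - t) * fst d) with (fst z) by (simpl; ring) end.
      apply abs_fst_le.
    + match type of K with Cmod ?z <= _ => replace (snd (g s) - snd (g t) - (s - t) * snd d) with (snd z) by (simpl; ring) end.
      apply abs_snd_le.
Qed.

Lemma vdiff_comp (f : C -> C) (g : R -> C) (t : R) (l d : C) :
  cdiff f (g t) l -> vdiff g t d -> vdiff (fun s => f (g s)) t (l * d).
Proof.
  rewrite cdiff_eps, !vdiff_eps. intros Hf Hg eps He.
  set (A := Cmod d + 1). assert (HA : 0 < A) by (unfold A; generalize (Cmod_ge_0 d); lra).
  set (B := Cmod l + 1). assert (HB : 0 < B) by (unfold B; generalize (Cmod_ge_0 l); lra).
  destruct (Hf (eps / (2 * A))) as [d1 [Hd1 K1]]; [apply Rdiv_lt_0_compat; lra |].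
  destruct (Hg (Rmin 1 (eps / (2 * B)))) as [d2 [Hd2 K2]].
  { apply Rmin_glb_lt; [lra | apply Rdiv_lt_0_compat; lra]. }
  exists (Rmin d2 (d1 / A)). split; [apply Rmin_glb_lt; [lra | apply Rdiv_lt_0_compat; lra] |].
  intros s Hs. specialize (K2 s (Rlt_le_trans _ _ _ Hs (Rmin_l _ _))).
  assert (Hs2 := Rlt_le_trans _ _ _ Hs (Rmin_r _ _)).
  assert (Hs0 := Rabs_pos (s - t)).
  assert (M1 := Rmin_l 1 (eps / (2 * B))). assert (M2 := Rmin_r 1 (eps / (2 * B))).
  assert (Hv : Cmod (g s - g t) <= A * Rabs (s - t)).
  { replace (g s - g t)%C with ((g s - g t - (s - t)%R * d) + (s - t)%R * d)%C by ring.
    eapply Rle_trans; [apply Cmod_triangle |]. rewrite Cmod_mult, Cmod_R. unfold A. nra. }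
  assert (Hv1 : Cmod (g s - g t) < d1).
  { eapply Rle_lt_trans; [exact Hv |]. replace d1 with (A * (d1 / A)) by (field; lra).
    apply Rmult_lt_compat_l; auto. }
  specialize (K1 _ Hv1).
  replace (f (g s) - f (g t) - (s - t)%R * (l * d))%C
    with ((f (g s) - f (g t) - l * (g s - g t)) + l * (g s - g t - (s - t)%R * d))%C by ring.
  eapply Rle_trans; [apply Cmod_triangle |]. rewrite Cmod_mult.
  assert (Cmod (f (g s) - f (g t) - l * (g s - g t)) <= eps / 2 * Rabs (s - t)).
  { eapply Rle_trans; [exact K1 |].
    replace (eps / 2 * Rabs (s - t)) with (eps / (2 * A) * (A * Rabs (s - t))) by (field; lra).
    apply Rmult_le_compat_l; [| exact Hv]. apply Rlt_le, Rdiv_lt_0_compat; lra. }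
  assert (Cmod l * Cmod (g s - g t - (s - t)%R * d) <= eps / 2 * Rabs (s - t)).
  { apply Rle_trans with (B * (eps / (2 * B) * Rabs (s - t))).
    - apply Rmult_le_compat; try apply Cmod_ge_0; [unfold B; lra |].
      eapply Rle_trans; [exact K2 |]. apply Rmult_le_compat_r; auto.
    - right. field. lra. }
  lra.
Qed.

Lemma vdiff_line (a b : C) (t : R) : vdiff (fun s => a + s * b)%C t b.
Proof.
  apply vdiff_eps. intros eps He. exists 1. split; [lra |]. intros s _.
  replace (a + s * b - (a + t * b) - (s - t)%R * b)%C with (RtoC 0)
    by (rewrite RtoC_minus; ring).
  rewrite Cmod_0. apply Rmult_le_pos; [lra | apply Rabs_pos].
Qed.

Lemma cont_at_line (a b : C) (t : R) : cont_at (fun s : R => a + s * b)%C t.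
Proof.
  cont.
Qed.

(** * Integrals over segments and Goursat's theorem *)

(** Integral of [f] along the segment from [a] to [b]. *)
Definition seg_int (f : C -> C) (a b : C) : C :=
  ((b - a) * CInt (fun t => f (a + t * (b - a))%C) 0 1)%C.

Definition seg_cont (f : C -> C) (a b : C) : Prop :=
  forall t, 0 <= t <= 1 -> cont_at f (a + t * (b - a))%C.

Lemma seg_cont_on (f : C -> C) (a b : C) :
  seg_cont f a b -> cont_on (fun t => f (a + t * (b - a))%C) 0 1.
Proof.
  intros H t Ht. apply (cont_at_comp f (fun s : R => (a + s * (b - a))%C)); [apply H, Ht | apply cont_at_line].
Qed.

Lemma seg_int_bound (f : C -> C) (a b : C) (M : R) :
  seg_cont f a b -> (forall t, 0 <= t <= 1 -> Cmod (f (a + t * (b - a))%C) <= M) ->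
  Cmod (seg_int f a b) <= Cmod (b - a) * M.
Proof.
  intros Hc HM. unfold seg_int. rewrite Cmod_mult.
  apply Rmult_le_compat_l; [apply Cmod_ge_0 |].
  replace M with ((1 - 0) * M) by ring. apply CInt_bound; [lra | apply seg_cont_on, Hc | exact HM].
Qed.

Lemma seg_int_derive (f F : C -> C) (a b : C) :
  (forall t, 0 <= t <= 1 -> cdiff F (a + t * (b - a))%C (f (a + t * (b - a))%C)) ->
  seg_cont f a b -> seg_int f a b = (F b - F a)%C.
Proof.
  intros HF Hc. unfold seg_int. rewrite <- CInt_scal by (try lra; apply seg_cont_on, Hc).
  rewrite (CInt_derive (fun t => F (a + t * (b - a))%C)).
  - f_equal; f_equal; [ring | f_equal; ring].
  - lra.
  - intros t Ht. rewrite Cmult_comm. apply (vdiff_comp F (fun s => a + s * (b - a))%C); [apply HF, Ht | apply vdiff_line].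
  - intros t Ht. apply cont_at_mult; [apply cont_at_const | apply seg_cont_on; auto].
Qed.

Lemma seg_int_plus (f g : C -> C) (a b : C) :
  seg_cont f a b -> seg_cont g a b ->
  seg_int (fun z => f z + g z)%C a b = (seg_int f a b + seg_int g a b)%C.
Proof.
  intros Hf Hg. unfold seg_int.
  rewrite (CInt_plus (fun t => f (a + t * (b - a))%C) (fun t => g (a + t * (b - a))%C));
    [ring | lra | apply seg_cont_on, Hf | apply seg_cont_on, Hg].
Qed.

Lemma seg_int_const (c a b : C) : seg_int (fun _ => c) a b = (c * (b - a))%C.
Proof. unfold seg_int. rewrite CInt_const, RtoC_minus. ring. Qed.

Lemma seg_int_affine (c l p a b : C) :
  seg_int (fun z => c + l * (z - p))%C a b
  = (c * (b - a) + l * (((b - p) * (b - p) - (a - p) * (a - p)) / 2))%C.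
Proof.
  rewrite (seg_int_derive _ (fun z => c * z + l * (((z - p) * (z - p)) * / 2))%C).
  - unfold Cdiv. ring.
  - intros t Ht. eapply cdiff_eq; cycle 1.
    + apply cdiff_plus.
      * apply cdiff_mult; [apply cdiff_const | apply cdiff_id].
      * apply cdiff_mult; [apply cdiff_const |]. apply cdiff_mult; [| apply cdiff_const].
        apply cdiff_mult; (apply cdiff_minus; [apply cdiff_id | apply cdiff_const]).
    + simpl. field.
  - intros t Ht. cont.
Qed.

Lemma seg_int_split (f : C -> C) (a b : C) (s : R) :
  0 <= s <= 1 -> seg_cont f a b ->
  seg_int f a b = (seg_int f a (a + s * (b - a)) + seg_int f (a + s * (b - a)) b)%C.
Proof.
  intros Hs Hf. unfold seg_int.
  set (g := fun t : R => f (a + t * (b - a))%C).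
  assert (Hg : cont_on g 0 1) by apply seg_cont_on, Hf.
  assert (E1 : CInt (fun t => f (a + t * (a + s * (b - a) - a))%C) 0 1 = CInt (fun t => g (s * t + 0)%R) 0 1).
  { apply CInt_ext; [lra |]. intros t _. unfold g. f_equal. rewrite RtoC_plus, RtoC_mult. ring. }
  assert (E2 : CInt (fun t => f (a + s * (b - a) + t * (b - (a + s * (b - a))))%C) 0 1
               = CInt (fun t => g ((1 - s) * t + s)%R) 0 1).
  { apply CInt_ext; [lra |]. intros t _. unfold g. f_equal. rewrite RtoC_plus, RtoC_mult, RtoC_minus. ring. }
  rewrite E1, E2.
  assert (L1 := CInt_lin g s 0 0 1). assert (L2 := CInt_lin g (1 - s) s 0 1).
  replace (s * 0 + 0) with 0 in L1 by ring. replace (s * 1 + 0) with s in L1 by ring.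
  replace ((1 - s) * 0 + s) with s in L2 by ring. replace ((1 - s) * 1 + s) with 1 in L2 by ring.
  rewrite <- (CInt_Chasles g 0 s 1) by (auto; lra).
  rewrite <- L1, <- L2; try lra; try (intros t Ht; apply Hg; lra).
  rewrite RtoC_minus. ring.
Qed.

Lemma CInt_rev (g : R -> C) : cont_on g 0 1 -> CInt (fun t => g (1 - t)) 0 1 = CInt g 0 1.
Proof.
  intros Hg. assert (H1 := ex_RInt_fst g 0 1 Rle_0_1 Hg). assert (H2 := ex_RInt_snd g 0 1 Rle_0_1 Hg).
  assert (K : forall h : R -> R, ex_RInt h 0 1 -> RInt (fun t => h (1 - t)) 0 1 = RInt h 0 1).
  { intros h Hh. assert (Hh' := ex_RInt_swap _ _ _ Hh).
    assert (S := opp_RInt_swap (V := R_CompleteNormedModule) h 1 0 Hh').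
    assert (L := RInt_comp_lin (V := R_CompleteNormedModule) h (-1) 1 0 1).
    assert (X := ex_RInt_comp_lin (V := R_NormedModule) h (-1) 1 0 1).
    replace (-1 * 0 + 1) with 1 in L, X by ring. replace (-1 * 1 + 1) with 0 in L, X by ring.
    rewrite <- S, <- (L Hh').
    rewrite <- (RInt_opp (V := R_CompleteNormedModule)) by exact (X Hh').
    apply RInt_ext. intros t _. unfold opp, scal; simpl; unfold mult; simpl.
    replace (-1 * t + 1) with (1 - t) by ring. ring. }
  unfold CInt. apply injective_projections; simpl.
  - apply (K (fun t => fst (g t))), H1.
  - apply (K (fun t => snd (g t))), H2.
Qed.

Lemma seg_int_rev (f : C -> C) (a b : C) :
  seg_cont f a b -> seg_int f b a = (- seg_int f a b)%C.
Proof.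
  intros H. unfold seg_int.
  rewrite <- (CInt_rev (fun t => f (a + t * (b - a))%C)) by (apply seg_cont_on, H).
  rewrite (CInt_ext (fun t => f (b + t * (a - b))%C) (fun t => f (a + (1 - t)%R * (b - a))%C)).
  - ring.
  - lra.
  - intros t _. f_equal. rewrite RtoC_minus. ring.
Qed.

Lemma seg_int_ext (f g : C -> C) (a b : C) :
  (forall t, 0 <= t <= 1 -> f (a + t * (b - a))%C = g (a + t * (b - a))%C) ->
  seg_int f a b = seg_int g a b.
Proof. intros H. unfold seg_int. f_equal. apply CInt_ext; [lra | exact H]. Qed.

Definition hull (a b c z : C) : Prop :=
  exists s t : R, 0 <= s /\ 0 <= t /\ s + t <= 1 /\ z = (a + s * (b - a) + t * (c - a))%C.

Lemma hull_convex (a b c : C) : Cconvex (hull a b c).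
Proof.
  intros x y r [s [t [Hs [Ht [Hst ->]]]]] [s' [t' [Hs' [Ht' [Hst' ->]]]]] Hr.
  exists ((1 - r) * s + r * s'), ((1 - r) * t + r * t'). repeat split; try nra.
  rewrite !RtoC_plus, !RtoC_mult, !RtoC_minus. ring.
Qed.

Lemma hull_1 (a b c : C) : hull a b c a.
Proof. exists 0, 0. repeat split; try lra. ring. Qed.

Lemma hull_2 (a b c : C) : hull a b c b.
Proof. exists 1, 0. repeat split; try lra. ring. Qed.

Lemma hull_3 (a b c : C) : hull a b c c.
Proof. exists 0, 1. repeat split; try lra. ring. Qed.

Lemma hull_in_convex (U : C -> Prop) (a b c z : C) :
  Cconvex U -> U a -> U b -> U c -> hull a b c z -> U z.
Proof.
  intros HU Ha Hb Hc [s [t [Hs [Ht [Hst ->]]]]].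
  destruct (Req_dec (s + t) 0) as [E | E].
  - replace s with 0 by lra. replace t with 0 by lra.
    replace (a + 0 * (b - a) + 0 * (c - a))%C with a by ring. exact Ha.
  - assert (Hp : U (b + (t / (s + t))%R * (c - b))%C).
    { apply HU; auto. split.
      - apply Rle_div_r; lra.
      - apply Rle_div_l; lra. }
    assert (Hq := HU _ _ (s + t) Ha Hp ltac:(lra)).
    replace (a + s * (b - a) + t * (c - a))%C
      with (a + (s + t)%R * (b + (t / (s + t))%R * (c - b) - a))%C; [exact Hq |].
    assert (F : ((s + t)%R * (t / (s + t))%R)%C = RtoC t).
    { rewrite <- RtoC_mult. f_equal. field. exact E. }
    transitivity (a + (s + t)%R * (b - a) + ((s + t)%R * (t / (s + t))%R) * (c - b))%C; [ring |].
    rewrite F, RtoC_plus. ring.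
Qed.

(** Compactness of the square in which the barycentric coordinates [s], [t] vary:
    if [p] is not in the triangle, the distance to [p] has a positive lower
    bound. Degenerate triangles, whose points have several coordinates, are covered. *)
Lemma hull_closed (a b c p : C) :
  (forall eps, 0 < eps -> exists z, hull a b c z /\ Cmod (z - p) < eps) -> hull a b c p.
Proof.
  intros H. apply NNPP. intros Hp.
  set (sg := fun u v : R => (a + u * (b - a) + v * (c - a))%C).
  set (K := Cmod (b - a) + Cmod (c - a) + 1).
  assert (HK : 0 < K) by (unfold K; generalize (Cmod_ge_0 (b - a)), (Cmod_ge_0 (c - a)); lra).
  assert (Hdel : forall u v : R, { d : posreal |
     0 <= u <= 1 -> 0 <= v <= 1 -> forall s t, 0 <= s -> 0 <= t -> s + t <= 1 ->
       Rabs (s - u) < d -> Rabs (t - v) < d -> d <= Cmod (sg s t - p) }).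
  { intros u v. apply constructive_indefinite_description.
    destruct (Rle_dec (u + v) 1) as [Huv | Huv].
    - destruct (classic (0 <= u <= 1 /\ 0 <= v <= 1)) as [[Hu Hv] | Hn].
      + assert (Hpos : 0 < Cmod (sg u v - p)).
        { apply Cmod_sub_pos. intros E. apply Hp. exists u, v. repeat split; try lra. rewrite <- E. reflexivity. }
        assert (Hd : 0 < Cmod (sg u v - p) / (2 * K)) by (apply Rdiv_lt_0_compat; lra).
        exists (mkposreal _ Hd). simpl. intros _ _ s t Hs Ht Hst H1 H2.
        set (m := Cmod (sg u v - p)) in *.
        assert (Em : m = (m / (2 * K)) * (2 * K)) by (field; lra).
        set (d := m / (2 * K)) in *.
        assert (Cmod (sg s t - sg u v) <= d * (K - 1)).
        { replace (sg s t - sg u v)%C with ((s - u)%R * (b - a) + (t - v)%R * (c - a))%C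
            by (unfold sg; rewrite !RtoC_minus; ring).
          eapply Rle_trans; [apply Cmod_triangle |]. rewrite !Cmod_mult, !Cmod_R.
          unfold K. generalize (Cmod_ge_0 (b - a)), (Cmod_ge_0 (c - a)). nra. }
        generalize (Cmod_tri_sub (sg u v) (sg s t) p). rewrite (Cmod_sym (sg u v) (sg s t)). fold m. nra.
      + exists (mkposreal 1 Rlt_0_1). intros A B. exfalso. auto.
    - assert (Hd : 0 < (u + v - 1) / 2) by lra.
      exists (mkposreal _ Hd). simpl. intros _ _ s t Hs Ht Hst H1 H2.
      apply Rabs_lt_between in H1. apply Rabs_lt_between in H2. lra. }
  destruct (compactness_value_2d 0 1 0 1 (fun u v => proj1_sig (Hdel u v))) as [d Hd].
  destruct (H d (cond_pos d)) as [z [[s [t [Hs [Ht [Hst Hz]]]]] Hlt]].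
  apply (Hd s t); [lra | lra |]. intros [u [v [Hu [Hv [H1 [H2 H3]]]]]].
  generalize (proj2_sig (Hdel u v) Hu Hv s t Hs Ht Hst H1 H2).
  fold (sg s t) in Hz. rewrite <- Hz. lra.
Qed.

Lemma C_complete (x : nat -> C) (e : nat -> R) :
  (forall eps, 0 < eps -> exists N, forall n, (N <= n)%nat -> e n < eps) -> (forall n m, (n <= m)%nat -> Cmod (x m - x n) <= e n) ->
  exists p, forall n, Cmod (p - x n) <= e n.
Proof.
  intros He Hx.
  assert (L : forall u : nat -> R, (forall n m, (n <= m)%nat -> Rabs (u m - u n) <= e n) ->
     exists l : R, is_lim_seq u l).
  { intros u Hu. apply ex_lim_seq_cauchy_corr. intros eps.
    destruct (He (eps / 2)) as [N HN]; [generalize (cond_pos eps); lra |].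
    exists N. intros n m Hn Hm.
    replace (u n - u m) with ((u n - u N) - (u m - u N)) by ring.
    assert (A := Hu N n Hn). assert (B := Hu N m Hm).
    assert (HNN := HN N (le_n _)).
    apply Rabs_le_between in A. apply Rabs_le_between in B. apply Rabs_lt_between. lra. }
  destruct (L (fun n => fst (x n))) as [l1 H1].
  { intros n m Hnm. eapply Rle_trans; [apply (abs_fst_le (x m - x n)) | apply Hx, Hnm]. }
  destruct (L (fun n => snd (x n))) as [l2 H2].
  { intros n m Hnm. eapply Rle_trans; [apply (abs_snd_le (x m - x n)) | apply Hx, Hnm]. }
  exists (l1, l2). intros n. apply le_epsilon. intros eps Hp.
  apply is_lim_seq_spec in H1. apply is_lim_seq_spec in H2.
  assert (Hp2 : 0 < eps / 2) by lra.
  destruct (H1 (mkposreal _ Hp2)) as [N1 K1]. destruct (H2 (mkposreal _ Hp2)) as [N2 K2].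
  set (m := Nat.max n (Nat.max N1 N2)).
  assert (A := K1 m ltac:(unfold m; lia)). assert (B := K2 m ltac:(unfold m; lia)). simpl in A, B.
  generalize (Cmod_tri_sub (l1, l2) (x m) (x n)).
  assert (Cmod ((l1, l2) - x m) <= eps).
  { rewrite Cmod_sym. eapply Rle_trans; [apply Cmod_le_abs |]. simpl.
    unfold Rminus in A, B. lra. }
  assert (D := Hx n m ltac:(unfold m; lia)). lra.
Qed.

Definition tri_int (f : C -> C) (a b c : C) : C :=
  (seg_int f a b + seg_int f b c + seg_int f c a)%C.

Definition perim (a b c : C) : R := Cmod (b - a) + Cmod (c - b) + Cmod (a - c).

Lemma perim_ge_0 (a b c : C) : 0 <= perim a b c.
Proof. unfold perim. generalize (Cmod_ge_0 (b - a)), (Cmod_ge_0 (c - b)), (Cmod_ge_0 (a - c)). lra. Qed.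

Definition mid (a b : C) : C := (a + (/2)%R * (b - a))%C.

Lemma mid_half (a b c : C) : Cmod (mid a b - mid a c) = / 2 * Cmod (b - c).
Proof.
  replace (mid a b - mid a c)%C with ((/2)%R * (b - c))%C by (unfold mid; ring).
  rewrite Cmod_mult, Cmod_R, Rabs_pos_eq; lra.
Qed.

Lemma half_plus_half : (RtoC (/ 2) + RtoC (/ 2))%C = 1%C.
Proof. rewrite <- RtoC_plus. f_equal. lra. Qed.

Lemma mid_comm (a b : C) : mid a b = mid b a.
Proof.
  unfold mid. transitivity (a * ((RtoC (/ 2) + RtoC (/ 2)) - (/2)%R) + (/2)%R * b)%C.
  - rewrite half_plus_half. ring.
  - transitivity (b * ((RtoC (/ 2) + RtoC (/ 2)) - (/2)%R) + (/2)%R * a)%C; [ring |].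
    rewrite half_plus_half. ring.
Qed.

Lemma mid_self (a : C) : mid a a = a.
Proof. unfold mid. ring. Qed.

Lemma Hol_seg_cont (f : C -> C) (K : C -> Prop) (a b : C) :
  Cconvex K -> Hol K f -> K a -> K b -> seg_cont f a b.
Proof.
  intros HK Hf Ha Hb t Ht. destruct (Hf _ (HK a b t Ha Hb Ht)) as [l Hl]. apply (cdiff_cont _ _ _ Hl).
Qed.

Lemma convex_mid (K : C -> Prop) (a b : C) : Cconvex K -> K a -> K b -> K (mid a b).
Proof. intros HK Ha Hb. apply HK; auto. lra. Qed.

Lemma seg_int_mid (f : C -> C) (K : C -> Prop) (a b : C) :
  Cconvex K -> Hol K f -> K a -> K b ->
  seg_int f a b = (seg_int f a (mid a b) + seg_int f (mid a b) b)%C.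
Proof. intros. apply seg_int_split; [lra |]. apply Hol_seg_cont with K; auto. Qed.

Lemma tri_int_subdivide (f : C -> C) (K : C -> Prop) (a b c : C) :
  Cconvex K -> Hol K f -> K a -> K b -> K c ->
  tri_int f a b c =
    (tri_int f a (mid a b) (mid a c) + tri_int f (mid a b) b (mid b c)
     + tri_int f (mid a c) (mid b c) c + tri_int f (mid b c) (mid a c) (mid a b))%C.
Proof.
  intros HK Hf Ha Hb Hc.
  assert (Hab := convex_mid K a b HK Ha Hb). assert (Hbc := convex_mid K b c HK Hb Hc).
  assert (Hac := convex_mid K a c HK Ha Hc).
  unfold tri_int.
  rewrite (seg_int_mid f K a b), (seg_int_mid f K b c), (seg_int_mid f K c a) by auto.
  rewrite (mid_comm c a).
  rewrite (seg_int_rev f (mid a b) (mid a c)), (seg_int_rev f (mid b c) (mid a b)),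
    (seg_int_rev f (mid a c) (mid b c)) by (apply Hol_seg_cont with K; auto).
  ring.
Qed.

Lemma tri_int_affine (c l p x y z : C) : tri_int (fun w => c + l * (w - p))%C x y z = 0%C.
Proof. unfold tri_int. rewrite !seg_int_affine. unfold Cdiv. ring. Qed.

Lemma tri_int_plus (f g : C -> C) (a b c : C) :
  seg_cont f a b -> seg_cont f b c -> seg_cont f c a ->
  seg_cont g a b -> seg_cont g b c -> seg_cont g c a ->
  tri_int (fun z => f z + g z)%C a b c = (tri_int f a b c + tri_int g a b c)%C.
Proof. intros. unfold tri_int. rewrite !seg_int_plus by auto. ring. Qed.

Lemma tri_int_bound (f : C -> C) (K : C -> Prop) (a b c : C) (M : R) :
  Cconvex K -> K a -> K b -> K c ->
  seg_cont f a b -> seg_cont f b c -> seg_cont f c a ->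
  (forall z, K z -> Cmod (f z) <= M) -> Cmod (tri_int f a b c) <= perim a b c * M.
Proof.
  intros HK Ha Hb Hc H1 H2 H3 HM. unfold tri_int, perim.
  eapply Rle_trans; [apply Cmod_triangle |].
  eapply Rle_trans; [apply Rplus_le_compat_r, Cmod_triangle |].
  assert (A1 := seg_int_bound f a b M H1 (fun t Ht => HM _ (HK a b t Ha Hb Ht))).
  assert (A2 := seg_int_bound f b c M H2 (fun t Ht => HM _ (HK b c t Hb Hc Ht))).
  assert (A3 := seg_int_bound f c a M H3 (fun t Ht => HM _ (HK c a t Hc Ha Ht))).
  lra.
Qed.

Record triangle : Type := Tri { va : C; vb : C; vc : C }.

(** Bisection: one of four similar triangles carries at least a quarter of the
    integral, so the n-th triangle has integral at least [|T| / 4^n] and perimeter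
    [P / 2^n]. The triangles shrink to a point [p]; the affine part of [f] at [p]
    integrates to 0, and the remainder contributes [o(1 / 4^n)]. *)
Lemma Goursat (f : C -> C) (a b c : C) :
  Hol (hull a b c) f -> tri_int f a b c = 0%C.
Proof.
  intros Hf. set (K := hull a b c). fold K in Hf.
  assert (HK : Cconvex K) by apply hull_convex.
  set (I := fun t => tri_int f (va t) (vb t) (vc t)).
  set (P := fun t => perim (va t) (vb t) (vc t)).
  set (In3 := fun t => K (va t) /\ K (vb t) /\ K (vc t)).
  assert (Hstep : forall t, exists t', In3 t ->
    In3 t' /\ P t' = / 2 * P t /\ Cmod (va t' - va t) <= P t /\ Cmod (I t) <= 4 * Cmod (I t')).
  { intros [x y z]. destruct (classic (In3 (Tri x y z))) as [[Hx [Hy Hz]] | Hn].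
    2:{ exists (Tri x y z). intros; contradiction. }
    simpl in Hx, Hy, Hz.
    assert (Hxy := convex_mid K x y HK Hx Hy). assert (Hyz := convex_mid K y z HK Hy Hz).
    assert (Hxz := convex_mid K x z HK Hx Hz).
    assert (E := tri_int_subdivide f K x y z HK Hf Hx Hy Hz).
    assert (Hsum : Cmod (tri_int f x y z) <=
      Cmod (tri_int f x (mid x y) (mid x z)) + Cmod (tri_int f (mid x y) y (mid y z))
      + Cmod (tri_int f (mid x z) (mid y z) z) + Cmod (tri_int f (mid y z) (mid x z) (mid x y))).
    { rewrite E. eapply Rle_trans; [apply Cmod_triangle |]. apply Rplus_le_compat_r.
      eapply Rle_trans; [apply Cmod_triangle |]. apply Rplus_le_compat_r. apply Cmod_triangle. }
    assert (M1 : Cmod (mid x y - x) = / 2 * Cmod (y - x)).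
    { rewrite <- (mid_self x) at 2. apply mid_half. }
    assert (M2 : Cmod (mid x z - mid x y) = / 2 * Cmod (z - y)) by apply mid_half.
    assert (M3 : Cmod (x - mid x z) = / 2 * Cmod (x - z)).
    { rewrite <- (mid_self x) at 1. apply mid_half. }
    assert (M4 : Cmod (y - mid x y) = / 2 * Cmod (y - x)).
    { rewrite (mid_comm x y). rewrite <- (mid_self y) at 1. apply mid_half. }
    assert (M5 : Cmod (mid y z - y) = / 2 * Cmod (z - y)).
    { rewrite <- (mid_self y) at 2. apply mid_half. }
    assert (M6 : Cmod (mid x y - mid y z) = / 2 * Cmod (x - z)).
    { rewrite (mid_comm x y). apply mid_half. }
    assert (M7 : Cmod (mid y z - mid x z) = / 2 * Cmod (y - x)).
    { rewrite (mid_comm y z), (mid_comm x z). apply mid_half. }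
    assert (M8 : Cmod (z - mid y z) = / 2 * Cmod (z - y)).
    { rewrite (mid_comm y z). rewrite <- (mid_self z) at 1. apply mid_half. }
    assert (M9 : Cmod (mid x z - z) = / 2 * Cmod (x - z)).
    { rewrite (mid_comm x z). rewrite <- (mid_self z) at 2. apply mid_half. }
    assert (N1 := Cmod_sym (mid x z) (mid y z)). assert (N2 := Cmod_sym (mid x y) (mid x z)).
    assert (N3 := Cmod_sym (mid y z) (mid x y)).
    assert (N4 := Cmod_sym (mid x z) x). assert (N5 := Cmod_sym z y).
    assert (N6 := Cmod_tri_sub (mid y z) y x).
    assert (Q1 := Cmod_ge_0 (y - x)). assert (Q2 := Cmod_ge_0 (z - y)). assert (Q3 := Cmod_ge_0 (x - z)).
    assert (Hc : Cmod (tri_int f x y z) <= 4 * Cmod (tri_int f x (mid x y) (mid x z)) \/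
      Cmod (tri_int f x y z) <= 4 * Cmod (tri_int f (mid x y) y (mid y z)) \/
      Cmod (tri_int f x y z) <= 4 * Cmod (tri_int f (mid x z) (mid y z) z) \/
      Cmod (tri_int f x y z) <= 4 * Cmod (tri_int f (mid y z) (mid x z) (mid x y))).
    { apply NNPP. intros Hn. apply not_or_and in Hn. destruct Hn as [n1 Hn].
      apply not_or_and in Hn. destruct Hn as [n2 Hn]. apply not_or_and in Hn. destruct Hn as [n3 n4].
      apply Rnot_le_lt in n1, n2, n3, n4. lra. }
    destruct Hc as [Hc | [Hc | [Hc | Hc]]];
      [exists (Tri x (mid x y) (mid x z)) | exists (Tri (mid x y) y (mid y z))
       | exists (Tri (mid x z) (mid y z) z) | exists (Tri (mid y z) (mid x z) (mid x y))];
      intros _; unfold In3, P, perim, I; simpl;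
      (split; [repeat split; assumption |]); (split; [lra |]); (split; [| assumption]).
    - rewrite Cmod_self. lra.
    - lra.
    - lra.
    - lra. }
  set (next := fun t => proj1_sig (constructive_indefinite_description _ (Hstep t))).
  assert (Hnext : forall t, In3 t -> In3 (next t) /\ P (next t) = / 2 * P t /\
    Cmod (va (next t) - va t) <= P t /\ Cmod (I t) <= 4 * Cmod (I (next t))).
  { intros t. unfold next. apply (proj2_sig (constructive_indefinite_description _ (Hstep t))). }
  set (tr := fun n => Nat.iter n next (Tri a b c)).
  set (P0 := perim a b c).
  assert (HP0 : 0 <= P0) by apply perim_ge_0.
  assert (Htr : forall n, In3 (tr n) /\ P (tr n) = P0 * (/ 2) ^ n /\
                 Cmod (tri_int f a b c) <= 4 ^ n * Cmod (I (tr n))).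
  { induction n as [| n [A [B D]]].
    - simpl. repeat split; try apply hull_1; try apply hull_2; try apply hull_3.
      + unfold P, P0. simpl. ring.
      + unfold I. simpl. lra.
    - destruct (Hnext _ A) as [A' [B' [_ D']]]. change (tr (S n)) with (next (tr n)).
      split; [exact A' | split].
      + rewrite B', B. simpl. ring.
      + simpl. assert (0 < 4 ^ n) by (apply pow_lt; lra). nra. }
  assert (Hcau : forall n m, (n <= m)%nat -> Cmod (va (tr m) - va (tr n)) <= 2 * P0 * (/ 2) ^ n).
  { assert (G : forall n k, Cmod (va (tr (k + n)%nat) - va (tr n)) <= 2 * P0 * (/ 2) ^ n - 2 * P0 * (/ 2) ^ (k + n)).
    { intros n k. induction k as [| k IH].
      - simpl. rewrite Cmod_self. lra.
      - change (tr (S k + n)%nat) with (next (tr (k + n)%nat)).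
        destruct (Htr (k + n)%nat) as [A [B _]]. destruct (Hnext _ A) as [_ [_ [D _]]].
        generalize (Cmod_tri_sub (va (next (tr (k + n)%nat))) (va (tr (k + n)%nat)) (va (tr n))).
        simpl pow. rewrite B in D. lra. }
    intros n m Hnm. replace m with ((m - n) + n)%nat by lia.
    generalize (G n (m - n)%nat). assert (0 < (/ 2) ^ (m - n + n)) by (apply pow_lt; lra). nra. }
  destruct (C_complete (fun n => va (tr n)) (fun n => 2 * P0 * (/ 2) ^ n)) as [p Hp].
  { intros eps He. destruct (geom_small (2 * P0) (/ 2) eps) as [N HN]; [lra | exact He |].
    exists N. intros n Hn. eapply Rle_lt_trans; [| exact HN]. apply Rmult_le_compat_l; [lra |].
    replace n with (N + (n - N))%nat by lia. rewrite pow_add.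
    assert (0 < (/ 2) ^ N) by (apply pow_lt; lra).
    assert ((/ 2) ^ (n - N) <= 1) by (rewrite <- (pow1 (n - N)); apply pow_incr; lra). nra. }
  { exact Hcau. }
  assert (HpK : K p).
  { apply hull_closed. intros eps He. destruct (geom_small (2 * P0) (/ 2) eps ltac:(lra) He) as [n Hn].
    exists (va (tr n)). split; [apply (Htr n) |]. rewrite Cmod_sym. specialize (Hp n). lra. }
  destruct (Hf p HpK) as [l Hl].
  apply Cmod_eq_0. apply Rle_antisym; [| apply Cmod_ge_0].
  apply le_epsilon. intros eps He. rewrite Rplus_0_l.
  set (eta := eps / (3 * (P0 * P0) + 1)).
  assert (Heta : 0 < eta) by (apply Rdiv_lt_0_compat; nra).
  assert (Heta2 : eta * (3 * (P0 * P0)) <= eps).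
  { assert (eta * (3 * (P0 * P0) + 1) = eps) by (unfold eta; field; nra). nra. }
  destruct (proj1 (cdiff_eps f p l) Hl eta Heta) as [d [Hd Hfd]].
  destruct (geom_small (3 * P0) (/ 2) d ltac:(lra) Hd) as [n Hn].
  destruct (Htr n) as [[Ka [Kb Kc]] [HP HI]].
  set (T := tr n) in *. set (q := (/ 2) ^ n) in *.
  assert (Hq : 0 < q) by (apply pow_lt; lra).
  assert (Hpn := Hp n). cbv beta in Hpn. fold q in Hpn.
  set (x := va T) in *. set (y := vb T) in *. set (z := vc T) in *.
  (* all of the small triangle lies within [3 P0 / 2^n] of [p] *)
  set (K' := fun w => K w /\ Cmod (w - p) <= 3 * P0 * q).
  assert (HPd : Cmod (y - x) + Cmod (z - y) + Cmod (x - z) = P0 * q) by exact HP.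
  assert (HK' : Cconvex K').
  { intros u v t [Hu1 Hu2] [Hv1 Hv2] Ht. split; [apply HK; auto |].
    replace (u + t * (v - u) - p)%C with ((1 - t)%R * (u - p) + t * (v - p))%C
      by (rewrite RtoC_minus; ring).
    eapply Rle_trans; [apply Cmod_triangle |]. rewrite !Cmod_mult, !Cmod_RtoC_pos by lra. nra. }
  fold T in Hpn. fold x in Hpn. assert (HPq : 0 <= P0 * q) by (apply Rmult_le_pos; lra).
  assert (Kx : K' x).
  { split; [exact Ka |]. rewrite Cmod_sym. lra. }
  assert (S1 := Cmod_sym p x). assert (S2 := Cmod_sym x z).
  assert (G1 := Cmod_ge_0 (y - x)). assert (G2 := Cmod_ge_0 (z - y)). assert (G3 := Cmod_ge_0 (x - z)).
  assert (Ky : K' y).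
  { split; [exact Kb |]. generalize (Cmod_tri_sub y x p). lra. }
  assert (Kz : K' z).
  { split; [exact Kc |]. generalize (Cmod_tri_sub z x p). lra. }
  set (r := fun w => (f w - f p - l * (w - p))%C).
  set (g := fun w => (f p + l * (w - p))%C).
  assert (Ef : forall w, f w = (r w + g w)%C) by (intros w; unfold r, g; ring).
  assert (Hgc : forall u v, seg_cont g u v).
  { intros u v t _. unfold g. cont. }
  assert (Hfc : forall u v, K u -> K v -> seg_cont f u v).
  { intros u v Hu Hv. apply Hol_seg_cont with K; auto. }
  assert (Hrc : forall u v, K u -> K v -> seg_cont r u v).
  { intros u v Hu Hv t Ht. unfold r. assert (cont_at f (u + t * (v - u))%C) by (apply Hfc; auto). cont. }
  assert (EI : I T = tri_int r x y z).
  { unfold I. fold x y z.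
    transitivity (tri_int (fun w => r w + g w)%C x y z).
    - unfold tri_int. rewrite !(seg_int_ext f (fun w => r w + g w)%C) by (intros; apply Ef). reflexivity.
    - rewrite tri_int_plus by auto. unfold g at 1. rewrite tri_int_affine. ring. }
  assert (Hb : Cmod (tri_int r x y z) <= perim x y z * (eta * (3 * P0 * q))).
  { apply tri_int_bound with K'; auto. intros w [_ Hw].
    eapply Rle_trans; [apply Hfd; lra |]. apply Rmult_le_compat_l; lra. }
  rewrite EI in HI. unfold perim in Hb. rewrite HPd in Hb.
  assert (Hq4 : 4 ^ n * (q * q) = 1).
  { unfold q. rewrite <- !Rpow_mult_distr. replace (4 * (/ 2 * / 2)) with 1 by field. apply pow1. }
  assert (0 < 4 ^ n) by (apply pow_lt; lra).
  eapply Rle_trans; [exact HI |].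
  apply Rle_trans with (4 ^ n * (P0 * q * (eta * (3 * P0 * q)))).
  - apply Rmult_le_compat_l; lra.
  - replace (4 ^ n * (P0 * q * (eta * (3 * P0 * q)))) with (4 ^ n * (q * q) * (eta * (3 * (P0 * P0)))) by ring.
    rewrite Hq4. lra.
Qed.

(** * Primitives on convex sets *)

Lemma seg_combination (a x y : C) (s t : R) :
  0 <= s -> 0 <= t -> 0 < s + t -> (s * (x - a) + t * (y - a))%C = 0%C ->
  exists u, 0 <= u <= 1 /\ a = (x + u * (y - x))%C.
Proof.
  intros Hs Ht Hst E. exists (t / (s + t)). split; [split |].
  - apply Rle_div_r; lra.
  - apply Rle_div_l; lra.
  - assert (Hn : (RtoC s + RtoC t)%C <> 0%C).
    { rewrite <- RtoC_plus. intros F. apply RtoC_inj in F. lra. }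
    rewrite RtoC_div, RtoC_plus by lra.
    transitivity ((s * x + t * y - (s * (x - a) + t * (y - a))) / (s + t))%C.
    + field. exact Hn.
    + rewrite E. field. exact Hn.
Qed.

(** If [a] lies between [x] and [y] the three integrals cancel by additivity.
    Otherwise a small similar triangle is cut off at [a]: the rest is made of two
    triangles avoiding [a], with integral 0 by Goursat, and the integral over the
    small one tends to 0 with its perimeter. *)
Lemma tri_int_punctured (U : C -> Prop) (f : C -> C) (a x y : C) :
  Cconvex U -> (forall z, U z -> cont_at f z) ->
  (forall z, U z -> z <> a -> exists l, cdiff f z l) ->
  U a -> U x -> U y -> tri_int f a x y = 0%C.
Proof.
  intros HU Hc Hf Ha Hx Hy.
  assert (Hs : forall u v, U u -> U v -> seg_cont f u v).
  { intros u v Hu Hv t Ht. apply Hc, HU; auto. }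
  destruct (classic (exists u, 0 <= u <= 1 /\ a = (x + u * (y - x))%C)) as [[u [Hu E]] | Hn].
  - unfold tri_int. rewrite (seg_int_split f x y u Hu) by auto. rewrite <- E.
    rewrite (seg_int_rev f a x), (seg_int_rev f a y) by auto. ring.
  - assert (Hscale : forall s v, 0 <= s <= 1 -> U v -> U (a + s * (v - a))%C) by (intros; apply HU; auto).
    assert (Hsmall : forall s, 0 < s <= 1 ->
       tri_int f a x y = tri_int f a (a + s * (x - a))%C (a + s * (y - a))%C).
    { intros s Hs1. set (x' := (a + s * (x - a))%C). set (y' := (a + s * (y - a))%C).
      assert (Hx' : U x') by (apply Hscale; auto; lra).
      assert (Hy' : U y') by (apply Hscale; auto; lra).
      assert (T1 : tri_int f x' x y = 0%C).
      { apply Goursat. intros z Hz. apply Hf; [apply (hull_in_convex U x' x y); auto |].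
        intros ->. apply Hn. destruct Hz as [p [q [Hp [Hq [Hpq E]]]]].
        apply (seg_combination a x y ((1 - p - q) * s + p) q); [assert (0 <= (1 - p - q) * s) by (apply Rmult_le_pos; lra); lra | lra | assert (0 <= (1 - s) * (p + q)) by (apply Rmult_le_pos; lra); lra |].
        replace (RtoC 0) with ((a - a) : C) by ring. rewrite E at 3. unfold x'.
        rewrite RtoC_plus, RtoC_mult, !RtoC_minus. ring. }
      assert (T2 : tri_int f x' y y' = 0%C).
      { apply Goursat. intros z Hz. apply Hf; [apply (hull_in_convex U x' y y'); auto |].
        intros ->. apply Hn. destruct Hz as [p [q [Hp [Hq [Hpq E]]]]].
        apply (seg_combination a x y ((1 - p - q) * s) (p + q * s)).
        - apply Rmult_le_pos; lra.
        - assert (0 <= q * s) by (apply Rmult_le_pos; lra). lra.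
        - assert (0 <= (1 - s) * p) by (apply Rmult_le_pos; lra). lra.
        - replace (RtoC 0) with ((a - a) : C) by ring. rewrite E at 3. unfold x', y'.
          rewrite RtoC_plus, !RtoC_mult, !RtoC_minus. ring. }
      assert (E1 := seg_int_split f a x s ltac:(lra) (Hs a x Ha Hx)). fold x' in E1.
      assert (E2 := seg_int_split f a y s ltac:(lra) (Hs a y Ha Hy)). fold y' in E2.
      assert (R1 := seg_int_rev f a y (Hs _ _ Ha Hy)).
      assert (R2 := seg_int_rev f a y' (Hs _ _ Ha Hy')).
      assert (R3 := seg_int_rev f y' y (Hs _ _ Hy' Hy)).
      assert (R4 := seg_int_rev f x' y (Hs _ _ Hx' Hy)).
      assert (R5 := seg_int_rev f x' y' (Hs _ _ Hx' Hy')).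
      unfold tri_int in *.
      replace (seg_int f a x + seg_int f x y + seg_int f y a)%C
        with ((seg_int f a x' + seg_int f x' y' + seg_int f y' a) + (seg_int f x' x + seg_int f x y + seg_int f y x')
          + (seg_int f x' y + seg_int f y y' + seg_int f y' x'))%C.
      - rewrite T1, T2. ring.
      - rewrite R1, R2, R3, R4, R5, E1, E2. ring. }
    apply Cmod_arbitrarily_small. intros eps He.
    destruct (proj1 (cont_at_C f a) (Hc a Ha) 1 Rlt_0_1) as [d [Hd Hfd]].
    set (M := Cmod (f a) + 1). assert (HM : 0 < M) by (unfold M; generalize (Cmod_ge_0 (f a)); lra).
    assert (HP := perim_ge_0 a x y). set (P := perim a x y) in *.
    set (s := Rmin 1 (Rmin (d / (P + 1)) (eps / ((P + 1) * M)))).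
    assert (Hs0 : 0 < s).
    { unfold s. repeat apply Rmin_glb_lt; [lra | |]; apply Rdiv_lt_0_compat; try lra. apply Rmult_lt_0_compat; lra. }
    assert (Hs1 : s <= 1) by apply Rmin_l.
    assert (Hs2 : s <= d / (P + 1)) by (eapply Rle_trans; [apply Rmin_r | apply Rmin_l]).
    assert (Hs3 : s <= eps / ((P + 1) * M)) by (eapply Rle_trans; [apply Rmin_r | apply Rmin_r]).
    assert (Hs2' : s * (P + 1) <= d).
    { apply Rle_div_r; lra. }
    assert (Hs3' : s * ((P + 1) * M) <= eps).
    { apply Rle_div_r; [apply Rmult_lt_0_compat; lra | exact Hs3]. }
    rewrite (Hsmall s) by lra.
    set (x' := (a + s * (x - a))%C). set (y' := (a + s * (y - a))%C).
    assert (Hx' : U x') by (apply Hscale; auto; lra).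
    assert (Hy' : U y') by (apply Hscale; auto; lra).
    assert (EP : perim a x' y' = s * P).
    { unfold perim, P, perim.
      replace (x' - a)%C with (s * (x - a))%C by (unfold x'; ring).
      replace (y' - x')%C with (s * (y - x))%C by (unfold x', y'; ring).
      replace (a - y')%C with (s * (a - y))%C by (unfold y'; ring).
      rewrite !Cmod_mult, !Cmod_RtoC_pos by lra. ring. }
    assert (Hdist : forall v : C, U v -> Cmod (v - a) <= P -> Disc a d (a + s * (v - a))%C).
    { intros v _ Hv. unfold Disc. replace (a + s * (v - a) - a)%C with (s * (v - a))%C by ring.
      rewrite Cmod_mult, Cmod_RtoC_pos by lra. nra. }
    eapply Rle_trans.
    + apply (tri_int_bound f (Disc a d) a x' y' M); auto.
      * apply convex_disc.
      * unfold Disc. rewrite Cmod_self. exact Hd.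
      * apply Hdist; auto. unfold P, perim. generalize (Cmod_ge_0 (y - x)), (Cmod_ge_0 (a - y)). lra.
      * apply Hdist; auto. unfold P, perim. rewrite (Cmod_sym a y).
        generalize (Cmod_ge_0 (y - x)), (Cmod_ge_0 (x - a)). lra.
      * intros z Hz. unfold M. specialize (Hfd z Hz). generalize (Cmod_rev (f z) (f a)). lra.
    + rewrite EP. nra.
Qed.

Lemma primitive_of_triangles (U : C -> Prop) (f : C -> C) (a : C) :
  open U -> Cconvex U -> U a -> (forall z, U z -> cont_at f z) ->
  (forall x y, U x -> U y -> tri_int f a x y = 0%C) ->
  forall z, U z -> cdiff (seg_int f a) z (f z).
Proof.
  intros Ho HU Ha Hc HT z Hz. apply cdiff_eps. intros eps He.
  destruct (proj1 (open_C_iff U) Ho z Hz) as [d1 [Hd1 HU1]].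
  destruct (proj1 (cont_at_C f z) (Hc z Hz) eps He) as [d2 [Hd2 Hf]].
  exists (Rmin d1 d2). split; [apply Rmin_glb_lt; auto |]. intros w Hw.
  destruct (Rmin_lt _ _ _ Hw) as [Hw1 Hw2].
  assert (Hs : forall u v, U u -> U v -> seg_cont f u v).
  { intros u v Hu Hv t Ht. apply Hc, HU; auto. }
  assert (Uw : U w) by auto.
  assert (E := HT z w Hz Uw). unfold tri_int in E.
  rewrite (seg_int_rev f a w) in E by auto.
  assert (E2 : (seg_int f a w - seg_int f a z)%C = seg_int f z w).
  { transitivity (seg_int f z w - (seg_int f a z + seg_int f z w + - seg_int f a w))%C; [ring |].
    rewrite E. ring. }
  rewrite E2.
  assert (E3 : (seg_int f z w - f z * (w - z))%C = seg_int (fun v => f v + - f z)%C z w).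
  { rewrite (seg_int_plus f (fun _ => - f z)%C).
    - rewrite seg_int_const. ring.
    - auto.
    - intros t _. apply cont_at_const. }
  rewrite E3, Rmult_comm. apply seg_int_bound.
  - intros t Ht. apply cont_at_plus; [apply Hs; auto | apply cont_at_const].
  - intros t Ht. apply Rlt_le, Hf.
    replace (z + t * (w - z) - z)%C with (t * (w - z))%C by ring.
    rewrite Cmod_mult, Cmod_RtoC_pos by lra. generalize (Cmod_ge_0 (w - z)). nra.
Qed.

Lemma primitive_punctured (U : C -> Prop) (f : C -> C) (a : C) :
  open U -> Cconvex U -> U a -> (forall z, U z -> cont_at f z) ->
  (forall z, U z -> z <> a -> exists l, cdiff f z l) ->
  exists F, forall z, U z -> cdiff F z (f z).
Proof.
  intros Ho HU Ha Hc Hf. exists (seg_int f a). apply primitive_of_triangles; auto.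
  intros x y Hx Hy. apply tri_int_punctured with U; auto.
Qed.

Lemma primitive_exists (U : C -> Prop) (f : C -> C) :
  open U -> Cconvex U -> Hol U f -> exists F, forall z, U z -> cdiff F z (f z).
Proof.
  intros Ho HU Hf. destruct (classic (exists a, U a)) as [[a Ha] | Hn].
  - apply (primitive_punctured U f a); auto. intros z Hz. apply (Hol_cont U); auto.
  - exists f. intros z Hz. exfalso. eauto.
Qed.

(** * Cauchy's integral formula *)

Definition expi (t : R) : C := (cos t, sin t).

Lemma Cmod_expi (t : R) : Cmod (expi t) = 1.
Proof.
  unfold Cmod, expi; simpl. rewrite !Rmult_1_r.
  replace (cos t * cos t + sin t * sin t) with 1; [apply sqrt_1 |].
  generalize (sin2_cos2 t). unfold Rsqr. lra.
Qed.

Lemma vdiff_expi (t : R) : vdiff expi t (Ci * expi t)%C.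
Proof.
  unfold vdiff, expi; simpl. split.
  - evar_last; [apply is_derive_cos | ring].
  - evar_last; [apply is_derive_sin | ring].
Qed.

Lemma vdiff_cont (g : R -> C) (t : R) (d : C) : vdiff g t d -> cont_at g t.
Proof.
  intros [H1 H2]. apply cont_at_pair.
  - apply (ex_derive_continuous (V := R_NormedModule) (fun s => fst (g s))). eexists. apply H1.
  - apply (ex_derive_continuous (V := R_NormedModule) (fun s => snd (g s))). eexists. apply H2.
Qed.

Definition circ (c : C) (r : R) (t : R) : C := (c + r * expi t)%C.

Lemma cont_at_expi (t : R) : cont_at expi t.
Proof. apply (vdiff_cont _ _ _ (vdiff_expi t)). Qed.

Lemma cont_at_circ (c : C) (r t : R) : cont_at (circ c r) t.
Proof.
  assert (H := cont_at_expi t). unfold circ. cont.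
Qed.

Lemma Cmod_circ (c : C) (r t : R) : 0 <= r -> Cmod (circ c r t - c) = r.
Proof.
  intros Hr. unfold circ. replace (c + r * expi t - c)%C with (r * expi t)%C by ring.
  rewrite Cmod_mult, Cmod_expi, Cmod_RtoC_pos by auto. ring.
Qed.

Lemma vdiff_circ (c : C) (r t : R) : vdiff (circ c r) t (Ci * (circ c r t - c))%C.
Proof.
  replace (Ci * (circ c r t - c))%C with (r * (Ci * expi t))%C by (unfold circ; ring).
  apply (vdiff_comp (fun z => c + r * z)%C).
  - eapply cdiff_eq; cycle 1.
    + apply cdiff_plus; [apply cdiff_const | apply cdiff_mult; [apply cdiff_const | apply cdiff_id]].
    + simpl. ring.
  - apply vdiff_expi.
Qed.

(** Mean over one period. *)
Definition avg (f : R -> C) : C := (/ (2 * PI)%R * CInt f 0 (2 * PI))%C.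

Definition periodic_cont (f : R -> C) : Prop := cont_on f 0 (2 * PI).

Lemma two_PI_pos : 0 < 2 * PI.
Proof. generalize PI_RGT_0. lra. Qed.

Lemma two_PI_neq : RtoC (2 * PI) <> 0%C.
Proof. intros E. apply RtoC_inj in E. generalize two_PI_pos. lra. Qed.

Lemma avg_ext (f g : R -> C) : (forall t, f t = g t) -> avg f = avg g.
Proof. intros H. unfold avg. f_equal. apply CInt_ext; auto. apply Rlt_le, two_PI_pos. Qed.

Lemma avg_const (c : C) : avg (fun _ => c) = c.
Proof.
  unfold avg. rewrite CInt_const, Rminus_0_r. field. apply two_PI_neq.
Qed.

Lemma avg_plus (f g : R -> C) :
  periodic_cont f -> periodic_cont g -> avg (fun t => f t + g t)%C = (avg f + avg g)%C.
Proof.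
  intros Hf Hg. unfold avg. rewrite CInt_plus; auto; [ring | apply Rlt_le, two_PI_pos].
Qed.

Lemma avg_scal (c : C) (f : R -> C) : periodic_cont f -> avg (fun t => c * f t)%C = (c * avg f)%C.
Proof.
  intros Hf. unfold avg. rewrite CInt_scal; auto; [ring | apply Rlt_le, two_PI_pos].
Qed.

Lemma avg_bound (f : R -> C) (M : R) :
  periodic_cont f -> (forall t, 0 <= t <= 2 * PI -> Cmod (f t) <= M) -> Cmod (avg f) <= M.
Proof.
  intros Hf HM. unfold avg. assert (P := two_PI_pos).
  rewrite Cmod_mult, Cmod_inv by apply two_PI_neq. rewrite Cmod_RtoC_pos by lra.
  assert (B := CInt_bound f 0 (2 * PI) M ltac:(lra) Hf HM).
  apply Rmult_le_reg_l with (2 * PI); [exact P |].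
  rewrite <- Rmult_assoc, Rinv_r by lra. lra.
Qed.

Lemma avg_conj (f : R -> C) : periodic_cont f -> avg (fun t => Cconj (f t)) = Cconj (avg f).
Proof.
  intros Hf. assert (H := ex_RInt_snd f 0 (2 * PI) ltac:(generalize two_PI_pos; lra) Hf).
  unfold avg.
  assert (E : CInt (fun t => Cconj (f t)) 0 (2 * PI) = Cconj (CInt f 0 (2 * PI))).
  { unfold CInt, Cconj; simpl. f_equal.
    apply (RInt_opp (V := R_CompleteNormedModule) (fun t => snd (f t))), H. }
  rewrite E, <- RtoC_inv by (generalize two_PI_pos; lra).
  apply injective_projections; simpl; ring.
Qed.

Lemma avg_exact (g d : R -> C) :
  (forall t, vdiff g t (d t)) -> periodic_cont d -> g 0 = g (2 * PI) -> avg d = 0%C.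
Proof.
  intros Hg Hd E. unfold avg. rewrite (CInt_derive g d); auto.
  - rewrite E. ring.
  - apply Rlt_le, two_PI_pos.
Qed.

Lemma circ_period (c : C) (r : R) : circ c r 0 = circ c r (2 * PI).
Proof. unfold circ, expi. rewrite cos_0, sin_0, cos_2PI, sin_2PI. reflexivity. Qed.

(** This mean is the contour integral of [f] over the circle divided by [2 pi i]. *)
Lemma avg_closed (F f : C -> C) (c : C) (r : R) :
  (forall t, cdiff F (circ c r t) (f (circ c r t))) -> (forall t, cont_at f (circ c r t)) ->
  avg (fun t => f (circ c r t) * (circ c r t - c))%C = 0%C.
Proof.
  intros HF Hf.
  assert (Hc : periodic_cont (fun t => f (circ c r t) * (circ c r t - c))%C).
  { intros t _. assert (H := cont_at_circ c r t).
    assert (H' := cont_at_comp f _ _ (Hf t) H). cont. }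
  assert (E : avg (fun t => Ci * (f (circ c r t) * (circ c r t - c)))%C = 0%C).
  { apply (avg_exact (fun t => F (circ c r t))).
    - intros t. replace (Ci * (f (circ c r t) * (circ c r t - c)))%C
        with (f (circ c r t) * (Ci * (circ c r t - c)))%C by ring.
      apply (vdiff_comp F); [apply HF | apply vdiff_circ].
    - intros t Ht. apply cont_at_mult; [apply cont_at_const | apply Hc, Ht].
    - rewrite circ_period. reflexivity. }
  rewrite avg_scal in E by exact Hc.
  transitivity (- (Ci * (Ci * avg (fun t => f (circ c r t) * (circ c r t - c)))))%C.
  - replace (Ci * (Ci * avg (fun t => f (circ c r t) * (circ c r t - c))))%C
      with ((Ci * Ci) * avg (fun t => f (circ c r t) * (circ c r t - c)))%C by ring.
    replace (Ci * Ci)%C with (- (1))%C by (apply injective_projections; simpl; ring). ring.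
  - rewrite E. ring.
Qed.

Lemma circ_neq (c z : C) (r t : R) : Cmod (z - c) < r -> (circ c r t - z)%C <> 0%C.
Proof.
  intros Hz. apply Cmod_gt_0. assert (0 <= r) by (generalize (Cmod_ge_0 (z - c)); lra).
  generalize (Cmod_tri_sub (circ c r t) z c). rewrite Cmod_circ by auto. lra.
Qed.

Lemma circ_dist (c z : C) (r t : R) : Cmod (z - c) < r -> r - Cmod (z - c) <= Cmod (circ c r t - z).
Proof.
  intros Hz. assert (0 <= r) by (generalize (Cmod_ge_0 (z - c)); lra).
  generalize (Cmod_tri_sub (circ c r t) z c). rewrite Cmod_circ by auto. lra.
Qed.

(** The winding number about an interior point. Reflection in the circle turns
    [b / (w - b)] into the conjugate of a function holomorphic inside. *)
Lemma avg_kernel (c z : C) (r : R) :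
  Cmod (z - c) < r -> avg (fun t => (circ c r t - c) / (circ c r t - z))%C = 1%C.
Proof.
  intros Hz. set (b := (z - c)%C) in *.
  assert (Hr : 0 < r) by (generalize (Cmod_ge_0 b); lra).
  set (g := fun w => (Cconj b / (r * r - Cconj b * (w - c)))%C).
  set (U := Disc c (r * r / (Cmod b + (r - Cmod b) / 2))).
  set (m := Cmod b + (r - Cmod b) / 2) in *.
  assert (Hb0 := Cmod_ge_0 b).
  assert (Hm : Cmod b < m < r) by (unfold m; lra).
  assert (Hrho : r < r * r / m).
  { apply Rlt_div_r; nra. }
  assert (Hden : forall w, U w -> (r * r - Cconj b * (w - c))%C <> 0%C).
  { intros w Hw E. unfold U, Disc in Hw.
    assert (E2 : (Cconj b * (w - c))%C = (r * r)%C).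
    { transitivity (r * r - (r * r - Cconj b * (w - c)))%C; [ring | rewrite E; ring]. }
    apply (f_equal Cmod) in E2. rewrite !Cmod_mult, Cmod_conj, Cmod_RtoC_pos in E2 by lra.
    assert (Cmod b * Cmod (w - c) <= m * Cmod (w - c)).
    { apply Rmult_le_compat_r; [apply Cmod_ge_0 | lra]. }
    assert (m * Cmod (w - c) < m * (r * r / m)) by (apply Rmult_lt_compat_l; lra).
    replace (m * (r * r / m)) with (r * r) in H0 by (field; lra). lra. }
  assert (Hg : Hol U g).
  { apply Hol_div; [exact Hden | apply Hol_const |]. apply Hol_minus; [apply Hol_const |].
    apply Hol_mult; [apply Hol_const |]. apply Hol_minus; [apply Hol_id | apply Hol_const]. }
  assert (HU : forall t, U (circ c r t)).
  { intros t. unfold U, Disc. rewrite Cmod_circ by lra. exact Hrho. }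
  destruct (primitive_exists U g) as [G HG]; [apply open_disc | apply convex_disc | exact Hg |].
  assert (E : avg (fun t => g (circ c r t) * (circ c r t - c))%C = 0%C).
  { apply (avg_closed G); intros t; [apply HG, HU | apply (Hol_cont U); auto]. }
  assert (Hc : periodic_cont (fun t => g (circ c r t) * (circ c r t - c))%C).
  { intros t _. assert (H := cont_at_circ c r t).
    assert (H' := cont_at_comp g _ _ (Hol_cont U g _ Hg (HU t)) H). cont. }
  assert (Hc2 : periodic_cont (fun t => Cconj (g (circ c r t) * (circ c r t - c))%C)).
  { intros t Ht eps He. generalize (Hc t Ht eps He). apply filter_imp. intros s Hs.
    rewrite <- Cminus_conj, Cmod_conj. exact Hs. }
  transitivity (avg (fun t => 1 + Cconj (g (circ c r t) * (circ c r t - c)))%C).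
  - apply avg_ext. intros t.
    assert (Hn := circ_neq c z r t Hz). assert (Hn2 := Hden _ (HU t)).
    set (u := (circ c r t - c)%C) in *.
    assert (Hu : (u * Cconj u)%C = (r * r)%C).
    { rewrite <- Cmod2_conj. unfold u. rewrite Cmod_circ by lra. rewrite <- RtoC_mult. f_equal. simpl. ring. }
    replace (circ c r t - z)%C with (u - b)%C in * by (unfold u, b; ring).
    unfold g. fold u. unfold Cdiv. rewrite Cmult_conj, Cmult_conj, Cconj_conj, Cinv_conj by exact Hn2.
    assert (Hn3 : (r * r - b * Cconj u)%C <> 0%C).
    { intros F. apply Hn2. apply (f_equal Cconj) in F.
      assert (K : Cconj (r * r)%C = (r * r)%C) by (apply injective_projections; simpl; ring).
      rewrite Cminus_conj, K, Cmult_conj, Cconj_conj in F. rewrite F. apply injective_projections; simpl; ring. }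
    assert (Hu0 : Cconj u <> 0%C).
    { apply Cmod_gt_0. rewrite Cmod_conj. unfold u. rewrite Cmod_circ; lra. }
    assert (K : Cconj (r * r)%C = (r * r)%C) by (apply injective_projections; simpl; ring).
    rewrite Cminus_conj, K, Cmult_conj, Cconj_conj, <- Hu. rewrite <- Hu in Hn3. field. repeat split; auto.
  - rewrite avg_plus, avg_const, avg_conj, E; auto.
    + apply injective_projections; simpl; ring.
    + intros t _. apply cont_at_const.
Qed.

(** The difference quotient, completed by continuity. *)
Definition slope (f : C -> C) (z w : C) : C :=
  if excluded_middle_informative (w = z) then C_derive f z else ((f w - f z) / (w - z))%C.

Lemma slope_neq (f : C -> C) (z w : C) : w <> z -> slope f z w = ((f w - f z) / (w - z))%C.
Proof. intros H. unfold slope. destruct (excluded_middle_informative (w = z)); [contradiction | reflexivity]. Qed.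

Lemma slope_eq (f : C -> C) (z : C) : slope f z z = C_derive f z.
Proof. unfold slope. destruct (excluded_middle_informative (z = z)); [reflexivity | contradiction]. Qed.

Lemma slope_mult (f : C -> C) (z w : C) : (f w = f z + slope f z w * (w - z))%C.
Proof.
  unfold slope. destruct (excluded_middle_informative (w = z)) as [-> | n]; [ring |].
  field. apply Csub_neq, n.
Qed.

Lemma slope_diff (U : C -> Prop) (f : C -> C) (z w : C) :
  open U -> Hol U f -> U w -> w <> z -> exists l, cdiff (slope f z) w l.
Proof.
  intros Ho Hf Hw Hn. destruct (Hf w Hw) as [l Hl].
  assert (Hd : exists m, cdiff (fun v => (f v - f z) * / (v - z))%C w m).
  { eexists. apply cdiff_mult.
    - apply cdiff_minus; [exact Hl | apply cdiff_const].
    - apply cdiff_inv; [apply Csub_neq, Hn |].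
      apply cdiff_minus; [apply cdiff_id | apply cdiff_const]. }
  destruct Hd as [m Hm]. exists m. apply cdiff_ext_loc with (2 := Hm).
  apply locally_C_iff. exists (Cmod (w - z)). split; [apply Cmod_sub_pos, Hn |].
  intros v Hv. rewrite slope_neq; [reflexivity |]. intros ->. rewrite Cmod_sym in Hv. lra.
Qed.

Lemma slope_cont (U : C -> Prop) (f : C -> C) (z w : C) :
  open U -> Hol U f -> U z -> U w -> cont_at (slope f z) w.
Proof.
  intros Ho Hf Hz Hw. destruct (classic (w = z)) as [-> | Hn].
  - apply cont_at_C. intros eps He.
    destruct (proj1 (cdiff_eps _ _ _) (Hol_derive U f z Hf Hz) (eps / 2) ltac:(lra)) as [d [Hd H]].
    exists d. split; [exact Hd |]. intros v Hv. rewrite slope_eq.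
    destruct (classic (v = z)) as [-> | n]; [rewrite slope_eq, Cmod_self; exact He |].
    rewrite slope_neq by exact n. specialize (H v Hv).
    assert (P := Cmod_sub_pos _ _ n). assert (Q := Csub_neq _ _ n).
    replace ((f v - f z) / (v - z) - C_derive f z)%C
      with ((f v - f z - C_derive f z * (v - z)) / (v - z))%C by (field; exact Q).
    rewrite Cmod_div by exact Q. apply Rlt_div_l; [exact P | nra].
  - destruct (slope_diff U f z w Ho Hf Hw Hn) as [l Hl]. apply (cdiff_cont _ _ _ Hl).
Qed.

(** The slope of [f] at [z] has a primitive, so its contour integral is 0; what
    remains is [f z] times the winding number. *)
Theorem Cauchy_formula (f : C -> C) (c z : C) (r R0 : R) :
  Hol (Disc c R0) f -> Cmod (z - c) < r -> r < R0 ->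
  f z = avg (fun t => f (circ c r t) * (circ c r t - c) / (circ c r t - z))%C.
Proof.
  intros Hf Hz Hr. set (U := Disc c R0) in *.
  assert (Hr0 : 0 < r) by (generalize (Cmod_ge_0 (z - c)); lra).
  assert (Uz : U z) by (unfold U, Disc; lra).
  assert (HU : forall t, U (circ c r t)) by (intros t; unfold U, Disc; rewrite Cmod_circ; lra).
  assert (HoU : open U) by apply open_disc.
  destruct (primitive_punctured U (slope f z) z) as [F HF].
  { exact HoU. } { apply convex_disc. } { exact Uz. }
  { intros w Hw. apply (slope_cont U); auto. }
  { intros w Hw Hn. apply (slope_diff U); auto. }
  assert (E : avg (fun t => slope f z (circ c r t) * (circ c r t - c))%C = 0%C).
  { apply (avg_closed F); intros t; [apply HF, HU | apply (slope_cont U); auto]. }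
  assert (Hk : forall t, cont_at (fun s => (circ c r s - c) / (circ c r s - z))%C t).
  { intros t. assert (H := cont_at_circ c r t).
    apply cont_at_mult; [| apply cont_at_inv; [apply circ_neq, Hz |]]; cont. }
  transitivity (avg (fun t => slope f z (circ c r t) * (circ c r t - c)
       + f z * ((circ c r t - c) / (circ c r t - z)))%C).
  - rewrite avg_plus, E, avg_scal, avg_kernel; auto.
    + ring.
    + intros t _. apply Hk.
    + intros t _. assert (H := cont_at_circ c r t).
      assert (H' := cont_at_comp (slope f z) _ _ (slope_cont U f z _ HoU Hf Uz (HU t)) H). cont.
    + intros t _. assert (H := Hk t). cont.
  - apply avg_ext. intros t. assert (Hn := circ_neq c z r t Hz).
    rewrite slope_neq.
    + field. exact Hn.
    + intros E2. apply Hn. rewrite E2. ring.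
Qed.

(** * Consequences of Cauchy's formula *)

(** Differentiation under the integral sign. *)
Lemma avg_param_diff (K K' : R -> C -> C) (z : C) (A d : R) :
  0 < d -> 0 <= A ->
  (forall w, Cmod (w - z) < d -> periodic_cont (fun t => K t w)) ->
  periodic_cont (fun t => K' t z) ->
  (forall t, 0 <= t <= 2 * PI -> forall w, Cmod (w - z) < d ->
     Cmod (K t w - K t z - K' t z * (w - z)) <= A * (Cmod (w - z) * Cmod (w - z))) ->
  cdiff (fun w => avg (fun t => K t w)) z (avg (fun t => K' t z)).
Proof.
  intros Hd HA Hc Hc' HK. apply cdiff_eps. intros eps He.
  exists (Rmin d (eps / (A + 1))). split; [apply Rmin_glb_lt; [lra | apply Rdiv_lt_0_compat; lra] |].
  intros w Hw. destruct (Rmin_lt _ _ _ Hw) as [Hw1 Hw2].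
  assert (Hz : Cmod (z - z) < d) by (rewrite Cmod_self; exact Hd).
  assert (C1 : periodic_cont (fun t => - (1) * K t z)%C).
  { intros t Ht. apply cont_at_mult; [apply cont_at_const | apply (Hc z Hz t Ht)]. }
  assert (C2 : periodic_cont (fun t => - (w - z) * K' t z)%C).
  { intros t Ht. apply cont_at_mult; [apply cont_at_const | apply (Hc' t Ht)]. }
  assert (C3 : periodic_cont (fun t => K t w + (- (1) * K t z + - (w - z) * K' t z))%C).
  { intros t Ht. apply cont_at_plus; [apply (Hc w Hw1 t Ht) |]. apply cont_at_plus; [apply C1, Ht | apply C2, Ht]. }
  assert (E : (avg (fun t => K t w) - avg (fun t => K t z) - avg (fun t => K' t z) * (w - z))%C
     = avg (fun t => K t w + (- (1) * K t z + - (w - z) * K' t z))%C).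
  { rewrite (avg_plus (fun t => K t w)), (avg_plus (fun t => - (1) * K t z)%C), !avg_scal; auto.
    - ring.
    - intros t Ht. apply cont_at_plus; [apply C1, Ht | apply C2, Ht]. }
  rewrite E. set (h := Cmod (w - z)) in *. assert (Hh : 0 <= h) by apply Cmod_ge_0.
  apply Rle_trans with (A * (h * h)).
  - apply avg_bound; [exact C3 |]. intros t Ht. specialize (HK t Ht w Hw1). fold h in HK.
    replace (K t w + (- (1) * K t z + - (w - z) * K' t z))%C
      with (K t w - K t z - K' t z * (w - z))%C by ring. exact HK.
  - assert ((A + 1) * h <= eps).
    { replace eps with ((A + 1) * (eps / (A + 1))) by (field; lra).
      apply Rmult_le_compat_l; lra. }
    nra.
Qed.

Lemma kernel_cont (g : R -> C) (c z : C) (r : R) (n : nat) :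
  periodic_cont g -> Cmod (z - c) < r ->
  periodic_cont (fun t => g t * (/ (circ c r t - z)) ^ n)%C.
Proof.
  intros Hg Hz t Ht. apply cont_at_mult; [apply Hg, Ht |].
  assert (H : cont_at (fun s => / (circ c r s - z))%C t).
  { apply cont_at_inv; [apply circ_neq, Hz |].
    assert (H := cont_at_circ c r t). cont. }
  induction n as [| n IH]; simpl; [apply cont_at_const | apply cont_at_mult; auto].
Qed.

Lemma kernel_bound (g : R -> C) (c z : C) (r M : R) (n : nat) :
  Cmod (z - c) < r -> (forall t, 0 <= t <= 2 * PI -> Cmod (g t) <= M) ->
  forall t, 0 <= t <= 2 * PI -> Cmod (g t * (/ (circ c r t - z)) ^ n)%C <= M * (/ (r - Cmod (z - c))) ^ n.
Proof.
  intros Hz HM t Ht. rewrite Cmod_mult, Cmod_pow, Cmod_inv by (apply circ_neq, Hz).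
  apply Rmult_le_compat; auto.
  - apply Cmod_ge_0.
  - apply pow_le, Rlt_le, Rinv_0_lt_compat. generalize (circ_dist c z r t Hz). lra.
  - apply pow_incr. split.
    + apply Rlt_le, Rinv_0_lt_compat. generalize (circ_dist c z r t Hz). lra.
    + apply Rinv_le_contravar; [lra | apply circ_dist, Hz].
Qed.

(** The kernels of orders 1 and 2 suffice: they show that [f'] is differentiable,
    after which the argument can be repeated for [f']. *)
Lemma Cauchy_integral_diff (g : R -> C) (c z : C) (r M : R) :
  periodic_cont g -> (forall t, 0 <= t <= 2 * PI -> Cmod (g t) <= M) -> Cmod (z - c) < r ->
  cdiff (fun w => avg (fun t => g t * (/ (circ c r t - w)) ^ 1)%C) z
        (avg (fun t => g t * (/ (circ c r t - z)) ^ 2)%C) /\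
  cdiff (fun w => avg (fun t => g t * (/ (circ c r t - w)) ^ 2)%C) z
        (avg (fun t => 2 * g t * (/ (circ c r t - z)) ^ 3)%C).
Proof.
  intros Hg HM Hz. set (d := (r - Cmod (z - c)) / 2).
  assert (Hd : 0 < d) by (unfold d; lra).
  assert (HM0 : 0 <= M) by (apply Rle_trans with (1 := Cmod_ge_0 (g 0)); apply HM; generalize two_PI_pos; lra).
  assert (Hw : forall w, Cmod (w - z) < d -> Cmod (w - c) < r /\ forall t, d <= Cmod (circ c r t - w)).
  { intros w Hw. assert (Cmod (w - c) <= r - d) by (generalize (Cmod_tri_sub w z c); unfold d in *; lra).
    split; [lra |]. intros t. generalize (circ_dist c w r t ltac:(lra)). lra. }
  assert (Hz2 : forall t, d <= Cmod (circ c r t - z)) by (intros t; apply Hw; rewrite Cmod_self; lra).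
  assert (Hid : 0 < / d) by (apply Rinv_0_lt_compat; lra).
  split.
  - apply (avg_param_diff (fun t w => g t * (/ (circ c r t - w)) ^ 1)%C
      (fun t w => g t * (/ (circ c r t - w)) ^ 2)%C z (M * (/ d * / d * / d)) d); auto.
    + repeat apply Rmult_le_pos; lra.
    + intros w H. apply kernel_cont; [exact Hg | apply Hw, H].
    + apply kernel_cont; auto.
    + intros t Ht w H. destruct (Hw w H) as [H1 H2]. specialize (H2 t). specialize (Hz2 t).
      assert (N1 := circ_neq c w r t H1). assert (N2 := circ_neq c z r t Hz).
      set (v := (circ c r t - z)%C) in *. set (u := (circ c r t - w)%C) in *.
      replace (w - z)%C with (v - u)%C by (unfold u, v; ring).
      replace (g t * (/ u) ^ 1 - g t * (/ v) ^ 1 - g t * (/ v) ^ 2 * (v - u))%C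
        with (g t * ((v - u) * (v - u) * (/ u * / v * / v)))%C by (simpl; field; auto).
      rewrite !Cmod_mult, !Cmod_inv by auto.
      assert (I1 : / Cmod u <= / d) by (apply Rinv_le_contravar; lra).
      assert (I2 : / Cmod v <= / d) by (apply Rinv_le_contravar; lra).
      assert (P1 : 0 < / Cmod u) by (apply Rinv_0_lt_compat; lra).
      assert (P2 : 0 < / Cmod v) by (apply Rinv_0_lt_compat; lra).
      assert (Cmod (g t) * (/ Cmod u * / Cmod v * / Cmod v) <= M * (/ d * / d * / d)).
      { apply Rmult_le_compat; [apply Cmod_ge_0 | | apply HM, Ht |].
        - repeat apply Rmult_le_pos; lra.
        - apply Rmult_le_compat; try lra; [repeat apply Rmult_le_pos; lra |].
          apply Rmult_le_compat; lra. }
      assert (0 <= Cmod (v - u) * Cmod (v - u)) by (apply Rmult_le_pos; apply Cmod_ge_0).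
      nra.
  - apply (avg_param_diff (fun t w => g t * (/ (circ c r t - w)) ^ 2)%C
      (fun t w => 2 * g t * (/ (circ c r t - w)) ^ 3)%C z (M * (3 * (/ d * / d * / d * / d))) d); auto.
    + repeat apply Rmult_le_pos; lra.
    + intros w H. apply kernel_cont; [exact Hg | apply Hw, H].
    + apply (kernel_cont (fun t => 2 * g t)%C); auto.
      intros t Ht. apply cont_at_mult; [apply cont_at_const | apply Hg, Ht].
    + intros t Ht w H. destruct (Hw w H) as [H1 H2]. specialize (H2 t). specialize (Hz2 t).
      assert (N1 := circ_neq c w r t H1). assert (N2 := circ_neq c z r t Hz).
      set (v := (circ c r t - z)%C) in *. set (u := (circ c r t - w)%C) in *.
      replace (w - z)%C with (v - u)%C by (unfold u, v; ring).
      replace (g t * (/ u) ^ 2 - g t * (/ v) ^ 2 - 2 * g t * (/ v) ^ 3 * (v - u))%C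
        with (g t * ((v - u) * (v - u) * (/ u * / u * / v * / v + 2 * (/ u * / v * / v * / v))))%C
        by (simpl; field; auto).
      rewrite !Cmod_mult.
      assert (I1 : / Cmod u <= / d) by (apply Rinv_le_contravar; lra).
      assert (I2 : / Cmod v <= / d) by (apply Rinv_le_contravar; lra).
      assert (P1 : 0 < / Cmod u) by (apply Rinv_0_lt_compat; lra).
      assert (P2 : 0 < / Cmod v) by (apply Rinv_0_lt_compat; lra).
      assert (B : Cmod (/ u * / u * / v * / v + 2 * (/ u * / v * / v * / v)) <= 3 * (/ d * / d * / d * / d)).
      { eapply Rle_trans; [apply Cmod_triangle |].
        rewrite !Cmod_mult, !Cmod_inv by auto. rewrite Cmod_RtoC_pos by lra.
        assert (Q : forall a b c e : R, 0 <= a <= / d -> 0 <= b <= / d -> 0 <= c <= / d -> 0 <= e <= / d ->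
          a * b * c * e <= / d * / d * / d * / d).
        { intros a b e1 e2 Ha Hb Hc He. apply Rmult_le_compat; try lra; [repeat apply Rmult_le_pos; lra |].
          apply Rmult_le_compat; try lra; [repeat apply Rmult_le_pos; lra |]. apply Rmult_le_compat; lra. }
        assert (Q1 := Q (/ Cmod u) (/ Cmod u) (/ Cmod v) (/ Cmod v) ltac:(lra) ltac:(lra) ltac:(lra) ltac:(lra)).
        assert (Q2 := Q (/ Cmod u) (/ Cmod v) (/ Cmod v) (/ Cmod v) ltac:(lra) ltac:(lra) ltac:(lra) ltac:(lra)).
        lra. }
      assert (0 <= Cmod (v - u) * Cmod (v - u)) by (apply Rmult_le_pos; apply Cmod_ge_0).
      assert (Cmod (g t) * Cmod (/ u * / u * / v * / v + 2 * (/ u * / v * / v * / v)) <= M * (3 * (/ d * / d * / d * / d))).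
      { apply Rmult_le_compat; auto; apply Cmod_ge_0. }
      nra.
Qed.

Definition sup_circle (f : C -> C) (c : C) (r M : R) : Prop :=
  forall t, 0 <= t <= 2 * PI -> Cmod (f (circ c r t)) <= M.

Lemma sup_circle_intro (f : C -> C) (c : C) (r M : R) :
  0 <= r -> (forall w, Cmod (w - c) = r -> Cmod (f w) <= M) -> sup_circle f c r M.
Proof. intros Hr H t _. apply H, Cmod_circ, Hr. Qed.

Lemma sup_circle_ge_0 (f : C -> C) (c : C) (r M : R) : sup_circle f c r M -> 0 <= M.
Proof.
  intros H. apply Rle_trans with (1 := Cmod_ge_0 (f (circ c r 0))), H. generalize two_PI_pos. lra.
Qed.

Lemma circle_bounded (f : C -> C) (c : C) (r : R) :
  (forall t, cont_at f (circ c r t)) -> exists M, sup_circle f c r M.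
Proof.
  intros Hc.
  assert (Hg : forall t, continuous (fun s => Cmod (f (circ c r s))) t).
  { intros t. apply filterlim_locally. intros eps.
    assert (H := cont_at_comp f _ _ (Hc t) (cont_at_circ c r t)).
    generalize (H eps (cond_pos eps)). apply filter_imp. intros s Hs.
    change (Rabs (Cmod (f (circ c r s)) - Cmod (f (circ c r t))) < eps).
    apply Rabs_lt_between'. assert (A := Cmod_rev (f (circ c r s)) (f (circ c r t))).
    assert (B := Cmod_rev (f (circ c r t)) (f (circ c r s))). rewrite Cmod_sym in B. lra. }
  destruct (continuity_ab_maj (fun s => Cmod (f (circ c r s))) 0 (2 * PI)) as [s [Hs _]].
  { apply Rlt_le, two_PI_pos. }
  { intros t _. apply continuity_pt_filterlim, Hg. }
  exists (Cmod (f (circ c r s))). exact Hs.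
Qed.

Lemma Hol_circle (f : C -> C) (c : C) (r R0 : R) :
  Hol (Disc c R0) f -> 0 <= r < R0 -> forall t, cont_at f (circ c r t).
Proof.
  intros Hf Hr t. apply (Hol_cont (Disc c R0)); [exact Hf |]. unfold Disc. rewrite Cmod_circ; lra.
Qed.

Lemma Hol_circle_bounded (f : C -> C) (c : C) (r R0 : R) :
  Hol (Disc c R0) f -> 0 <= r < R0 -> exists M, sup_circle f c r M.
Proof. intros Hf Hr. apply circle_bounded, Hol_circle with R0; auto. Qed.

(** The numerator of Cauchy's kernel. *)
Definition cnum (f : C -> C) (c : C) (r t : R) : C := (f (circ c r t) * (circ c r t - c))%C.

Lemma cnum_cont (f : C -> C) (c : C) (r : R) :
  (forall t, cont_at f (circ c r t)) -> periodic_cont (cnum f c r).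
Proof.
  intros Hf t _. assert (H := cont_at_circ c r t). assert (H' := cont_at_comp f _ _ (Hf t) H).
  unfold cnum. cont.
Qed.

Lemma cnum_bound (f : C -> C) (c : C) (r M : R) :
  0 <= r -> sup_circle f c r M -> forall t, 0 <= t <= 2 * PI -> Cmod (cnum f c r t) <= M * r.
Proof.
  intros Hr HM t Ht. unfold cnum. rewrite Cmod_mult, Cmod_circ by auto.
  apply Rmult_le_compat_r; [exact Hr | apply HM, Ht].
Qed.

Lemma Cauchy_formula' (f : C -> C) (c z : C) (r R0 : R) :
  Hol (Disc c R0) f -> Cmod (z - c) < r -> r < R0 ->
  f z = avg (fun t => cnum f c r t * (/ (circ c r t - z)) ^ 1)%C.
Proof.
  intros Hf Hz Hr. rewrite (Cauchy_formula f c z r R0) by auto.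
  apply avg_ext. intros t. unfold cnum. simpl. unfold Cdiv. ring.
Qed.

Lemma Cauchy_derivative (f : C -> C) (c z : C) (r R0 : R) :
  Hol (Disc c R0) f -> Cmod (z - c) < r -> r < R0 ->
  C_derive f z = avg (fun t => cnum f c r t * (/ (circ c r t - z)) ^ 2)%C.
Proof.
  intros Hf Hz Hr. assert (Hr0 : 0 < r) by (generalize (Cmod_ge_0 (z - c)); lra).
  destruct (Hol_circle_bounded f c r R0 Hf) as [M HM]; [lra |].
  apply cdiff_unique.
  destruct (Cauchy_integral_diff (cnum f c r) c z r (M * r)) as [H _]; auto.
  { apply cnum_cont, Hol_circle with R0; auto. lra. }
  { apply cnum_bound; auto. lra. }
  apply cdiff_ext_loc with (2 := H). apply filter_imp with (Disc c r).
  - intros w Hw. symmetry. apply Cauchy_formula' with R0; auto.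
  - apply open_locally; [apply open_disc | exact Hz].
Qed.

Lemma open_sub_disc (U : C -> Prop) (z : C) :
  open U -> U z -> exists r, 0 < r /\ forall w, Disc z r w -> U w.
Proof. intros Ho Hz. exact (proj1 (open_C_iff U) Ho z Hz). Qed.

(** Cauchy's formula represents [f'] by the kernel of order 2, itself differentiable. *)
Theorem Hol_C_derive (U : C -> Prop) (f : C -> C) : open U -> Hol U f -> Hol U (C_derive f).
Proof.
  intros Ho Hf z Hz. destruct (open_sub_disc U z Ho Hz) as [R0 [HR HU]].
  assert (HfD : Hol (Disc z R0) f) by (apply (Hol_subset U); auto).
  assert (Hz0 : Cmod (z - z) < R0 / 2) by (rewrite Cmod_self; lra).
  destruct (Hol_circle_bounded f z (R0 / 2) R0 HfD) as [M HM]; [lra |].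
  destruct (Cauchy_integral_diff (cnum f z (R0 / 2)) z z (R0 / 2) (M * (R0 / 2))) as [_ H]; auto.
  { apply cnum_cont, Hol_circle with R0; auto. lra. }
  { apply cnum_bound; auto. lra. }
  eexists. apply cdiff_ext_loc with (2 := H). apply filter_imp with (Disc z (R0 / 2)).
  - intros w Hw. symmetry. apply Cauchy_derivative with R0; auto. lra.
  - apply open_locally; [apply open_disc | exact Hz0].
Qed.

Lemma Hol_C_derive_n (U : C -> Prop) (f : C -> C) (n : nat) :
  open U -> Hol U f -> Hol U (C_derive_n f n).
Proof. intros Ho Hf. induction n as [| n IH]; simpl; [exact Hf | apply Hol_C_derive; auto]. Qed.

Lemma Cauchy_estimate (f : C -> C) (c : C) (r R0 M : R) :
  Hol (Disc c R0) f -> 0 < r < R0 -> sup_circle f c r M -> Cmod (C_derive f c) <= M / r.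
Proof.
  intros Hf Hr HM. assert (Hz : Cmod (c - c) < r) by (rewrite Cmod_self; lra).
  assert (Hc : periodic_cont (cnum f c r)) by (apply cnum_cont, Hol_circle with R0; auto; lra).
  rewrite (Cauchy_derivative f c c r R0) by (auto; lra).
  replace (M / r) with ((M * r) * (/ (r - Cmod (c - c))) ^ 2).
  - apply avg_bound; [apply kernel_cont; auto |].
    apply kernel_bound; auto. apply cnum_bound; auto. lra.
  - rewrite Cmod_self. field. lra.
Qed.

Lemma Cauchy_estimate_disc (f : C -> C) (c : C) (r M : R) :
  0 < r -> Hol (Disc c r) f -> (forall w, Disc c r w -> Cmod (f w) <= M) ->
  Cmod (C_derive f c) <= 2 * M / r.
Proof.
  intros Hr Hf HM. replace (2 * M / r) with (M / (r / 2)) by (field; lra).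
  apply Cauchy_estimate with r; auto; [lra |].
  apply sup_circle_intro; [lra |]. intros w Hw. apply HM. unfold Disc. lra.
Qed.

Lemma Cauchy_bound (f : C -> C) (c z : C) (r R0 M : R) :
  Hol (Disc c R0) f -> Cmod (z - c) < r -> r < R0 -> sup_circle f c r M ->
  Cmod (f z) <= M * (r / (r - Cmod (z - c))).
Proof.
  intros Hf Hz Hr HM. assert (Hr0 : 0 < r) by (generalize (Cmod_ge_0 (z - c)); lra).
  assert (Hc : periodic_cont (cnum f c r)) by (apply cnum_cont, Hol_circle with R0; auto; lra).
  rewrite (Cauchy_formula' f c z r R0) by auto.
  replace (M * (r / (r - Cmod (z - c)))) with (M * r * (/ (r - Cmod (z - c))) ^ 1) by (simpl; field; lra).
  apply avg_bound; [apply kernel_cont; auto |]. apply kernel_bound; auto. apply cnum_bound; auto. lra.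
Qed.

(** The constant [r / (r - |z - c|)] of Cauchy's formula disappears when
    the bound is applied to the powers of [f]. *)
Theorem max_principle (f : C -> C) (c z : C) (r R0 M : R) :
  Hol (Disc c R0) f -> Cmod (z - c) < r -> r < R0 -> sup_circle f c r M -> Cmod (f z) <= M.
Proof.
  intros Hf Hz Hr HM. assert (Hr0 : 0 < r) by (generalize (Cmod_ge_0 (z - c)); lra).
  assert (HM0 := sup_circle_ge_0 _ _ _ _ HM).
  set (K := r / (r - Cmod (z - c))).
  assert (Hn : forall n, Cmod (f z) ^ n <= M ^ n * K).
  { intros n. rewrite <- Cmod_pow. apply (Cauchy_bound (fun w => f w ^ n)%C c z r R0); auto.
    - apply Hol_pow, Hf.
    - intros t Ht. rewrite Cmod_pow. apply pow_incr. split; [apply Cmod_ge_0 | apply HM, Ht]. }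
  apply Rnot_lt_le. intros Hlt. set (x := Cmod (f z)) in *.
  assert (Hx : 0 < x) by lra.
  destruct (geom_small K (M / x) 1) as [N HN]; [apply ratio_lt_1; lra | lra |].
  specialize (Hn N). assert (Hp : 0 < x ^ N) by (apply pow_lt; lra).
  assert (E : K * (M / x) ^ N * x ^ N = M ^ N * K).
  { unfold Rdiv. rewrite Rpow_mult_distr, pow_inv. field. lra. }
  nra.
Qed.

(** * Zeros *)

(** A removable singularity: the slope is the derivative of its primitive. *)
Lemma Hol_slope (U : C -> Prop) (f : C -> C) (a : C) :
  open U -> Cconvex U -> Hol U f -> U a -> Hol U (slope f a).
Proof.
  intros Ho HU Hf Ha.
  destruct (primitive_punctured U (slope f a) a) as [F HF]; auto.
  { intros z Hz. apply (slope_cont U); auto. }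
  { intros z Hz Hn. apply (slope_diff U); auto. }
  apply (Hol_ext U (C_derive F)); auto.
  - intros z Hz. apply cdiff_unique, HF, Hz.
  - apply Hol_C_derive; auto. intros z Hz. eexists. apply HF, Hz.
Qed.

(** A zero of order at least [n], with its cofactor. *)
Definition order_ge (U : C -> Prop) (f : C -> C) (a : C) (n : nat) (g : C -> C) : Prop :=
  Hol U g /\ forall z, U z -> f z = ((z - a) ^ n * g z)%C.

Lemma order_ge_S (U : C -> Prop) (f g : C -> C) (a : C) (n : nat) :
  open U -> Cconvex U -> U a -> order_ge U f a n g -> g a = 0%C ->
  order_ge U f a (S n) (slope g a).
Proof.
  intros Ho HU Ha [Hg E] H0. split; [apply Hol_slope; auto |].
  intros z Hz. rewrite (E z Hz). rewrite (slope_mult g a z), H0. simpl. ring.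
Qed.

Lemma zero_dichotomy (U : C -> Prop) (f : C -> C) (a : C) :
  open U -> Cconvex U -> Hol U f -> U a ->
  (forall n, exists g, order_ge U f a n g) \/
  (exists n g, order_ge U f a n g /\ g a <> 0%C).
Proof.
  intros Ho HU Hf Ha. destruct (classic (exists n g, order_ge U f a n g /\ g a <> 0%C)) as [H | H]; [right; exact H |].
  left. induction n as [| n [g Hg]].
  - exists f. split; [exact Hf | intros; simpl; ring].
  - exists (slope g a). apply order_ge_S; auto. apply NNPP. intros Hn. apply H. eauto.
Qed.

(** The maximum principle for the cofactor. *)
Lemma order_bound (f g : C -> C) (a z : C) (n : nat) (r R0 M : R) :
  order_ge (Disc a R0) f a n g -> Cmod (z - a) < r -> r < R0 -> sup_circle f a r M ->
  Cmod (f z) <= (Cmod (z - a) / r) ^ n * M.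
Proof.
  intros [Hg E] Hz Hr HM. assert (Hr0 : 0 < r) by (generalize (Cmod_ge_0 (z - a)); lra).
  assert (B : Cmod (g z) <= M / r ^ n).
  { apply (max_principle g a z r R0); auto. intros t Ht.
    assert (Hw := Cmod_circ a r t ltac:(lra)).
    apply Rle_div_r; [apply pow_lt, Hr0 |]. rewrite <- Hw at 2.
    rewrite Rmult_comm, <- Cmod_pow, <- Cmod_mult, <- E by (unfold Disc; lra). apply HM, Ht. }
  rewrite E by (unfold Disc; lra). rewrite Cmod_mult, Cmod_pow. unfold Rdiv.
  rewrite Rpow_mult_distr, pow_inv, Rmult_assoc. apply Rmult_le_compat_l.
  - apply pow_le, Cmod_ge_0.
  - rewrite Rmult_comm. exact B.
Qed.

(** [order_bound] for [n] tending to infinity. *)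
Lemma infinite_order_zero (f : C -> C) (a : C) (R0 : R) :
  (forall n, exists g, order_ge (Disc a R0) f a n g) -> forall z, Disc a R0 z -> f z = 0%C.
Proof.
  intros H z Hz. unfold Disc in Hz.
  assert (Hf : Hol (Disc a R0) f).
  { destruct (H 0%nat) as [g [Hg E]]. apply (Hol_ext _ g); auto; [apply open_disc |].
    intros w Hw. rewrite (E w Hw). simpl. ring. }
  set (r := (Cmod (z - a) + R0) / 2). set (d := Cmod (z - a)) in *.
  assert (Hd : 0 <= d) by apply Cmod_ge_0.
  assert (Hr : d < r < R0) by (unfold r; lra).
  destruct (Hol_circle_bounded f a r R0 Hf) as [M HM]; [lra |].
  apply Cmod_arbitrarily_small. intros eps He.
  destruct (geom_small M (d / r) eps) as [N HN]; [apply ratio_lt_1; lra | exact He |].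
  destruct (H N) as [g Hg].
  assert (B := order_bound f g a z N r R0 M Hg ltac:(fold d; lra) ltac:(lra) HM). fold d in B. lra.
Qed.

Lemma infinite_order_zero_plane (f : C -> C) (a : C) :
  (forall n, exists g, order_ge plane f a n g) -> forall z, f z = 0%C.
Proof.
  intros H z. apply (infinite_order_zero f a (Cmod (z - a) + 1)); [| unfold Disc; lra].
  intros n. destruct (H n) as [g [Hg E]]. exists g. split.
  - apply Hol_plane_sub, Hg.
  - intros w _. apply E. exact I.
Qed.

Lemma isolated_zero (f : C -> C) (a : C) :
  Hol plane f -> (exists z, f z <> 0%C) ->
  exists r, 0 < r /\ forall z, z <> a -> Cmod (z - a) < r -> f z <> 0%C.
Proof.
  intros Hf [z0 Hz0].
  destruct (zero_dichotomy plane f a open_plane convex_plane Hf I) as [H | [n [g [[Hg E] H0]]]].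
  - exfalso. apply Hz0, (infinite_order_zero_plane f a H).
  - assert (Hc := Hol_cont plane g a Hg I).
    destruct (proj1 (cont_at_C g a) Hc (Cmod (g a))) as [r [Hr H]]; [apply Cmod_gt_0, H0 |].
    exists r. split; [exact Hr |]. intros z Hz Hzr. rewrite (E z I).
    apply Cmult_neq_0; [apply Cpow_nz, Csub_neq, Hz |].
    intros F. specialize (H z Hzr). rewrite F in H.
    replace (0 - g a)%C with (- g a)%C in H by ring. rewrite Cmod_opp in H. lra.
Qed.

(** Where [f] does not vanish [g] does, on a whole disc, so its zeros are not isolated. *)
Lemma entire_mult_zero (f g : C -> C) :
  Hol plane f -> Hol plane g -> (forall z, (f z * g z)%C = 0%C) ->
  (forall z, f z = 0%C) \/ (forall z, g z = 0%C).
Proof.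
  intros Hf Hg H. destruct (classic (forall z, f z = 0%C)) as [Z | Z]; [left; exact Z |].
  right. apply not_all_ex_not in Z. destruct Z as [a Ha].
  apply NNPP. intros Hn. apply not_all_ex_not in Hn.
  destruct (isolated_zero g a Hg Hn) as [r [Hr Hgr]].
  destruct (proj1 (cont_at_C f a) (Hol_cont plane f a Hf I) (Cmod (f a))) as [d [Hd Hfd]];
    [apply Cmod_gt_0, Ha |].
  set (s := Rmin r d / 2). assert (Hs : 0 < s) by (unfold s; generalize (Rmin_glb_lt _ _ _ Hr Hd); lra).
  assert (Hs1 : s < r) by (unfold s in *; generalize (Rmin_l r d); lra).
  assert (Hs2 : s < d) by (unfold s in *; generalize (Rmin_r r d); lra).
  assert (Es : Cmod (a + s - a) = s).
  { replace (a + s - a)%C with (RtoC s) by ring. apply Cmod_RtoC_pos. lra. }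
  assert (F1 : g (a + s)%C <> 0%C).
  { apply Hgr; [| lra]. intros E. rewrite E, Cmod_self in Es. lra. }
  assert (F2 : f (a + s)%C <> 0%C).
  { intros E. specialize (Hfd (a + s)%C ltac:(lra)). rewrite E in Hfd.
    replace (0 - f a)%C with (- f a)%C in Hfd by ring. rewrite Cmod_opp in Hfd. lra. }
  apply (Cmult_neq_0 _ _ F2 F1), H.
Qed.

Lemma order_ge_derive (U : C -> Prop) (f g : C -> C) (a : C) (n : nat) :
  open U -> Hol U f -> U a -> order_ge U f a (S n) g -> exists h, order_ge U (C_derive f) a n h.
Proof.
  intros Ho Hf Ha [Hg E].
  exists (fun z => INR (S n) * g z + (z - a) * C_derive g z)%C. split.
  - apply Hol_plus; apply Hol_mult; auto.
    + apply Hol_const.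
    + apply Hol_minus; [apply Hol_id | apply Hol_const].
    + apply Hol_C_derive; auto.
  - intros z Hz. apply cdiff_unique.
    assert (Hp : forall m, cdiff (fun w => (w - a) ^ S m)%C z (INR (S m) * (z - a) ^ m)%C).
    { induction m as [| m IH].
      - apply cdiff_ext_loc with (fun w => w - a)%C; [apply filter_forall; intros; simpl; ring |].
        eapply cdiff_eq; [| apply cdiff_minus; [apply cdiff_id | apply cdiff_const]]. simpl. ring.
      - eapply cdiff_eq; [| apply (cdiff_mult (fun w => w - a)%C (fun w => (w - a) ^ S m)%C); [apply cdiff_minus; [apply cdiff_id | apply cdiff_const] | exact IH]].
        rewrite (S_INR (S m)), RtoC_plus. simpl Cpow. ring. }
    apply cdiff_ext_loc with (fun w => (w - a) ^ S n * g w)%C.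
    + apply filter_imp with U; [intros w Hw; symmetry; apply E, Hw | apply open_locally; auto].
    + eapply cdiff_eq; [| apply cdiff_mult; [apply Hp | apply (Hol_derive U g z Hg Hz)]].
      cbv beta. simpl Cpow. ring.
Qed.

Lemma order_ge_derivs_zero (U : C -> Prop) (f g : C -> C) (a : C) (n : nat) :
  open U -> Hol U f -> U a -> order_ge U f a n g -> forall j, (j < n)%nat -> C_derive_n f j a = 0%C.
Proof.
  intros Ho Hf Ha Hg.
  assert (H : forall j m, (j + m = n)%nat -> exists h, order_ge U (C_derive_n f j) a m h).
  { induction j as [| j IH]; intros m Hm.
    - simpl in *. subst m. exists g. exact Hg.
    - destruct (IH (S m)) as [h Hh]; [lia |].
      apply (order_ge_derive U (C_derive_n f j) h a m); auto. apply Hol_C_derive_n; auto. }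
  intros j Hj. destruct (H j (n - j)%nat) as [h [_ E]]; [lia |].
  rewrite (E a Ha). replace (n - j)%nat with (S (n - j - 1)) by lia. simpl. ring.
Qed.

(** * Logarithms, Schwarz's lemma and Harnack's inequality *)

Lemma zero_derivative_const (U : C -> Prop) (f : C -> C) (a b : C) :
  Cconvex U -> (forall z, U z -> cdiff f z 0%C) -> U a -> U b -> f a = f b.
Proof.
  intros HU Hf Ha Hb.
  assert (E : seg_int (fun _ => 0%C) a b = (f b - f a)%C).
  { apply seg_int_derive.
    - intros t Ht. apply Hf, HU; auto.
    - intros t _. apply cont_at_const. }
  rewrite seg_int_const in E. transitivity (f b - (f b - f a))%C; [ring |].
  rewrite <- E. ring.
Qed.

Definition cexp (z : C) : C := (RtoC (exp (Re z)) * expi (Im z))%C.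

Lemma expi_plus (s t : R) : expi (s + t) = (expi s * expi t)%C.
Proof. unfold expi. rewrite cos_plus, sin_plus. apply injective_projections; simpl; ring. Qed.

Lemma cexp_plus (z w : C) : cexp (z + w) = (cexp z * cexp w)%C.
Proof.
  unfold cexp. unfold Re, Im; simpl. rewrite exp_plus, expi_plus, RtoC_mult. ring.
Qed.

Lemma Cmod_cexp (z : C) : Cmod (cexp z) = exp (Re z).
Proof.
  unfold cexp. rewrite Cmod_mult, Cmod_expi, Cmod_RtoC_pos by (apply Rlt_le, exp_pos). ring.
Qed.

Lemma expi_0 : expi 0 = 1%C.
Proof. unfold expi. rewrite cos_0, sin_0. reflexivity. Qed.

Lemma cdiff_cexp_0 : cdiff cexp 0 1.
Proof.
  apply cdiff_eps. intros eps He.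
  assert (V1 : vdiff (fun t => RtoC (exp t)) 0 1%C).
  { split; simpl; [| apply @is_derive_const].
    evar_last; [apply is_derive_exp | apply exp_0]. }
  assert (V2 := vdiff_expi 0). rewrite expi_0 in V2.
  set (e := Rmin 1 (eps / 3)). assert (He0 : 0 < e) by (unfold e; apply Rmin_glb_lt; lra).
  assert (He1 : e <= 1) by apply Rmin_l. assert (He2 : e <= eps / 3) by apply Rmin_r.
  destruct (proj1 (vdiff_eps _ _ _) V1 e He0) as [d1 [Hd1 K1]].
  destruct (proj1 (vdiff_eps _ _ _) V2 e He0) as [d2 [Hd2 K2]].
  exists (Rmin (eps / 12) (Rmin d1 d2)). split; [repeat apply Rmin_glb_lt; lra |].
  intros h Hh. replace (h - 0)%C with h in * by ring.
  destruct (Rmin_lt _ _ _ Hh) as [Hh0 Hh'].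
  destruct (Rmin_lt _ _ _ Hh') as [Hh1 Hh2].
  set (x := Re h). set (y := Im h).
  assert (Hx : Rabs x <= Cmod h) by apply abs_fst_le.
  assert (Hy : Rabs y <= Cmod h) by apply abs_snd_le.
  assert (Eh : h = (RtoC x + y * Ci)%C) by (apply injective_projections; unfold x, y, Re, Im; simpl; ring).
  specialize (K1 x). specialize (K2 y). rewrite Rminus_0_r in K1, K2.
  specialize (K1 ltac:(lra)). specialize (K2 ltac:(lra)). rewrite exp_0 in K1. rewrite expi_0 in K2.
  set (A := (RtoC (exp x) - 1 - x * 1)%C) in *. set (B := (expi y - 1 - y * (Ci * 1))%C) in *.
  assert (E0 : cexp 0 = 1%C).
  { unfold cexp, Re, Im; simpl. rewrite exp_0, expi_0. ring. }
  rewrite E0.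
  assert (E : (cexp h - 1 - 1 * h)%C = (A + B + (A + x) * (B + y * Ci))%C).
  { unfold cexp. fold x y. rewrite Eh. unfold A, B. ring. }
  rewrite E. set (c := Cmod h) in *. assert (Hc : 0 <= c) by apply Cmod_ge_0.
  assert (HA : Cmod A <= e * c) by nra. assert (HB : Cmod B <= e * c) by nra.
  assert (HAx : Cmod (A + x) <= 2 * c).
  { eapply Rle_trans; [apply Cmod_triangle |]. rewrite Cmod_R. nra. }
  assert (HBy : Cmod (B + y * Ci) <= 2 * c).
  { eapply Rle_trans; [apply Cmod_triangle |]. rewrite Cmod_mult, Cmod_Ci, Cmod_R. nra. }
  eapply Rle_trans; [apply Cmod_triangle |].
  assert (Cmod (A + B) <= e * c + e * c) by (eapply Rle_trans; [apply Cmod_triangle | lra]).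
  assert (Cmod ((A + x) * (B + y * Ci)) <= (2 * c) * (2 * c)).
  { rewrite Cmod_mult. apply Rmult_le_compat; auto; apply Cmod_ge_0. }
  nra.
Qed.

Lemma cdiff_cexp (z : C) : cdiff cexp z (cexp z).
Proof.
  apply cdiff_ext_loc with (fun w => cexp z * cexp (w - z))%C.
  - apply filter_forall. intros w. rewrite <- cexp_plus. f_equal. ring.
  - eapply cdiff_eq; cycle 1.
    + apply cdiff_mult; [apply cdiff_const |]. apply (cdiff_comp cexp (fun w => w - z)%C).
      * replace (z - z)%C with (RtoC 0) by ring. apply cdiff_cexp_0.
      * apply cdiff_minus; [apply cdiff_id | apply cdiff_const].
    + cbv beta. ring.
Qed.

(** [h] is a primitive of [g' / g]: the function [g exp (- h)] has derivative 0, and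
    [exp k] is its constant modulus. *)
Lemma log_exists (U : C -> Prop) (g : C -> C) :
  open U -> Cconvex U -> Hol U g -> (forall z, U z -> g z <> 0%C) ->
  exists h : C -> C, (forall z, U z -> cdiff h z (C_derive g z / g z)%C) /\
    exists k : R, forall z, U z -> ln (Cmod (g z)) = k + Re (h z).
Proof.
  intros Ho HU Hg H0.
  destruct (primitive_exists U (fun z => C_derive g z / g z)%C) as [h Hh]; auto.
  { apply Hol_div; auto. apply Hol_C_derive; auto. }
  exists h. split; [exact Hh |].
  destruct (classic (exists a, U a)) as [[a Ha] | Hn].
  2:{ exists 0. intros z Hz. exfalso; eauto. }
  set (p := fun z => (g z * cexp (- h z))%C).
  assert (Hp : forall z, U z -> p z = p a).
  { intros z Hz. apply (zero_derivative_const U); auto. intros w Hw.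
    eapply cdiff_eq; cycle 1.
    - unfold p. apply cdiff_mult; [apply (Hol_derive U); auto |].
      apply (cdiff_comp cexp (fun w => - h w)%C); [apply cdiff_cexp | apply cdiff_opp, Hh, Hw].
    - cbv beta. field. apply H0, Hw. }
  exists (ln (Cmod (p a))). intros z Hz. rewrite <- (Hp z Hz). unfold p.
  rewrite Cmod_mult, Cmod_cexp, ln_mult, ln_exp; [| apply Cmod_gt_0, H0, Hz | apply exp_pos].
  unfold Re; simpl. ring.
Qed.

Lemma Schwarz (f : C -> C) (c z : C) (r : R) :
  Hol (Disc c r) f -> (forall w, Disc c r w -> Cmod (f w) <= 1) -> f c = 0%C -> Disc c r z ->
  Cmod (f z) * r <= Cmod (z - c).
Proof.
  intros Hf H1 H0 Hz. unfold Disc in Hz. set (d := Cmod (z - c)) in *.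
  assert (Hd : 0 <= d) by apply Cmod_ge_0.
  assert (Hrc : Disc c r c) by (unfold Disc; rewrite Cmod_self; lra).
  assert (Hord : order_ge (Disc c r) f c 1 (slope f c)).
  { apply (order_ge_S _ f f); auto; [apply open_disc | apply convex_disc |].
    split; [exact Hf | intros; simpl; ring]. }
  assert (B : forall s, d < s < r -> Cmod (f z) * s <= d).
  { intros s Hs. assert (B := order_bound f (slope f c) c z 1 s r 1 Hord ltac:(fold d; lra) ltac:(lra)).
    fold d in B. apply Rmult_le_reg_r with (/ s); [apply Rinv_0_lt_compat; lra |].
    rewrite Rmult_assoc, Rinv_r by lra. rewrite Rmult_1_r. eapply Rle_trans; [apply B |].
    - apply sup_circle_intro; [lra |]. intros w Hw. apply H1. unfold Disc. lra.
    - unfold Rdiv. simpl. lra. }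
  apply Rnot_lt_le. intros Hlt.
  assert (F1 := H1 z Hz). set (m := Cmod (f z)) in *. assert (Hm0 : 0 <= m) by apply Cmod_ge_0.
  assert (Hm : 0 < m) by (destruct Hm0 as [|E]; [auto | rewrite <- E in Hlt; lra]).
  assert (E : m * (d / m) = d) by (field; lra).
  assert (d / m < r) by (apply Rmult_lt_reg_l with m; lra).
  assert (d <= d / m) by (apply Rmult_le_reg_l with m; [auto | nra]).
  specialize (B ((d / m + r) / 2) ltac:(lra)). nra.
Qed.

Lemma half_plane_identity (u v : C) :
  Cmod (u + Cconj v) ^ 2 - Cmod (u - v) ^ 2 = 4 * (Re u * Re v).
Proof. rewrite !Cmod2_alt. unfold Re, Im; simpl. ring. Qed.

Lemma Re_le_Cmod (z : C) : Re z <= Cmod z.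
Proof. eapply Rle_trans; [apply Rle_abs | apply abs_fst_le]. Qed.

(** Schwarz's lemma for maps into the right half plane, the disc being reached
    through the Moebius map [u |-> (u - v) / (u + conj v)]. *)
Lemma Schwarz_half_plane (H : C -> C) (c z : C) (r : R) :
  Hol (Disc c r) H -> (forall w, Disc c r w -> 0 < Re (H w)) -> Disc c r z ->
  Cmod (H z - H c) * r <= Cmod (z - c) * Cmod (H z + Cconj (H c)).
Proof.
  intros HH Hp Hz.
  assert (Hr0 : 0 < r) by (unfold Disc in Hz; generalize (Cmod_ge_0 (z - c)); lra).
  assert (Hc : Disc c r c) by (unfold Disc; rewrite Cmod_self; lra).
  set (v := H c) in *. assert (Hv := Hp c Hc). fold v in Hv.
  assert (Hd : forall w, Disc c r w -> 0 < Cmod (H w + Cconj v)).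
  { intros w Hw. eapply Rlt_le_trans; [| apply Re_le_Cmod]. specialize (Hp w Hw).
    unfold Re in *; simpl in *. lra. }
  assert (Hd' : forall w, Disc c r w -> (H w + Cconj v)%C <> 0%C) by (intros; apply Cmod_gt_0; auto).
  assert (S := Schwarz (fun w => (H w - v) / (H w + Cconj v))%C c z r).
  assert (S' : Cmod ((H z - v) / (H z + Cconj v)) * r <= Cmod (z - c)).
  { apply S; auto.
    - apply Hol_div; [exact Hd' | apply Hol_minus; auto; apply Hol_const | apply Hol_plus; auto; apply Hol_const].
    - intros w Hw. rewrite Cmod_div by auto. specialize (Hd w Hw). specialize (Hp w Hw).
      apply Rle_div_l; [exact Hd |]. rewrite Rmult_1_l.
      assert (I := half_plane_identity (H w) v). assert (0 < Re (H w) * Re v) by (apply Rmult_lt_0_compat; auto).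
      assert (G := Cmod_ge_0 (H w - v)). nra.
    - fold v. unfold Cdiv. ring. }
  rewrite Cmod_div in S' by auto. specialize (Hd z Hz).
  apply Rmult_le_compat_r with (r := Cmod (H z + Cconj v)) in S'; [| lra].
  replace (Cmod (H z - v) / Cmod (H z + Cconj v) * r * Cmod (H z + Cconj v))
    with (Cmod (H z - v) * r) in S' by (field; lra). exact S'.
Qed.

(** Schwarz's lemma gives [|H z - H c| <= q |H z + conj (H c)|], and the squares
    of the two moduli differ by [4 Re (H z) Re (H c)]. The factor 4 is not sharp;
    the linear dependence on [1 - q] is what the growth estimate uses. *)
Lemma Harnack_half_plane (H : C -> C) (c z : C) (r q : R) :
  Hol (Disc c r) H -> (forall w, Disc c r w -> 0 < Re (H w)) ->
  0 < r -> 0 <= q < 1 -> Cmod (z - c) <= q * r ->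
  (1 - q) * Re (H c) <= 4 * Re (H z) /\ (1 - q) * Re (H z) <= 4 * Re (H c).
Proof.
  intros HH Hp Hr Hq Hz.
  assert (Dz : Disc c r z) by (unfold Disc; nra).
  assert (Dc : Disc c r c) by (unfold Disc; rewrite Cmod_self; lra).
  assert (S := Schwarz_half_plane H c z r HH Hp Dz).
  assert (I := half_plane_identity (H z) (H c)).
  assert (Px := Hp z Dz). assert (P0 := Hp c Dc).
  set (x := Re (H z)) in *. set (x0 := Re (H c)) in *.
  assert (B : x + x0 <= Cmod (H z + Cconj (H c))).
  { eapply Rle_trans; [| apply Re_le_Cmod]. unfold x, x0, Re; simpl. lra. }
  set (P := Cmod (H z + Cconj (H c))) in *. set (Q := Cmod (H z - H c)) in *.
  assert (HQ : 0 <= Q) by apply Cmod_ge_0.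
  assert (HQP : Q <= q * P).
  { apply Rmult_le_reg_r with r; [exact Hr |]. eapply Rle_trans; [exact S |].
    replace (q * P * r) with (q * r * P) by ring. apply Rmult_le_compat_r; lra. }
  assert (HQP2 : Q ^ 2 <= (q * P) ^ 2) by (apply pow_incr; lra).
  assert (HP2 : (x + x0) ^ 2 <= P ^ 2) by (apply pow_incr; lra).
  assert (K : (1 - q) * (x + x0) ^ 2 <= 4 * (x * x0)).
  { apply Rle_trans with ((1 - q) * P ^ 2); [apply Rmult_le_compat_l; lra |].
    assert (0 <= q * (1 - q) * P ^ 2) by (apply Rmult_le_pos; [apply Rmult_le_pos; lra | apply pow_le; lra]).
    nra. }
  split.
  - apply Rmult_le_reg_r with x0; [exact P0 |].
    assert ((1 - q) * x0 ^ 2 <= (1 - q) * (x + x0) ^ 2) by (apply Rmult_le_compat_l; [lra | apply pow_incr; lra]).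
    simpl in *. lra.
  - apply Rmult_le_reg_r with x; [exact Px |].
    assert ((1 - q) * x ^ 2 <= (1 - q) * (x + x0) ^ 2) by (apply Rmult_le_compat_l; [lra | apply pow_incr; lra]).
    simpl in *. lra.
Qed.

(** Harnack's inequality for the positive harmonic function [ln |g / m|]. *)
Lemma Harnack (g : C -> C) (c z : C) (r q m : R) :
  Hol (Disc c r) g -> 0 < m -> (forall w, Disc c r w -> m < Cmod (g w)) ->
  0 < r -> 0 <= q < 1 -> Cmod (z - c) <= q * r ->
  (1 - q) * (ln (Cmod (g c)) - ln m) <= 4 * (ln (Cmod (g z)) - ln m) /\
  (1 - q) * (ln (Cmod (g z)) - ln m) <= 4 * (ln (Cmod (g c)) - ln m).
Proof.
  intros Hg Hm Hgm Hr Hq Hz.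
  destruct (log_exists (Disc c r) g) as [h [Hh [k Hk]]]; auto.
  { apply open_disc. } { apply convex_disc. }
  { intros w Hw. apply Cmod_gt_0. specialize (Hgm w Hw). lra. }
  assert (Dz : Disc c r z) by (unfold Disc; nra).
  assert (Dc : Disc c r c) by (unfold Disc; rewrite Cmod_self; lra).
  destruct (Harnack_half_plane (fun w => h w + (k - ln m)%R)%C c z r q) as [A B]; auto.
  { apply Hol_plus; [| apply Hol_const]. intros w Hw. eexists. apply Hh, Hw. }
  { intros w Hw. assert (E := Hk w Hw). specialize (Hgm w Hw). apply ln_increasing in Hgm; [| exact Hm].
    unfold Re in *; simpl. lra. }
  assert (Ez := Hk z Dz). assert (Ec := Hk c Dc).
  unfold Re in *; simpl in A, B. rewrite Ez, Ec.
  replace (k + fst (h c) - ln m) with (fst (h c) + (k - ln m)) by ring.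
  replace (k + fst (h z) - ln m) with (fst (h z) + (k - ln m)) by ring. auto.
Qed.

Lemma Liouville (f : C -> C) (M : R) :
  Hol plane f -> (forall z, Cmod (f z) <= M) -> forall z w, f z = f w.
Proof.
  intros Hf HM z w. apply (zero_derivative_const plane); try exact I; [apply convex_plane |].
  intros a _. replace (RtoC 0) with (C_derive f a); [apply (Hol_derive plane); auto; exact I |].
  assert (HM0 : 0 <= M) by (apply Rle_trans with (1 := Cmod_ge_0 (f a)); apply HM).
  apply Cmod_arbitrarily_small. intros eps He.
  set (r := (2 * M + 1) / eps). assert (Hr : 0 < r) by (apply Rdiv_lt_0_compat; lra).
  assert (B := Cauchy_estimate_disc f a r M Hr ltac:(apply Hol_plane_sub; auto) ltac:(auto)).
  eapply Rle_trans; [exact B |]. apply Rle_div_l; [exact Hr |]. unfold r.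
  replace (eps * ((2 * M + 1) / eps)) with (2 * M + 1) by (field; lra). lra.
Qed.

Definition exp_type (f : C -> C) : Prop :=
  exists K, 0 < K /\ forall z, Cmod (f z) <= exp (K * (1 + Cmod z)).

(** Borel and Caratheodory's inequality bounds a logarithm of [f] linearly,
    so its derivative is constant by Liouville's theorem. *)
Theorem zero_free_exp_type (f : C -> C) :
  Hol plane f -> exp_type f -> (forall z, f z <> 0%C) ->
  exists c : C, forall z, C_derive f z = (c * f z)%C.
Proof.
  intros Hf [K [HK HfK]] H0.
  destruct (log_exists plane f open_plane convex_plane Hf (fun z _ => H0 z)) as [h [Hh [k Hk]]].
  assert (Hhol : Hol plane h) by (intros z Hz; eexists; apply Hh, Hz).
  set (h1 := fun z => (h z - h 0%C)%C).
  assert (Hh1 : Hol plane h1) by (apply Hol_minus; [exact Hhol | apply Hol_const]).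
  set (K' := K + Rabs (k + Re (h 0%C))). assert (HKK : 0 < K') by (unfold K'; generalize (Rabs_pos (k + Re (h 0%C))); lra).
  assert (HRe : forall z, Re (h1 z) <= K' * (1 + Cmod z)).
  { intros z. assert (E := Hk z I). assert (L : ln (Cmod (f z)) <= K * (1 + Cmod z)).
    { rewrite <- (ln_exp (K * (1 + Cmod z))). apply ln_le; [apply Cmod_gt_0, H0 | apply HfK]. }
    assert (Er : Re (h1 z) = Re (h z) - Re (h 0%C)) by (unfold h1, Re; simpl; ring).
    rewrite Er. assert (A := Rle_abs (- (k + Re (h 0%C)))). rewrite Rabs_Ropp in A.
    unfold K'. assert (P := Cmod_ge_0 z). assert (Q := Rabs_pos (k + Re (h 0%C))). nra. }
  assert (BC : forall r z, 0 < r -> Cmod z <= r / 2 -> Cmod (h1 z) <= 2 * (K' * (1 + r))).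
  { intros r z Hr Hz. set (A := K' * (1 + r)). assert (HA : 0 < A) by (unfold A; nra).
    assert (S := Schwarz_half_plane (fun w => A - h1 w)%C 0 z r).
    assert (S' : Cmod ((A - h1 z) - (A - h1 0%C)) * r <= Cmod (z - 0) * Cmod ((A - h1 z) + Cconj (A - h1 0%C))).
    { apply S.
      - apply (Hol_subset plane); [intros; exact I | apply Hol_minus; [apply Hol_const | exact Hh1]].
      - intros w Hw. unfold Disc in Hw. replace (w - 0)%C with w in Hw by ring.
        assert (B := HRe w). assert (K' * (1 + Cmod w) < A) by (unfold A; apply Rmult_lt_compat_l; lra).
        change (0 < A - Re (h1 w)). lra.
      - unfold Disc. replace (z - 0)%C with z by ring. lra. }
    assert (E0 : h1 0%C = 0%C) by (unfold h1; ring).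
    rewrite E0 in S'. replace ((A - h1 z) - (A - 0))%C with (- h1 z)%C in S' by ring.
    replace ((A - h1 z) + Cconj (A - 0))%C with ((2 * A)%R - h1 z)%C in S'
      by (apply injective_projections; simpl; ring).
    replace (z - 0)%C with z in S' by ring. rewrite Cmod_opp in S'.
    assert (T : Cmod ((2 * A)%R - h1 z) <= 2 * A + Cmod (h1 z)).
    { eapply Rle_trans; [apply Cmod_triangle |]. rewrite Cmod_opp, Cmod_RtoC_pos; lra. }
    set (x := Cmod (h1 z)) in *. assert (Hx : 0 <= x) by apply Cmod_ge_0.
    assert (Hz0 := Cmod_ge_0 z).
    assert (x * r <= r / 2 * (2 * A + x)).
    { eapply Rle_trans; [exact S' |]. apply Rmult_le_compat; auto. apply Cmod_ge_0. }
    assert (x * r <= (2 * A) * r) by nra. apply Rmult_le_reg_r with r; lra. }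
  assert (Hd : Hol plane (C_derive h1)) by (apply Hol_C_derive; [apply open_plane | exact Hh1]).
  assert (Hb : forall z, Cmod (C_derive h1 z) <= 20 * K').
  { intros z. set (s := Cmod z + 1). assert (Hz0 := Cmod_ge_0 z).
    assert (B := Cauchy_estimate_disc h1 z s (2 * (K' * (1 + 4 * s))) ltac:(unfold s; lra)
      ltac:(apply Hol_plane_sub; auto)).
    eapply Rle_trans; [apply B |].
    - intros w Hw. apply BC; [unfold s; lra |]. unfold Disc in Hw.
      generalize (Cmod_tri_sub w z 0). replace (w - 0)%C with w by ring. replace (z - 0)%C with z by ring.
      unfold s in *. lra.
    - apply Rle_div_l; unfold s; nra. }
  exists (C_derive h1 0%C). intros z. rewrite (Liouville _ _ Hd Hb 0%C z).
  assert (E : C_derive h1 z = (C_derive f z / f z)%C).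
  { apply cdiff_unique. eapply cdiff_eq; [| apply cdiff_minus; [apply Hh; exact I | apply cdiff_const]]. ring. }
  rewrite E. field. apply H0.
Qed.

(** * Locally uniform limits: Weierstrass and Hurwitz *)

(** Morera: integrals over triangles vanish in the limit. *)
Lemma uniform_limit_Hol (f : C -> C) (c : C) (r : R) :
  (forall eps, 0 < eps -> exists g, Hol (Disc c r) g /\ forall z, Disc c r z -> Cmod (g z - f z) <= eps) ->
  Hol (Disc c r) f.
Proof.
  intros H.
  assert (Hc : forall z, Disc c r z -> cont_at f z).
  { intros z Hz. apply cont_at_C. intros eps He.
    destruct (H (eps / 4)) as [g [Hg Hgf]]; [lra |].
    destruct (proj1 (cont_at_C g z) (Hol_cont _ _ _ Hg Hz) (eps / 4)) as [d [Hd Hd']]; [lra |].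
    destruct (proj1 (open_C_iff _) (open_disc c r) z Hz) as [d1 [Hd1 Hd1']].
    exists (Rmin d d1). split; [apply Rmin_glb_lt; auto |]. intros w Hw.
    specialize (Hd' w (Rlt_le_trans _ _ _ Hw (Rmin_l _ _))).
    specialize (Hd1' w (Rlt_le_trans _ _ _ Hw (Rmin_r _ _))).
    assert (A := Hgf w Hd1'). assert (B := Hgf z Hz).
    assert (T1 := Cmod_tri_sub (f w) (g w) (f z)). assert (T2 := Cmod_tri_sub (g w) (g z) (f z)).
    rewrite (Cmod_sym (f w) (g w)) in T1. lra. }
  assert (HT : forall x y, Disc c r x -> Disc c r y -> Disc c r c -> tri_int f c x y = 0%C).
  { intros x y Hx Hy Hcc. apply Cmod_arbitrarily_small. intros eps He.
    assert (HP := perim_ge_0 c x y). set (p := perim c x y) in *.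
    destruct (H (eps / (p + 1))) as [g [Hg Hgf]]; [apply Rdiv_lt_0_compat; lra |].
    assert (Sf : forall u v, Disc c r u -> Disc c r v -> seg_cont f u v).
    { intros u v Hu Hv t Ht. apply Hc, convex_disc; auto. }
    assert (Sg : forall u v, Disc c r u -> Disc c r v -> seg_cont g u v).
    { intros u v Hu Hv. apply Hol_seg_cont with (Disc c r); auto. apply convex_disc. }
    assert (Sd : forall u v, Disc c r u -> Disc c r v -> seg_cont (fun w => f w - g w)%C u v).
    { intros u v Hu Hv t Ht. apply cont_at_minus; [apply Sf | apply Sg]; auto. }
    assert (E : tri_int f c x y = tri_int (fun w => f w - g w)%C c x y).
    { transitivity (tri_int (fun w => (f w - g w) + g w)%C c x y).
      - unfold tri_int. rewrite !(seg_int_ext f (fun w => (f w - g w) + g w)%C) by (intros; ring). reflexivity.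
      - rewrite tri_int_plus, (Goursat g); auto; [ring |].
        intros v Hv. apply Hg, (hull_in_convex _ c x y); auto. apply convex_disc. }
    rewrite E. eapply Rle_trans.
    - apply (tri_int_bound _ (Disc c r)) with (M := eps / (p + 1)); auto; [apply convex_disc |].
      intros w Hw. rewrite Cmod_sym. auto.
    - fold p. replace eps with (eps / (p + 1) * (p + 1)) at 2 by (field; lra).
      assert (0 < eps / (p + 1)) by (apply Rdiv_lt_0_compat; lra). nra. }
  intros z Hz.
  assert (Hcc : Disc c r c) by (unfold Disc in *; rewrite Cmod_self; generalize (Cmod_ge_0 (z - c)); lra).
  assert (HF := primitive_of_triangles (Disc c r) f c (open_disc c r) (convex_disc c r) Hcc Hc
    (fun x y Hx Hy => HT x y Hx Hy Hcc)).
  apply (Hol_ext (Disc c r) (C_derive (seg_int f c))); auto; [apply open_disc | |].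
  - intros w Hw. apply cdiff_unique, HF, Hw.
  - apply Hol_C_derive; [apply open_disc |]. intros w Hw. eexists. apply HF, Hw.
Qed.

Definition cvg_plane (g : nat -> C -> C) (h : C -> C) : Prop :=
  forall r eps, 0 < eps -> exists N, forall n, (N <= n)%nat ->
  forall z, Cmod z < r -> Cmod (g n z - h z) < eps.

Definition hol_eventually (g : nat -> C -> C) : Prop :=
  forall r, exists N, forall n, (N <= n)%nat -> Hol (Disc 0 r) (g n).

Lemma Disc_0 (r : R) (z : C) : Disc 0 r z <-> Cmod z < r.
Proof. unfold Disc. replace (z - 0)%C with z by ring. reflexivity. Qed.

Lemma cvg_plane_Hol (g : nat -> C -> C) (h : C -> C) :
  hol_eventually g -> cvg_plane g h -> Hol plane h.
Proof.
  intros Hg Hc z _. set (r := Cmod z + 1).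
  assert (H : Hol (Disc 0 r) h).
  { apply uniform_limit_Hol. intros eps He. destruct (Hg r) as [N1 H1].
    destruct (Hc r eps He) as [N2 H2]. exists (g (Nat.max N1 N2)). split; [apply H1; lia |].
    intros w Hw. apply Rlt_le, H2; [lia | apply Disc_0, Hw]. }
  apply H, Disc_0. unfold r. lra.
Qed.

Lemma hol_eventually_derive (g : nat -> C -> C) :
  hol_eventually g -> hol_eventually (fun n => C_derive (g n)).
Proof.
  intros H r. destruct (H r) as [N HN]. exists N. intros n Hn. apply Hol_C_derive; auto. apply open_disc.
Qed.

Lemma Disc_0_sub (r s : R) (z w : C) : Cmod z < r -> Disc z s w -> Disc 0 (r + s) w.
Proof.
  intros Hz Hw. apply Disc_0. unfold Disc in Hw.
  generalize (Cmod_add w z). lra.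
Qed.

Lemma cvg_plane_derive (g : nat -> C -> C) (h : C -> C) :
  hol_eventually g -> cvg_plane g h -> cvg_plane (fun n => C_derive (g n)) (C_derive h).
Proof.
  intros Hg Hc r eps He. assert (Hh := cvg_plane_Hol g h Hg Hc).
  destruct (Hg (r + 1)) as [N1 H1]. destruct (Hc (r + 1) (eps / 3)) as [N2 H2]; [lra |].
  exists (Nat.max N1 N2). intros n Hn z Hz.
  assert (Gn := H1 n ltac:(lia)).
  assert (Hd : Hol (Disc z 1) (fun w => g n w - h w)%C).
  { apply Hol_minus.
    - apply (Hol_subset (Disc 0 (r + 1))); auto. intros w. apply Disc_0_sub, Hz.
    - apply Hol_plane_sub; auto. }
  assert (E : (C_derive (g n) z - C_derive h z)%C = C_derive (fun w => g n w - h w)%C z).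
  { symmetry. apply cdiff_unique, cdiff_minus.
    - apply (Hol_derive (Disc 0 (r + 1))); auto. apply Disc_0. lra.
    - apply (Hol_derive plane); auto. exact I. }
  rewrite E. eapply Rle_lt_trans.
  - apply (Cauchy_estimate_disc _ z 1 (eps / 3)); auto; [lra |].
    intros w Hw. apply Rlt_le, H2; [lia |]. apply Disc_0, (Disc_0_sub r 1 z); auto.
  - lra.
Qed.

Lemma cvg_plane_derive_n (g : nat -> C -> C) (h : C -> C) (j : nat) :
  hol_eventually g -> cvg_plane g h ->
  hol_eventually (fun n => C_derive_n (g n) j) /\ cvg_plane (fun n => C_derive_n (g n) j) (C_derive_n h j).
Proof.
  intros Hg Hc. induction j as [| j [IH1 IH2]]; simpl; [auto |]. split.
  - apply (hol_eventually_derive _ IH1).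
  - apply (cvg_plane_derive _ _ IH1 IH2).
Qed.

Lemma entire_bounded (h : C -> C) (r : R) :
  Hol plane h -> exists M, 0 < M /\ forall z, Cmod z < r -> Cmod (h z) <= M.
Proof.
  intros Hh. destruct (Rle_dec r 0) as [Hr | Hr].
  - exists 1. split; [lra |]. intros z Hz. generalize (Cmod_ge_0 z). lra.
  - assert (Hh' : Hol (Disc 0 (r + 1)) h) by (apply Hol_plane_sub; auto).
    destruct (Hol_circle_bounded h 0 r (r + 1) Hh') as [M HM]; [lra |].
    exists (Rmax M 1). split; [eapply Rlt_le_trans; [apply Rlt_0_1 | apply Rmax_r] |].
    intros z Hz. apply Rle_trans with M; [| apply Rmax_l].
    apply (max_principle h 0 z r (r + 1)); auto; [| lra]. apply Disc_0, Hz.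
Qed.

Lemma cvg_plane_mult (g1 g2 : nat -> C -> C) (h1 h2 : C -> C) :
  Hol plane h1 -> Hol plane h2 -> cvg_plane g1 h1 -> cvg_plane g2 h2 ->
  cvg_plane (fun n z => g1 n z * g2 n z)%C (fun z => h1 z * h2 z)%C.
Proof.
  intros H1 H2 C1 C2 r eps He.
  destruct (entire_bounded h1 r H1) as [M1 [P1 B1]]. destruct (entire_bounded h2 r H2) as [M2 [P2 B2]].
  set (e := Rmin 1 (eps / (M1 + M2 + 2))).
  assert (He0 : 0 < e) by (unfold e; apply Rmin_glb_lt; [lra | apply Rdiv_lt_0_compat; lra]).
  assert (He1 : e <= 1) by apply Rmin_l.
  assert (He2 : e * (M1 + M2 + 2) <= eps).
  { replace eps with (eps / (M1 + M2 + 2) * (M1 + M2 + 2)) by (field; lra).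
    apply Rmult_le_compat_r; [lra | apply Rmin_r]. }
  destruct (C1 r e He0) as [N1 K1]. destruct (C2 r e He0) as [N2 K2].
  exists (Nat.max N1 N2). intros n Hn z Hz.
  specialize (K1 n ltac:(lia) z Hz). specialize (K2 n ltac:(lia) z Hz).
  specialize (B1 z Hz). specialize (B2 z Hz).
  replace (g1 n z * g2 n z - h1 z * h2 z)%C
    with ((g1 n z - h1 z) * (g2 n z - h2 z) + ((g1 n z - h1 z) * h2 z + h1 z * (g2 n z - h2 z)))%C by ring.
  eapply Rle_lt_trans; [apply Cmod_triangle |].
  assert (T := Cmod_triangle ((g1 n z - h1 z) * h2 z) (h1 z * (g2 n z - h2 z))).
  rewrite !Cmod_mult in *.
  assert (Q1 := Cmod_ge_0 (g1 n z - h1 z)). assert (Q2 := Cmod_ge_0 (g2 n z - h2 z)).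
  assert (Q3 := Cmod_ge_0 (h1 z)). assert (Q4 := Cmod_ge_0 (h2 z)).
  assert (Cmod (g1 n z - h1 z) * Cmod (g2 n z - h2 z) <= e * 1) by (apply Rmult_le_compat; lra).
  assert (Cmod (g1 n z - h1 z) * Cmod (h2 z) <= e * M2) by (apply Rmult_le_compat; lra).
  assert (Cmod (h1 z) * Cmod (g2 n z - h2 z) <= M1 * e) by (apply Rmult_le_compat; lra).
  nra.
Qed.

Lemma cvg_plane_const (c : C) : cvg_plane (fun _ _ => c) (fun _ => c).
Proof. intros r eps He. exists 0%nat. intros. rewrite Cmod_self. exact He. Qed.

Lemma cvg_plane_pow (g : nat -> C -> C) (h : C -> C) (m : nat) :
  Hol plane h -> cvg_plane g h -> cvg_plane (fun n z => g n z ^ m)%C (fun z => h z ^ m)%C.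
Proof.
  intros Hh Hc. induction m as [| m IH]; simpl; [apply cvg_plane_const |].
  apply cvg_plane_mult; auto. apply Hol_pow, Hh.
Qed.

Lemma Hol_C_prod (U : C -> Prop) (a : nat -> C -> C) (n : nat) :
  (forall i, Hol U (a i)) -> Hol U (fun z => C_prod (fun i => a i z) n).
Proof.
  intros H. induction n as [| n IH]; simpl; [apply Hol_const | apply Hol_mult; auto].
Qed.

Lemma cvg_plane_C_prod (a : nat -> nat -> C -> C) (b : nat -> C -> C) (m : nat) :
  (forall i, Hol plane (b i)) -> (forall i, cvg_plane (a i) (b i)) ->
  cvg_plane (fun n z => C_prod (fun i => a i n z) m) (fun z => C_prod (fun i => b i z) m).
Proof.
  intros Hb Hc. induction m as [| m IH]; simpl; [apply cvg_plane_const |].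
  apply cvg_plane_mult; auto. apply Hol_C_prod, Hb.
Qed.

Lemma Hol_diff_monomial (U : C -> Prop) (k : nat) (q : nat -> nat) (f : C -> C) :
  open U -> Hol U f -> Hol U (diff_monomial k q f).
Proof.
  intros Ho Hf. apply (Hol_C_prod U (fun i z => C_derive_n f i z ^ q i)%C).
  intros i. apply Hol_pow, Hol_C_derive_n; auto.
Qed.

Lemma cvg_plane_diff_monomial (k : nat) (q : nat -> nat) (g : nat -> C -> C) (h : C -> C) :
  hol_eventually g -> cvg_plane g h ->
  cvg_plane (fun n => diff_monomial k q (g n)) (diff_monomial k q h).
Proof.
  intros Hg Hc. assert (Hh := cvg_plane_Hol g h Hg Hc).
  assert (Hd : forall i, Hol plane (C_derive_n h i)).
  { intros i. apply Hol_C_derive_n; [apply open_plane | exact Hh]. }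
  apply (cvg_plane_C_prod (fun i n z => C_derive_n (g n) i z ^ q i)%C (fun i z => C_derive_n h i z ^ q i)%C).
  - intros i. apply Hol_pow, Hd.
  - intros i. apply cvg_plane_pow; [apply Hd | apply (cvg_plane_derive_n g h i Hg Hc)].
Qed.

(** Without zeros of [g n] near [a], the maximum principle for [1 / g n] would
    keep [g n a] away from [0]. *)
Theorem Hurwitz (g : nat -> C -> C) (h : C -> C) (a : C) (r : R) :
  hol_eventually g -> cvg_plane g h -> (exists z, h z <> 0%C) -> h a = 0%C -> 0 < r ->
  exists N, forall n, (N <= n)%nat -> exists z, Cmod (z - a) < r /\ g n z = 0%C.
Proof.
  intros Hg Hc Hn Ha Hr. assert (Hh := cvg_plane_Hol g h Hg Hc).
  destruct (isolated_zero h a Hh Hn) as [r1 [Hr1 Hiso]].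
  set (s := Rmin r r1 / 2).
  assert (Hs : 0 < s < r /\ s < r1).
  { unfold s. generalize (Rmin_glb_lt _ _ _ Hr Hr1), (Rmin_l r r1), (Rmin_r r r1). lra. }
  assert (Hcn : forall t, h (circ a s t) <> 0%C).
  { intros t. assert (E := Cmod_circ a s t ltac:(lra)). apply Hiso; [| lra].
    intros F. rewrite F, Cmod_self in E. lra. }
  destruct (circle_bounded (fun w => / h w)%C a s) as [M HM].
  { intros t. apply cont_at_inv; [apply Hcn | apply (Hol_cont plane); auto; exact I]. }
  assert (Hinv : forall t, 0 <= t <= 2 * PI -> 0 < M /\ / M <= Cmod (h (circ a s t))).
  { intros t Ht. assert (B := HM t Ht). cbv beta in B. rewrite Cmod_inv in B by apply Hcn.
    assert (P := proj1 (Cmod_gt_0 _) (Hcn t)).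
    split; [eapply Rlt_le_trans; [apply Rinv_0_lt_compat, P | exact B] |].
    rewrite <- (Rinv_inv (Cmod (h (circ a s t)))). apply Rinv_le_contravar; [apply Rinv_0_lt_compat, P | exact B]. }
  assert (HM0 : 0 < M) by (apply (Hinv 0); generalize two_PI_pos; lra).
  assert (HiM : 0 < / M) by (apply Rinv_0_lt_compat, HM0).
  set (R0 := Cmod a + r + 1).
  destruct (Hg R0) as [N1 H1]. destruct (Hc R0 (/ M / 2)) as [N2 H2]; [lra |].
  exists (Nat.max N1 N2). intros n Hn'. apply NNPP. intros Hno.
  assert (Hnz : forall z, Disc a r z -> g n z <> 0%C).
  { intros z Hz E. apply Hno. exists z. split; auto. }
  assert (Hin : forall z, Cmod (z - a) <= r -> Cmod z < R0).
  { intros z Hz. generalize (Cmod_add z a). unfold R0. lra. }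
  assert (Hhol : Hol (Disc a r) (fun z => / g n z)%C).
  { apply Hol_inv; auto. apply (Hol_subset (Disc 0 R0)); [| apply H1; lia].
    intros z Hz. apply Disc_0, Hin. unfold Disc in Hz. lra. }
  assert (B : Cmod (/ g n a) <= 2 * M).
  { apply (max_principle (fun z => / g n z)%C a a s r); auto; [rewrite Cmod_self; lra | lra |].
    intros t Ht. assert (Hw := Cmod_circ a s t ltac:(lra)). set (w := circ a s t) in *.
    assert (Hw0 : g n w <> 0%C) by (apply Hnz; unfold Disc; lra).
    rewrite Cmod_inv by exact Hw0. replace (2 * M) with (/ (/ M / 2)) by (field; lra).
    apply Rinv_le_contravar; [lra |]. specialize (H2 n ltac:(lia) w (Hin w ltac:(lra))).
    destruct (Hinv t Ht) as [_ L]. fold w in L. assert (T := Cmod_rev (h w) (g n w)). rewrite Cmod_sym in T. lra. }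
  assert (Ha0 : g n a <> 0%C) by (apply Hnz; unfold Disc; rewrite Cmod_self; lra).
  rewrite Cmod_inv in B by exact Ha0.
  specialize (H2 n ltac:(lia) a (Hin a ltac:(rewrite Cmod_self; lra))). rewrite Ha in H2.
  replace (g n a - 0)%C with (g n a) in H2 by ring.
  assert (P := proj1 (Cmod_gt_0 _) Ha0).
  apply (Rinv_lt_contravar) in H2; [| apply Rmult_lt_0_compat; lra].
  replace (/ (/ M / 2)) with (2 * M) in H2 by (field; lra). lra.
Qed.

(** * Compactness of discs and the Arzela-Ascoli theorem *)

(** The passage from local to uniform, for statements about all small scales [s].
    With [s = 1 / (n + 1)] it turns locally uniform convergence into uniform
    convergence on discs. *)
Lemma disc_uniform (c : C) (r : R) (Q : R -> C -> Prop) :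
  (forall z, Cmod (z - c) <= 2 * r -> exists d, 0 < d /\
     forall w, Cmod (w - z) < d -> forall s, 0 < s < d -> Q s w) ->
  exists d, 0 < d /\ forall w, Cmod (w - c) <= r -> forall s, 0 < s < d -> Q s w.
Proof.
  intros H.
  assert (G : forall u v : R, { d : posreal | Rabs u <= r -> Rabs v <= r ->
     forall w, Rabs (fst (w - c)%C - u) < d -> Rabs (snd (w - c)%C - v) < d -> forall s, 0 < s < d -> Q s w }).
  { intros u v. apply constructive_indefinite_description.
    destruct (classic (Rabs u <= r /\ Rabs v <= r)) as [[Hu Hv] | Hn].
    2:{ exists (mkposreal 1 Rlt_0_1). intros; exfalso; auto. }
    set (z := (c + (u, v))%C).
    assert (Ez : (z - c)%C = (u, v)) by (unfold z; ring).
    destruct (H z) as [d [Hd K]].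
    { rewrite Ez. eapply Rle_trans; [apply Cmod_le_abs |]. simpl. lra. }
    assert (Hd2 : 0 < d / 2) by lra. exists (mkposreal _ Hd2). simpl.
    intros _ _ w H1 H2 s Hs. apply (K w); [| lra].
    replace (w - z)%C with ((w - c) - (u, v))%C by (unfold z; ring).
    eapply Rle_lt_trans; [apply Cmod_le_abs |]. simpl. unfold Rminus in H1, H2. simpl in H1, H2. lra. }
  destruct (compactness_value_2d (- r) r (- r) r (fun u v => proj1_sig (G u v))) as [d Hd].
  exists d. split; [apply cond_pos |]. intros w Hw s Hs.
  assert (W1 := abs_fst_le (w - c)). assert (W2 := abs_snd_le (w - c)).
  assert (W3 := proj1 (Rabs_le_between _ _) (Rle_trans _ _ _ W1 Hw)).
  assert (W4 := proj1 (Rabs_le_between _ _) (Rle_trans _ _ _ W2 Hw)).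
  apply NNPP. intros Hn. apply (Hd _ _ W3 W4). intros [u [v [Hu [Hv [H1 [H2 H3]]]]]].
  apply Hn. apply (proj2_sig (G u v)); auto.
  - apply Rabs_le_between, Hu.
  - apply Rabs_le_between, Hv.
  - lra.
Qed.

Lemma disc_uniform_nat (c : C) (r : R) (Q : nat -> C -> Prop) :
  (forall z, Cmod (z - c) <= 2 * r -> exists d N, 0 < d /\
     forall n, (N <= n)%nat -> forall w, Cmod (w - z) < d -> Q n w) ->
  exists N, forall n, (N <= n)%nat -> forall w, Cmod (w - c) <= r -> Q n w.
Proof.
  intros H.
  destruct (disc_uniform c r (fun s w => forall n, / INR (S n) <= s -> Q n w)) as [d [Hd K]].
  - intros z Hz. destruct (H z Hz) as [d [N [Hd K]]].
    assert (HN : 0 < / INR (S N)) by (apply Rinv_0_lt_compat, lt_0_INR; lia).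
    exists (Rmin d (/ INR (S N))). split; [apply Rmin_glb_lt; auto |].
    intros w Hw s Hs n Hn. apply K; [| eapply Rlt_le_trans; [apply Hw | apply Rmin_l]].
    destruct (Nat.le_gt_cases N n) as [L | L]; [exact L | exfalso].
    assert (/ INR (S N) <= / INR (S n)).
    { apply Rinv_le_contravar; [apply lt_0_INR; lia | apply le_INR; lia]. }
    assert (s < / INR (S N)) by (eapply Rlt_le_trans; [apply Hs | apply Rmin_r]). lra.
  - destruct (archimed_cor1 d Hd) as [N [HN HN0]]. exists N. intros n Hn w Hw.
    assert (HN1 : 0 < INR N) by (apply lt_0_INR; lia).
    apply (K w Hw (/ INR N)); [split; [apply Rinv_0_lt_compat, HN1 | exact HN] |].
    apply Rinv_le_contravar; [exact HN1 | apply le_INR; lia].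
Qed.

Definition strict_incr (phi : nat -> nat) : Prop := forall n, (phi n < phi (S n))%nat.

Lemma strict_incr_lt (phi : nat -> nat) : strict_incr phi -> forall n m, (n < m)%nat -> (phi n < phi m)%nat.
Proof. intros H n m Hnm. induction Hnm; [apply H | specialize (H m); lia]. Qed.

Lemma strict_incr_ge (phi : nat -> nat) : strict_incr phi -> forall n, (n <= phi n)%nat.
Proof. intros H n. induction n as [| n IH]; [lia | specialize (H n); lia]. Qed.

Lemma strict_incr_comp (phi psi : nat -> nat) :
  strict_incr phi -> strict_incr psi -> strict_incr (fun n => phi (psi n)).
Proof. intros H1 H2 n. apply strict_incr_lt; auto. Qed.

Lemma subsequence_converges (u : nat -> R) (B : R) (N : nat) :
  (forall n, (N <= n)%nat -> Rabs (u n) <= B) ->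
  exists phi, strict_incr phi /\ exists l : R, is_lim_seq (fun n => u (phi n)) l.
Proof.
  intros HB.
  destruct (Bolzano_Weierstrass (fun n => u (N + n)%nat) (fun x => - B <= x <= B)) as [l Hl].
  { apply compact_P3. } { intros n. apply Rabs_le_between, HB. lia. }
  assert (P : forall M (e : posreal), { p | (M <= p)%nat /\ Rabs (u p - l) < e }).
  { intros M e. apply constructive_indefinite_description.
    destruct (Hl (fun x => Rabs (x - l) < e) M) as [p [Hp1 Hp2]].
    - exists e. intros x Hx. exact Hx.
    - exists (N + p)%nat. split; [lia | exact Hp2]. }
  set (e := fun n => mkposreal (/ INR (S n)) (Rinv_0_lt_compat _ (lt_0_INR (S n) (Nat.lt_0_succ n)))).
  set (phi := fix phi n := match n with O => proj1_sig (P 0%nat (e 0%nat))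
                                      | S m => proj1_sig (P (S (phi m)) (e (S m))) end).
  assert (Hphi : forall n, Rabs (u (phi n) - l) < e n).
  { intros [| n]; simpl phi.
    - apply (proj2_sig (P 0%nat (e 0%nat))).
    - apply (proj2_sig (P (S (phi n)) (e (S n)))). }
  exists phi. split.
  - intros n. change (phi (S n)) with (proj1_sig (P (S (phi n)) (e (S n)))).
    destruct (proj2_sig (P (S (phi n)) (e (S n)))) as [H _]. lia.
  - exists l. apply is_lim_seq_spec. intros eps.
    destruct (archimed_cor1 eps (cond_pos eps)) as [M [HM HM0]]. exists M. intros n Hn.
    eapply Rlt_trans; [apply Hphi |]. change (/ INR (S n) < eps). eapply Rle_lt_trans; [| exact HM].
    apply Rinv_le_contravar; [apply lt_0_INR; lia | apply le_INR; lia].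
Qed.

Lemma diagonal_subsequence (u : nat -> nat -> R) :
  (forall i, exists B N, forall n, (N <= n)%nat -> Rabs (u i n) <= B) ->
  exists phi, strict_incr phi /\ forall i, exists l : R, is_lim_seq (fun n => u i (phi n)) l.
Proof.
  intros HB.
  assert (Step : forall i phi, { psi | strict_incr phi -> strict_incr psi /\ exists l : R, is_lim_seq (fun n => u i (phi (psi n))) l }).
  { intros i phi. apply constructive_indefinite_description.
    destruct (classic (strict_incr phi)) as [Hp | Hn]; [| exists phi; intros; contradiction].
    destruct (HB i) as [B [N H]].
    destruct (subsequence_converges (fun n => u i (phi n)) B N) as [psi Hpsi].
    - intros n Hn. apply H. generalize (strict_incr_ge phi Hp n). lia.
    - exists psi. intros _. exact Hpsi. }
  set (Phi := fix Phi i := match i with O => fun n => n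
        | S j => fun n => Phi j (proj1_sig (Step j (Phi j)) n) end).
  assert (HPhi : forall i, strict_incr (Phi i)).
  { induction i as [| i IH]; [intros n; simpl; lia |].
    apply (strict_incr_comp (Phi i)); [exact IH | apply (proj2_sig (Step i (Phi i)) IH)]. }
  (* from rank [i] on, the diagonal is a subsequence of the i-th extraction *)
  assert (Htail : forall i k, exists th, strict_incr th /\ forall n, Phi (k + i)%nat n = Phi i (th n)).
  { intros i k. induction k as [| k [th [H1 H2]]].
    - exists (fun n => n). split; [intros n; lia | reflexivity].
    - exists (fun n => th (proj1_sig (Step (k + i)%nat (Phi (k + i)%nat)) n)). split.
      + apply strict_incr_comp; [exact H1 |]. apply (proj2_sig (Step (k + i)%nat (Phi (k + i)%nat)) (HPhi _)).
      + intros n. rewrite <- H2. reflexivity. }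
  exists (fun n => Phi n n). split.
  - intros n. change (Phi (S n) (S n)) with (Phi n (proj1_sig (Step n (Phi n)) (S n))).
    apply strict_incr_lt; [apply HPhi |].
    destruct (proj2_sig (Step n (Phi n)) (HPhi n)) as [H _].
    generalize (strict_incr_ge _ H (S n)). lia.
  - intros i. destruct (proj2_sig (Step i (Phi i)) (HPhi i)) as [_ [l Hl]].
    exists l. apply is_lim_seq_spec. apply is_lim_seq_spec in Hl. intros eps.
    destruct (Hl eps) as [N HN]. exists (Nat.max N (S i)). intros n Hn.
    destruct (Htail (S i) (n - S i)%nat) as [th [H1 H2]].
    replace (n - S i + S i)%nat with n in H2 by lia. rewrite H2.
    apply (HN (th n)). generalize (strict_incr_ge th H1 n). lia.
Qed.

Definition rational (n : nat) : R :=
  let (a, m) := Cantor.of_nat n in let (b, d) := Cantor.of_nat m in (INR a - INR b) / INR (S d).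

Definition rational_point (n : nat) : C :=
  let (a, b) := Cantor.of_nat n in (rational a, rational b).

Lemma rational_dense (x eps : R) : 0 < eps -> exists n, Rabs (rational n - x) < eps.
Proof.
  intros He. destruct (archimed_cor1 eps He) as [d [Hd Hd0]].
  assert (Hp : 0 < INR d) by (apply lt_0_INR; lia).
  assert (Hab : exists a b, INR a - INR b = IZR (up (x * INR d))).
  { destruct (Z.le_gt_cases 0 (up (x * INR d))) as [L | L].
    - exists (Z.to_nat (up (x * INR d))), 0%nat. rewrite (INR_IZR_INZ (Z.to_nat _)), Z2Nat.id by exact L. simpl. ring.
    - exists 0%nat, (Z.to_nat (- up (x * INR d))). rewrite (INR_IZR_INZ (Z.to_nat _)), Z2Nat.id by lia.
      rewrite opp_IZR. simpl. ring. }
  destruct Hab as [a [b Hab]].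
  exists (Cantor.to_nat (a, Cantor.to_nat (b, (d - 1)%nat))). unfold rational.
  rewrite !Cantor.cancel_of_to, Hab. replace (S (d - 1)) with d by lia.
  destruct (archimed (x * INR d)) as [A1 A2]. set (z := IZR (up (x * INR d))) in *.
  replace (z / INR d - x) with ((z - x * INR d) / INR d) by (field; lra).
  rewrite Rabs_pos_eq.
  - eapply Rle_lt_trans; [| exact Hd]. unfold Rdiv. rewrite <- (Rmult_1_l (/ INR d)) at 2.
    apply Rmult_le_compat_r; [apply Rlt_le, Rinv_0_lt_compat, Hp | lra].
  - apply Rmult_le_pos; [lra | apply Rlt_le, Rinv_0_lt_compat, Hp].
Qed.

Lemma rational_point_dense (z : C) (eps : R) : 0 < eps -> exists n, Cmod (rational_point n - z) < eps.
Proof.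
  intros He. destruct (rational_dense (fst z) (eps / 2)) as [a Ha]; [lra |].
  destruct (rational_dense (snd z) (eps / 2)) as [b Hb]; [lra |].
  exists (Cantor.to_nat (a, b)). unfold rational_point. rewrite Cantor.cancel_of_to.
  eapply Rle_lt_trans; [apply Cmod_le_abs |]. simpl. unfold Rminus in Ha, Hb. lra.
Qed.

(** Countably many real coordinates [u j], rather than maps into a metric space,
    let the theorem serve both the plane and the sphere. Bounds and
    equicontinuity concern only large [n], because the rescaled functions are
    defined on growing discs. *)
Theorem Arzela_Ascoli (D : C -> Prop) (u : nat -> nat -> C -> R) :
  open D ->
  (forall j z, D z -> exists B N, forall n, (N <= n)%nat -> Rabs (u j n z) <= B) ->
  (forall j z eps, D z -> 0 < eps -> exists r N, 0 < r /\ forall n, (N <= n)%nat ->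
     forall w, Cmod (w - z) < r -> Rabs (u j n w - u j n z) < eps) ->
  exists phi, strict_incr phi /\ exists v : nat -> C -> R,
    forall j z eps, D z -> 0 < eps -> exists r N, 0 < r /\ forall n, (N <= n)%nat ->
     forall w, Cmod (w - z) < r -> Rabs (u j (phi n) w - v j w) < eps.
Proof.
  intros Ho HB HE.
  set (a := fun i n => let (j, m) := Cantor.of_nat i in
     if excluded_middle_informative (D (rational_point m)) then u j n (rational_point m) else 0).
  destruct (diagonal_subsequence a) as [phi [Hphi Hconv]].
  { intros i. unfold a. destruct (Cantor.of_nat i) as [j m].
    destruct (excluded_middle_informative (D (rational_point m))) as [Hm | Hm].
    - apply HB, Hm.
    - exists 0, 0%nat. intros. rewrite Rabs_R0. lra. }
  exists phi. split; [exact Hphi |].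
  assert (Hge := strict_incr_ge phi Hphi).
  assert (Hcau : forall j z eps, D z -> 0 < eps -> exists r N, 0 < r /\ forall n m, (N <= n)%nat -> (N <= m)%nat ->
     forall w, Cmod (w - z) < r -> Rabs (u j (phi n) w - u j (phi m) w) < eps).
  { intros j z eps Hz He. destruct (HE j z (eps / 6) Hz ltac:(lra)) as [r [N [Hr H]]].
    destruct (open_sub_disc D z Ho Hz) as [r1 [Hr1 HD]].
    destruct (rational_point_dense z (Rmin r r1)) as [m Hm]; [apply Rmin_glb_lt; auto |].
    set (p := rational_point m) in *.
    destruct (Rmin_lt _ _ _ Hm) as [Hp1 Hp2].
    destruct (Hconv (Cantor.to_nat (j, m))) as [l Hl]. unfold a in Hl. rewrite Cantor.cancel_of_to in Hl.
    fold p in Hl. destruct (excluded_middle_informative (D p)) as [_ | Hn]; [| exfalso; apply Hn, HD, Hp2].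
    apply is_lim_seq_spec in Hl. assert (He6 : 0 < eps / 6) by lra.
    destruct (Hl (mkposreal _ He6)) as [N2 H2]. simpl in H2.
    exists r, (Nat.max N N2). split; [exact Hr |].
    assert (K : forall n, (Nat.max N N2 <= n)%nat -> forall w, Cmod (w - z) < r -> Rabs (u j (phi n) w - l) < eps / 2).
    { intros n Hn w Hw. assert (L := Hge n).
      assert (A := H (phi n) ltac:(lia) w Hw). assert (B := H (phi n) ltac:(lia) p Hp1).
      assert (E := H2 n ltac:(lia)).
      apply Rabs_lt_between in A. apply Rabs_lt_between in B. apply Rabs_lt_between in E.
      apply Rabs_lt_between. lra. }
    intros n n' Hn Hn' w Hw. assert (A := K n Hn w Hw). assert (B := K n' Hn' w Hw).
    apply Rabs_lt_between in A. apply Rabs_lt_between in B. apply Rabs_lt_between. lra. }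
  exists (fun j w => real (Lim_seq (fun n => u j (phi n) w))).
  assert (Hlim : forall j w, D w -> is_lim_seq (fun n => u j (phi n) w) (real (Lim_seq (fun n => u j (phi n) w)))).
  { intros j w Hw. apply Lim_seq_correct', ex_lim_seq_cauchy_corr. intros eps.
    destruct (Hcau j w eps Hw (cond_pos eps)) as [r [N [Hr H]]]. exists N. intros n m Hn Hm.
    apply H; auto. rewrite Cmod_self. exact Hr. }
  intros j z eps Hz He. destruct (Hcau j z (eps / 2) Hz ltac:(lra)) as [r [N [Hr H]]].
  destruct (open_sub_disc D z Ho Hz) as [r1 [Hr1 HD]].
  exists (Rmin r r1), N. split; [apply Rmin_glb_lt; auto |]. intros n Hn w Hw.
  destruct (Rmin_lt _ _ _ Hw) as [Hw1 Hw2].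
  assert (L := Hlim j w (HD w Hw2)). apply is_lim_seq_spec in L.
  assert (He4 : 0 < eps / 4) by lra.
  destruct (L (mkposreal _ He4)) as [M HM]. simpl in HM.
  specialize (HM (Nat.max N M) ltac:(lia)). assert (A := H n (Nat.max N M) Hn ltac:(lia) w Hw1).
  apply Rabs_lt_between in A. apply Rabs_lt_between in HM. apply Rabs_lt_between. lra.
Qed.

(** * Rescaling *)

(** Total degree of the monomial, and its weight: the number of differentiations,
    hence the power of [rho] that the substitution [z + rho w] produces. *)
Fixpoint degree (q : nat -> nat) (n : nat) : nat :=
  match n with O => 0 | S m => degree q m + q m end.

Fixpoint weight (q : nat -> nat) (n : nat) : nat :=
  match n with O => 0 | S m => weight q m + m * q m end.

Lemma weight_lt (q : nat -> nat) (k : nat) :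
  (1 <= k)%nat -> (1 <= q 0%nat)%nat -> (weight q (S k) < k * degree q (S k))%nat.
Proof.
  intros Hk H0.
  assert (G : forall n, (q 0%nat <= degree q (S n) /\ weight q (S n) + n * q 0%nat <= n * degree q (S n))%nat).
  { induction n as [| n [IH1 IH2]]; [simpl; lia |].
    change (degree q (S (S n))) with (degree q (S n) + q (S n))%nat.
    change (weight q (S (S n))) with (weight q (S n) + S n * q (S n))%nat.
    split; [lia | nia]. }
  destruct (G k) as [_ G2]. nia.
Qed.

Lemma weight_ge_1 (q : nat -> nat) (k : nat) :
  (1 <= k)%nat -> (1 <= q k)%nat -> (1 <= weight q (S k))%nat.
Proof. intros Hk H0. simpl. nia. Qed.

Lemma degree_ge_1 (q : nat -> nat) (k : nat) : (1 <= q k)%nat -> (1 <= degree q (S k))%nat.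
Proof. intros H0. simpl. lia. Qed.

Definition rescale (c : R) (rho : R) (z : C) (f : C -> C) : C -> C :=
  fun w => (c * f (z + rho * w))%C.

Lemma cdiff_rescale (c rho : R) (z : C) (f : C -> C) (w l : C) :
  cdiff f (z + rho * w)%C l -> cdiff (rescale c rho z f) w (c * (rho * l))%C.
Proof.
  intros H. unfold rescale. eapply cdiff_eq; cycle 1.
  - apply cdiff_mult; [apply cdiff_const |]. apply (cdiff_comp f (fun w => z + rho * w)%C); [exact H |].
    apply cdiff_plus; [apply cdiff_const |]. apply cdiff_mult; [apply cdiff_const | apply cdiff_id].
  - cbv beta. ring.
Qed.

Lemma cont_affine (rho : R) (z w : C) : cont_at (fun v => z + rho * v)%C w.
Proof.
  cont.
Qed.

Lemma derive_n_rescale (U : C -> Prop) (c rho : R) (z : C) (f : C -> C) (j : nat) (w : C) :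
  open U -> Hol U f -> U (z + rho * w)%C ->
  C_derive_n (rescale c rho z f) j w = (c * rho ^ j * C_derive_n f j (z + rho * w))%C.
Proof.
  intros Ho Hf. revert w. induction j as [| j IH]; intros w Hw.
  - simpl. unfold rescale. ring.
  - simpl C_derive_n. change (C_derive (C_derive_n (rescale c rho z f) j) w
      = (c * rho ^ S j * C_derive (C_derive_n f j) (z + rho * w))%C).
    apply cdiff_unique.
    assert (Hj : Hol U (C_derive_n f j)) by (apply Hol_C_derive_n; auto).
    apply cdiff_ext_loc with (fun v => RtoC (rho ^ j) * rescale c rho z (C_derive_n f j) v)%C.
    + destruct (proj1 (open_C_iff U) Ho _ Hw) as [d [Hd HU]].
      destruct (proj1 (cont_at_C _ _) (cont_affine rho z w) d Hd) as [d' [Hd' H]].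
      apply locally_C_iff. exists d'. split; [exact Hd' |]. intros v Hv.
      rewrite IH by (apply HU, H, Hv). unfold rescale. rewrite RtoC_pow. ring.
    + eapply cdiff_eq; cycle 1.
      * apply cdiff_mult; [apply cdiff_const |]. apply cdiff_rescale, (Hol_derive U _ _ Hj Hw).
      * rewrite RtoC_pow. simpl Cpow. cbv beta. ring.
Qed.

Lemma C_prod_ext (a b : nat -> C) (n : nat) : (forall i, a i = b i) -> C_prod a n = C_prod b n.
Proof. intros H. induction n as [| n IH]; simpl; [reflexivity | rewrite IH, H; reflexivity]. Qed.

Lemma Cpow_mult_l (a b : C) (n : nat) : ((a * b) ^ n = a ^ n * b ^ n)%C.
Proof. induction n as [| n IH]; simpl; [ring | rewrite IH; ring]. Qed.

Lemma Cpow_add (a : C) (n m : nat) : (a ^ (n + m) = a ^ n * a ^ m)%C.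
Proof. induction n as [| n IH]; simpl; [ring | rewrite IH; ring]. Qed.

Lemma Cpow_mul (a : C) (n m : nat) : ((a ^ n) ^ m = a ^ (n * m))%C.
Proof.
  induction m as [| m IH]; simpl; [rewrite Nat.mul_0_r; reflexivity |].
  rewrite IH, <- Cpow_add. f_equal. lia.
Qed.

Lemma C_prod_scale (q : nat -> nat) (c rho : C) (a : nat -> C) (n : nat) :
  C_prod (fun i => ((c * rho ^ i * a i) ^ q i)%C) n
  = (c ^ degree q n * rho ^ weight q n * C_prod (fun i => (a i ^ q i)%C) n)%C.
Proof.
  induction n as [| n IH]; simpl; [ring |].
  rewrite IH, !Cpow_add, !Cpow_mult_l, Cpow_mul. ring.
Qed.

Lemma diff_monomial_rescale (U : C -> Prop) (k : nat) (q : nat -> nat) (c rho : R) (z : C) (f : C -> C) (w : C) :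
  open U -> Hol U f -> U (z + rho * w)%C ->
  diff_monomial k q (rescale c rho z f) w
  = (c ^ degree q (S k) * rho ^ weight q (S k) * diff_monomial k q f (z + rho * w))%C.
Proof.
  intros Ho Hf Hw. unfold diff_monomial. rewrite <- C_prod_scale.
  apply C_prod_ext. intros i. f_equal. apply (derive_n_rescale U); auto.
Qed.

(** * Zeros of multiplicity at least [k] *)

(** A zero of infinite order makes [f] vanish on the disc; the hypothesis on
    multiplicities speaks about the other zeros. *)
Lemma zero_factor (D : C -> Prop) (f : C -> C) (k : nat) (p : C) (r : R) :
  Hol D f -> zeros_of_multiplicity_ge D f k -> D p -> f p = 0%C -> 0 < r ->
  (forall w, Disc p r w -> D w) ->
  (forall w, Disc p r w -> f w = 0%C) \/
  (exists m g, (k <= m)%nat /\ order_ge (Disc p r) f p m g /\ g p <> 0%C).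
Proof.
  intros Hf Hm Hp H0 Hr HD.
  assert (Hpr : Disc p r p) by (unfold Disc; rewrite Cmod_self; exact Hr).
  destruct (zero_dichotomy (Disc p r) f p) as [H | [m [g [[Hg E] Hg0]]]]; auto.
  { apply open_disc. } { apply convex_disc. } { apply (Hol_subset D); auto. }
  - left. apply infinite_order_zero, H.
  - right. exists m, g. split; [| split; [split; auto | auto]].
    apply (Hm p Hp H0). exists g. split; [| split; [exact Hg0 |]].
    + apply filter_imp with (Disc p r); [| apply open_locally; auto; apply open_disc].
      intros z Hz. destruct (Hg z Hz) as [l Hl]. exists l. apply cdiff_is_derive, Hl.
    + apply filter_imp with (Disc p r); [exact E | apply open_locally; auto; apply open_disc].
Qed.

Lemma zero_derivs (D : C -> Prop) (f : C -> C) (k : nat) (p : C) :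
  open D -> Hol D f -> zeros_of_multiplicity_ge D f k -> D p -> f p = 0%C ->
  forall j, (j < k)%nat -> C_derive_n f j p = 0%C.
Proof.
  intros Ho Hf Hm Hp H0 j Hj. destruct (open_sub_disc D p Ho Hp) as [r [Hr HD]].
  assert (Hpr : Disc p r p) by (unfold Disc; rewrite Cmod_self; exact Hr).
  assert (HfD : Hol (Disc p r) f) by (apply (Hol_subset D); auto).
  assert (Hor : exists m g, (k <= m)%nat /\ order_ge (Disc p r) f p m g).
  { destruct (zero_factor D f k p r) as [H | [m [g [Hkm [Hg _]]]]]; auto.
    - exists k, (fun _ => 0%C). split; [lia |]. split; [apply Hol_const |].
      intros z Hz. rewrite H by exact Hz. ring.
    - exists m, g. auto. }
  destruct Hor as [m [g [Hkm Hg]]].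
  apply (order_ge_derivs_zero (Disc p r) f g p m); auto; [apply open_disc | lia].
Qed.

(** * Bad discs *)

(** With [rho = s^gam] and [g w = f (z + rho w) / s^Gam], this says that [|g|] takes
    values below 1 and values above 2 on the unit disc. When [gam] and [Gam] are
    the degree and the weight of the monomial, this is the substitution that
    leaves the monomial unchanged; with [s] as scale instead of [rho], all
    exponents are integers. *)
Definition bad (gam Gam : nat) (f : C -> C) (z : C) (s : R) : Prop :=
  exists x y, Cmod (x - z) < s ^ gam /\ Cmod (y - z) < s ^ gam /\
    Cmod (f x) < s ^ Gam /\ 2 * s ^ Gam < Cmod (f y).

Lemma pow_le_1 (s : R) (n m : nat) : 0 <= s <= 1 -> (n <= m)%nat -> s ^ m <= s ^ n.
Proof.
  intros Hs Hnm. replace m with (n + (m - n))%nat by lia. rewrite pow_add.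
  rewrite <- (Rmult_1_r (s ^ n)) at 2. apply Rmult_le_compat_l; [apply pow_le; lra |].
  rewrite <- (pow1 (m - n)). apply pow_incr. lra.
Qed.

(** A form of Bernoulli's inequality: [(1 + t)^j (1 - j t) <= 1]. *)
Lemma pow_near_1 (m : nat) (t : R) : 0 <= t -> 3 * INR m * t <= 1 -> (1 + t) ^ m <= 3 / 2.
Proof.
  intros Ht Hm.
  assert (G : forall j, (1 + t) ^ j * (1 - INR j * t) <= 1).
  { induction j as [| j IH]; [simpl; lra |]. rewrite S_INR. simpl.
    assert (0 < (1 + t) ^ j) by (apply pow_lt; lra).
    assert (0 <= (INR j + 1) * (t * t)) by (apply Rmult_le_pos; [generalize (pos_INR j); lra | nra]).
    replace ((1 + t) * (1 + t) ^ j * (1 - (INR j + 1) * t))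
      with ((1 + t) ^ j * (1 - INR j * t) - (1 + t) ^ j * ((INR j + 1) * (t * t))) by ring.
    assert (0 <= (1 + t) ^ j * ((INR j + 1) * (t * t))) by (apply Rmult_le_pos; lra). lra. }
  specialize (G m). assert (0 < (1 + t) ^ m) by (apply pow_lt; lra). nra.
Qed.

(** Near a zero of order [m], [|f|] behaves like [A |z - p|^m], so it can double
    across a disc of radius [s^gam] only when [|z - p|] is comparable to [s^gam].
    There [|f|] is of the order of [s^(gam m)], negligible against [s^Gam] because
    [Gam < gam k <= gam m]: this is where the multiplicity of the zeros enters. *)
Lemma small_not_bad_local (gam Gam k : nat) (D : C -> Prop) (f : C -> C) (p : C) :
  (1 <= gam)%nat -> (1 <= Gam)%nat -> (1 <= k)%nat -> (Gam < k * gam)%nat ->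
  open D -> Hol D f -> zeros_of_multiplicity_ge D f k -> D p ->
  exists d, 0 < d /\ forall z, Cmod (z - p) < d -> forall s, 0 < s < d -> ~ bad gam Gam f z s.
Proof.
  intros Hg HG Hk HGk Ho Hf Hm Hp.
  assert (Near : forall d z x s, 0 < s < d / 2 -> s <= 1 -> Cmod (z - p) < d / 2 -> Cmod (x - z) < s ^ gam -> Cmod (x - p) < d).
  { intros d z x s Hs Hs1 Hz Hx. assert (s ^ gam <= s ^ 1) by (apply pow_le_1; [lra | lia]). simpl in *.
    generalize (Cmod_tri_sub x z p). lra. }
  destruct (classic (f p = 0%C)) as [H0 | H0].
  - destruct (open_sub_disc D p Ho Hp) as [r [Hr HD]].
    destruct (zero_factor D f k p r) as [H | [m [g [Hkm [[Hgh E] Hg0]]]]]; auto.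
    + exists (Rmin (r / 2) 1). split; [apply Rmin_glb_lt; lra |]. intros z Hz s Hs [x [y [_ [Hy [_ Hb]]]]].
      assert (R1 := Rmin_l (r / 2) 1). assert (R2 := Rmin_r (r / 2) 1).
      rewrite H, Cmod_0 in Hb; [| apply (Near r z y s); lra].
      assert (0 < s ^ Gam) by (apply pow_lt; lra). lra.
    + assert (Hpr : Disc p r p) by (unfold Disc; rewrite Cmod_self; exact Hr).
      assert (HA : 0 < Cmod (g p)) by (apply Cmod_gt_0, Hg0).
      set (A := Cmod (g p)) in *.
      destruct (proj1 (cont_at_C g p) (Hol_cont _ _ _ Hgh Hpr) (A / 10)) as [d1 [Hd1 Hgc]]; [lra |].
      set (d := Rmin r d1). assert (Hd : 0 < d) by (apply Rmin_glb_lt; auto).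
      assert (HgA : forall w, Cmod (w - p) < d -> 9 / 10 * A <= Cmod (g w) <= 11 / 10 * A).
      { intros w Hw. specialize (Hgc w (Rlt_le_trans _ _ _ Hw (Rmin_r _ _))).
        assert (T1 := Cmod_rev (g w) (g p)). assert (T2 := Cmod_rev (g p) (g w)).
        rewrite Cmod_sym in T2. fold A in T1, T2. lra. }
      assert (HfE : forall w, Cmod (w - p) < d -> Cmod (f w) = Cmod (w - p) ^ m * Cmod (g w)).
      { intros w Hw. rewrite (E w); [| apply (Rlt_le_trans _ _ _ Hw (Rmin_l _ _))].
        rewrite Cmod_mult, Cmod_pow. reflexivity. }
      assert (Hm1 : 1 <= INR m) by (apply (le_INR 1); lia).
      set (B := 6 * INR m + 2). set (K := 11 / 10 * A * B ^ m).
      assert (HB : 0 < B) by (unfold B; lra).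
      assert (HK : 0 < K) by (unfold K; apply Rmult_lt_0_compat; [lra | apply pow_lt, HB]).
      exists (Rmin (d / 2) (Rmin 1 (2 / K))).
      assert (H2K : 0 < 2 / K) by (apply Rdiv_lt_0_compat; lra).
      split; [repeat apply Rmin_glb_lt; lra |].
      intros z Hz s Hs [x [y [Hx [Hy [Hbx Hby]]]]].
      assert (R1 := Rmin_l (d / 2) (Rmin 1 (2 / K))). assert (R2 := Rmin_r (d / 2) (Rmin 1 (2 / K))).
      assert (R3 := Rmin_l 1 (2 / K)). assert (R4 := Rmin_r 1 (2 / K)).
      assert (Hxd : Cmod (x - p) < d) by (apply (Near d z x s); lra).
      assert (Hyd : Cmod (y - p) < d) by (apply (Near d z y s); lra).
      rewrite HfE in Hbx, Hby by assumption.
      assert (Gx := HgA x Hxd). assert (Gy := HgA y Hyd).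
      set (e := Cmod (x - p)) in *. set (e' := Cmod (y - p)) in *. set (rho := s ^ gam) in *.
      assert (He : 0 <= e) by apply Cmod_ge_0. assert (He' : 0 <= e') by apply Cmod_ge_0.
      assert (Hrho : 0 < rho) by (apply pow_lt; lra).
      assert (Hee : e' <= e + 2 * rho).
      { unfold e, e'. assert (T1 := Cmod_tri_sub y z p). assert (T2 := Cmod_tri_sub z x p).
        rewrite (Cmod_sym z x) in T2. lra. }
      assert (Hsm : 0 < s ^ Gam) by (apply pow_lt; lra).
      destruct (Rle_dec e (6 * INR m * rho)) as [Hs1 | Hs1].
      * (* close to the zero: [|f y| <= K s^(Gam + 1)] *)
        assert (He'2 : e' ^ m <= (B * rho) ^ m) by (apply pow_incr; unfold B; lra).
        rewrite Rpow_mult_distr in He'2.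
        assert (Hr2 : rho ^ m <= s ^ S Gam).
        { unfold rho. rewrite <- pow_mult. apply pow_le_1; [lra |].
          assert (k * gam <= gam * m)%nat by (rewrite Nat.mul_comm; apply Nat.mul_le_mono_l; lia). lia. }
        assert (U1 : 2 * s ^ Gam < K * s ^ S Gam).
        { eapply Rlt_le_trans; [exact Hby |].
          apply Rle_trans with (B ^ m * rho ^ m * (11 / 10 * A)).
          - apply Rmult_le_compat; auto; [apply pow_le, He' | lra | lra].
          - replace (B ^ m * rho ^ m * (11 / 10 * A)) with (K * rho ^ m) by (unfold K; ring).
            apply Rmult_le_compat_l; lra. }
        simpl in U1. assert (K * s <= 2).
        { replace 2 with (K * (2 / K)) by (field; lra). apply Rmult_le_compat_l; lra. }
        nra.
      * (* far from the zero: [|f y| <= (3 / 2) (11 / 9) |f x|], and the factor is less than 2 *)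
        apply Rnot_le_lt in Hs1.
        assert (He0 : 0 < e).
        { eapply Rle_lt_trans; [| exact Hs1]. apply Rmult_le_pos; lra. }
        set (t := 2 * rho / e).
        assert (Et : e * t = 2 * rho) by (unfold t; field; lra).
        assert (Ht : 0 <= t) by (unfold t; apply Rmult_le_pos; [lra | apply Rlt_le, Rinv_0_lt_compat, He0]).
        assert (Ht3 : 3 * INR m * t <= 1).
        { apply Rmult_le_reg_r with e; [exact He0 |].
          replace (3 * INR m * t * e) with (3 * INR m * (e * t)) by ring. rewrite Et. lra. }
        assert (P := pow_near_1 m t Ht Ht3).
        assert (Hpw : e' ^ m <= e ^ m * (3 / 2)).
        { apply Rle_trans with ((e * (1 + t)) ^ m); [apply pow_incr; nra |].
          rewrite Rpow_mult_distr. apply Rmult_le_compat_l; [apply pow_le, He | exact P]. }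
        assert (Hem : 0 < e ^ m) by (apply pow_lt, He0).
        assert (U1 : e' ^ m * Cmod (g y) <= e ^ m * (3 / 2) * (11 / 10 * A)).
        { apply Rmult_le_compat; auto; [apply pow_le, He' | lra | lra]. }
        assert (U2 : e ^ m * (9 / 10 * A) <= e ^ m * Cmod (g x)) by (apply Rmult_le_compat_l; lra).
        assert (0 < e ^ m * A) by (apply Rmult_lt_0_compat; auto). lra.
  - assert (HA : 0 < Cmod (f p)) by (apply Cmod_gt_0, H0).
    destruct (proj1 (cont_at_C f p) (Hol_cont D f p Hf Hp) (Cmod (f p) / 2)) as [d [Hd Hfd]]; [lra |].
    exists (Rmin (d / 2) (Rmin 1 (Cmod (f p) / 2))). split; [repeat apply Rmin_glb_lt; lra |].
    intros z Hz s Hs [x [y [Hx [_ [Hb _]]]]].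
    assert (R1 := Rmin_l (d / 2) (Rmin 1 (Cmod (f p) / 2))). assert (R2 := Rmin_r (d / 2) (Rmin 1 (Cmod (f p) / 2))).
    assert (R3 := Rmin_l 1 (Cmod (f p) / 2)). assert (R4 := Rmin_r 1 (Cmod (f p) / 2)).
    assert (Hxd : Cmod (x - p) < d) by (apply (Near d z x s); lra).
    specialize (Hfd x Hxd). assert (T := Cmod_rev (f p) (f x)). rewrite Cmod_sym in T.
    assert (s ^ Gam <= s ^ 1) by (apply pow_le_1; [lra | lia]). simpl in *. lra.
Qed.

Lemma small_not_bad (gam Gam k : nat) (D : C -> Prop) (f : C -> C) (c : C) (r : R) :
  (1 <= gam)%nat -> (1 <= Gam)%nat -> (1 <= k)%nat -> (Gam < k * gam)%nat ->
  open D -> Hol D f -> zeros_of_multiplicity_ge D f k -> (forall z, Cmod (z - c) <= 2 * r -> D z) ->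
  exists d, 0 < d /\ forall z, Cmod (z - c) <= r -> forall s, 0 < s < d -> ~ bad gam Gam f z s.
Proof.
  intros Hg HG Hk HGk Ho Hf Hm HD. apply (disc_uniform c r (fun s z => ~ bad gam Gam f z s)).
  intros z Hz. apply (small_not_bad_local gam Gam k D); auto.
Qed.

(** The relative size of a bad disc has a positive lower bound, so passing to bad
    discs of less than half the relative size must stop. This replaces the
    extremal choice in Zalcman's lemma. *)
Lemma nearly_minimal_bad (gam Gam : nat) (f : C -> C) (z0 : C) (r c : R) :
  0 < r -> 0 < c ->
  (exists d, 0 < d /\ forall z, Cmod (z - z0) <= r -> forall s, 0 < s < d -> ~ bad gam Gam f z s) ->
  (exists z s, Disc z0 r z /\ 0 < s /\ s < c * (r - Cmod (z - z0)) /\ bad gam Gam f z s) ->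
  exists z s, Disc z0 r z /\ 0 < s /\ s < c * (r - Cmod (z - z0)) /\ bad gam Gam f z s /\
    forall z' s', Disc z0 r z' -> 0 < s' ->
      2 * s' * (r - Cmod (z - z0)) < s * (r - Cmod (z' - z0)) -> ~ bad gam Gam f z' s'.
Proof.
  intros Hr Hc [d [Hd Hsmall]] H0.
  set (E := fun j => exists z s, Disc z0 r z /\ 0 < s /\ s * 2 ^ j < c * (r - Cmod (z - z0)) /\ bad gam Gam f z s).
  assert (Hj : exists j, E j /\ ~ E (S j)).
  { apply NNPP. intros Hn.
    assert (All : forall j, E j).
    { induction j as [| j IH].
      - destruct H0 as [z [s [A [B [D G]]]]]. exists z, s. simpl. rewrite Rmult_1_r. auto.
      - apply NNPP. intros Hj. apply Hn. eauto. }
    destruct (Pow_x_infinity 2 ltac:(rewrite Rabs_pos_eq; lra) (c * r / d)) as [N HN].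
    specialize (HN N (le_n _)). rewrite Rabs_pos_eq in HN by (apply pow_le; lra).
    destruct (All N) as [z [s [A [B [G1 G2]]]]]. unfold Disc in A.
    apply (Hsmall z ltac:(lra) s); [split; [exact B |] | exact G2].
    apply Rnot_le_lt. intros Hs.
    assert (c * r <= d * 2 ^ N).
    { replace (c * r) with (d * (c * r / d)) by (field; lra). apply Rmult_le_compat_l; lra. }
    assert (0 < 2 ^ N) by (apply pow_lt; lra).
    assert (d * 2 ^ N <= s * 2 ^ N) by (apply Rmult_le_compat_r; lra).
    assert (c * (r - Cmod (z - z0)) <= c * r) by (apply Rmult_le_compat_l; generalize (Cmod_ge_0 (z - z0)); lra).
    lra. }
  destruct Hj as [j [[z [s [Hz [Hs [Hlt Hb]]]]] Hn]].
  assert (P1 : 1 <= 2 ^ j) by (apply pow_R1_Rle; lra).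
  exists z, s. split; [exact Hz |]. split; [exact Hs |]. split; [nra |]. split; [exact Hb |].
  intros z' s' Hz' Hs' H Hb'. apply Hn. exists z', s'. split; [exact Hz' |]. split; [exact Hs' |]. split; [| exact Hb'].
  unfold Disc in *. simpl.
  apply Rmult_lt_reg_r with (r - Cmod (z - z0)); [lra |].
  apply Rlt_le_trans with (s * 2 ^ j * (r - Cmod (z' - z0))).
  - replace (s' * (2 * 2 ^ j) * (r - Cmod (z - z0))) with (2 ^ j * (2 * s' * (r - Cmod (z - z0)))) by ring.
    replace (s * 2 ^ j * (r - Cmod (z' - z0))) with (2 ^ j * (s * (r - Cmod (z' - z0)))) by ring.
    apply Rmult_lt_compat_l; lra.
  - replace (c * (r - Cmod (z' - z0)) * (r - Cmod (z - z0))) with (c * (r - Cmod (z - z0)) * (r - Cmod (z' - z0))) by ring.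
    apply Rmult_le_compat_r; lra.
Qed.

(** The negation of badness after rescaling: on each small disc [|g|] is bounded
    above by [2 t] or bounded below by [t]. *)
Definition tame (g : C -> C) (d t L : R) : Prop :=
  forall w, Cmod w < L -> forall x y, Disc w d x -> Disc w d y -> Cmod (g x) < t -> Cmod (g y) <= 2 * t.

(** A disc with a third of the scale [s], centred at distance at most [(n + 1) / 4]
    in the new variable, has less than half the relative size of the chosen disc,
    hence is not bad. The chosen disc becomes the unit disc. *)
Lemma rescaled_functions (D : C -> Prop) (k : nat) (q : nat -> nat) (f : C -> C) (z0 z : C) (r s : R) (n : nat) :
  open D -> Hol D f -> zeros_of_multiplicity_ge D f k ->
  (forall w, D w -> diff_monomial k q f w <> 1%C) ->
  (1 <= degree q (S k))%nat ->
  0 < r <= 1 -> (forall w, Disc z0 (3 * r) w -> D w) ->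
  Disc z0 r z -> 0 < s -> s < / INR (S n) * (r - Cmod (z - z0)) ->
  bad (degree q (S k)) (weight q (S k)) f z s ->
  (forall z' s', Disc z0 r z' -> 0 < s' ->
      2 * s' * (r - Cmod (z - z0)) < s * (r - Cmod (z' - z0)) ->
      ~ bad (degree q (S k)) (weight q (S k)) f z' s') ->
  exists g : C -> C,
    Hol (Disc 0 (INR (S n) / 4 + 1)) g /\
    (forall a, Cmod a < INR (S n) / 4 -> g a = 0%C -> forall j, (j < k)%nat -> C_derive_n g j a = 0%C) /\
    (forall w, Cmod w < INR (S n) / 4 -> diff_monomial k q g w <> 1%C) /\
    tame g ((/ 3) ^ degree q (S k)) ((/ 3) ^ weight q (S k)) (INR (S n) / 4) /\
    (exists x y, Cmod x < 1 /\ Cmod y < 1 /\ Cmod (g x) < 1 /\ 2 < Cmod (g y)).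
Proof.
  intros Ho Hf Hm Hne Hdeg Hr HD Hz Hs Hsn Hb Hmin.
  set (gam := degree q (S k)) in *. set (Gam := weight q (S k)) in *.
  set (rho := s ^ gam). set (c := / s ^ Gam).
  assert (Hrho : 0 < rho) by (apply pow_lt, Hs).
  assert (HsG : 0 < s ^ Gam) by (apply pow_lt, Hs).
  assert (Hc : 0 < c) by (apply Rinv_0_lt_compat, HsG).
  assert (HN : 1 <= INR (S n)) by (apply (le_INR 1); lia).
  set (N := INR (S n)) in *. set (sg := r - Cmod (z - z0)) in *.
  unfold Disc in Hz. assert (Hz0 := Cmod_ge_0 (z - z0)).
  assert (Hsg : 0 < sg <= r) by (unfold sg; lra).
  assert (HsN : s * N < sg).
  { replace sg with (/ N * sg * N) by (field; lra). apply Rmult_lt_compat_r; lra. }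
  assert (Hs1 : s <= 1) by nra.
  assert (Hrs : rho <= s).
  { unfold rho. rewrite <- (pow_1 s) at 2. apply pow_le_1; [lra | exact Hdeg]. }
  assert (Hmove : forall w a, Cmod w < a -> Cmod (z + rho * w - z0) < Cmod (z - z0) + rho * a).
  { intros w a Hw. replace (z + rho * w - z0)%C with ((z - z0) + rho * w)%C by ring.
    eapply Rle_lt_trans; [apply Cmod_triangle |]. rewrite Cmod_mult, Cmod_RtoC_pos by lra.
    apply Rplus_lt_compat_l, Rmult_lt_compat_l; auto. }
  assert (HinD : forall w, Disc 0 (N / 4 + 1) w -> D (z + rho * w)%C).
  { intros w Hw. apply HD. unfold Disc. assert (M := Hmove w _ (proj1 (Disc_0 _ _) Hw)).
    assert (rho * (N / 4 + 1) <= s * (N / 4 + 1)) by (apply Rmult_le_compat_r; lra). nra. }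
  assert (HinD' : forall w, Cmod w < N / 4 -> D (z + rho * w)%C).
  { intros w Hw. apply HinD, Disc_0. lra. }
  exists (rescale c rho z f).
  assert (Hmodg : forall w, Cmod (rescale c rho z f w) * s ^ Gam = Cmod (f (z + rho * w)%C)).
  { intros w. unfold rescale. rewrite Cmod_mult, Cmod_RtoC_pos by lra. unfold c. field. lra. }
  split; [| split; [| split; [| split]]].
  - intros w Hw. destruct (Hf _ (HinD w Hw)) as [l Hl]. eexists. apply cdiff_rescale, Hl.
  - intros a Ha H0 j Hj. rewrite (derive_n_rescale D) by auto.
    assert (Hfa : f (z + rho * a)%C = 0%C).
    { apply Cmod_eq_0. rewrite <- Hmodg, H0, Cmod_0. ring. }
    rewrite (zero_derivs D f k) by auto.
    ring.
  - intros w Hw. rewrite (diff_monomial_rescale D) by auto.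
    fold gam Gam.
    replace (c ^ gam * rho ^ Gam)%C with (RtoC 1).
    + rewrite Cmult_1_l. apply Hne, HinD', Hw.
    + rewrite <- !RtoC_pow, <- RtoC_mult. f_equal. unfold c, rho. rewrite pow_inv, <- !pow_mult.
      rewrite (Nat.mul_comm Gam gam). field. apply pow_nonzero. lra.
  - intros w Hw x y Hx Hy Hgx. apply Rnot_lt_le. intros Hgy.
    assert (Hz' : Cmod (z + rho * w - z0) < Cmod (z - z0) + sg / 4).
    { eapply Rlt_le_trans; [apply (Hmove w _ Hw) |]. 
      assert (rho * (N / 4) <= s * (N / 4)) by (apply Rmult_le_compat_r; lra). lra. }
    apply (Hmin (z + rho * w)%C (s / 3)).
    + unfold Disc, sg in *. lra.
    + lra.
    + assert (3 / 4 * sg < r - Cmod (z + rho * w - z0)) by (unfold sg in *; lra).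
      assert (s * (3 / 4 * sg) < s * (r - Cmod (z + rho * w - z0))) by (apply Rmult_lt_compat_l; lra).
      assert (0 < s * sg) by (apply Rmult_lt_0_compat; lra). lra.
    + assert (Ep : forall m, (s / 3) ^ m = s ^ m * (/ 3) ^ m).
      { intros m. unfold Rdiv. apply Rpow_mult_distr. }
      assert (Hin : forall v, Disc w ((/ 3) ^ gam) v -> Cmod (z + rho * v - (z + rho * w)) < (s / 3) ^ gam).
      { intros v Hv. rewrite Ep. fold rho. replace (z + rho * v - (z + rho * w))%C with (rho * (v - w))%C by ring.
        rewrite Cmod_mult, Cmod_RtoC_pos by lra. apply Rmult_lt_compat_l; auto. }
      exists (z + rho * x)%C, (z + rho * y)%C. split; [apply Hin, Hx |]. split; [apply Hin, Hy |].
      rewrite <- !Hmodg, Ep. split.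
      * rewrite Rmult_comm. apply Rmult_lt_compat_l; auto.
      * replace (2 * (s ^ Gam * (/ 3) ^ Gam)) with (2 * (/ 3) ^ Gam * s ^ Gam) by ring.
        apply Rmult_lt_compat_r; auto.
  - destruct Hb as [x [y [Hx [Hy [Hbx Hby]]]]].
    assert (Hback : forall v, Cmod (v - z) < s ^ gam -> Cmod (RtoC (/ rho) * (v - z)) < 1 /\ (z + rho * (RtoC (/ rho) * (v - z)))%C = v).
    { intros v Hv. assert (0 < / rho) by (apply Rinv_0_lt_compat, Hrho). split.
      - rewrite Cmod_mult, Cmod_RtoC_pos by lra. rewrite <- (Rinv_l rho) by lra.
        apply Rmult_lt_compat_l; auto.
      - rewrite RtoC_inv by lra. field. intros E. apply RtoC_inj in E. lra. }
    destruct (Hback x Hx) as [X1 X2]. destruct (Hback y Hy) as [Y1 Y2].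
    exists (RtoC (/ rho) * (x - z))%C, (RtoC (/ rho) * (y - z))%C. split; [exact X1 |]. split; [exact Y1 |].
    assert (Mx := Hmodg (RtoC (/ rho) * (x - z))%C). assert (My := Hmodg (RtoC (/ rho) * (y - z))%C).
    rewrite X2 in Mx. rewrite Y2 in My. split.
    + apply Rmult_lt_reg_r with (s ^ Gam); [exact HsG | lra].
    + apply Rmult_lt_reg_r with (s ^ Gam); [exact HsG | lra].
Qed.

(** * Functions of exponential type *)

Lemma exp_ge (x : R) : 1 + x <= exp x.
Proof. destruct (Req_dec x 0) as [-> | H]; [rewrite exp_0; lra | apply Rlt_le, exp_ineq1, H]. Qed.

Lemma exp_le (x y : R) : x <= y -> exp x <= exp y.
Proof. intros [H | ->]; [apply Rlt_le, exp_increasing, H | lra]. Qed.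

Lemma exp_type_const (c : C) : exp_type (fun _ => c).
Proof.
  assert (P := Cmod_ge_0 c). exists (Cmod c + 1). split; [lra |]. intros z.
  assert (Q := Cmod_ge_0 z). eapply Rle_trans; [| apply exp_ge]. nra.
Qed.

Lemma exp_type_mult (f g : C -> C) : exp_type f -> exp_type g -> exp_type (fun z => f z * g z)%C.
Proof.
  intros [A [HA Hf]] [B [HB Hg]]. exists (A + B). split; [lra |]. intros z.
  rewrite Cmod_mult, Rmult_plus_distr_r, exp_plus.
  apply Rmult_le_compat; auto; apply Cmod_ge_0.
Qed.

Lemma exp_type_plus (f g : C -> C) : exp_type f -> exp_type g -> exp_type (fun z => f z + g z)%C.
Proof.
  intros [A [HA Hf]] [B [HB Hg]]. exists (A + B + 1). split; [lra |]. intros z.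
  assert (P := Cmod_ge_0 z). eapply Rle_trans; [apply Cmod_triangle |].
  assert (E1 : Cmod (f z) <= exp ((A + B) * (1 + Cmod z))) by (eapply Rle_trans; [apply Hf | apply exp_le; nra]).
  assert (E2 : Cmod (g z) <= exp ((A + B) * (1 + Cmod z))) by (eapply Rle_trans; [apply Hg | apply exp_le; nra]).
  rewrite (Rmult_plus_distr_r (A + B)), exp_plus.
  assert (E3 := exp_ge (1 * (1 + Cmod z))). assert (E4 := exp_pos ((A + B) * (1 + Cmod z))). nra.
Qed.

Lemma exp_type_pow (f : C -> C) (n : nat) : exp_type f -> exp_type (fun z => f z ^ n)%C.
Proof.
  intros Hf. induction n as [| n IH]; simpl; [apply exp_type_const | apply exp_type_mult; auto].
Qed.

Lemma exp_type_derive (f : C -> C) : Hol plane f -> exp_type f -> exp_type (C_derive f).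
Proof.
  intros Hh [A [HA Hf]]. exists (2 * A + 1). split; [lra |]. intros z. assert (P := Cmod_ge_0 z).
  eapply Rle_trans.
  - apply (Cauchy_estimate_disc f z 1 (exp (2 * A * (1 + Cmod z)))); [lra | |].
    + apply Hol_plane_sub; auto.
    + intros w Hw. eapply Rle_trans; [apply Hf | apply exp_le]. unfold Disc in Hw.
      assert (T := Cmod_add w z). nra.
  - rewrite Rmult_plus_distr_r, exp_plus.
    assert (E3 := exp_ge (1 * (1 + Cmod z))). assert (E4 := exp_pos (2 * A * (1 + Cmod z))). nra.
Qed.

Lemma exp_type_derive_n (f : C -> C) (j : nat) : Hol plane f -> exp_type f -> exp_type (C_derive_n f j).
Proof.
  intros Hh Hf. induction j as [| j IH]; simpl; [exact Hf |].
  apply (exp_type_derive (C_derive_n f j)); [apply Hol_C_derive_n; auto; apply open_plane | exact IH].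
Qed.

Lemma exp_type_diff_monomial (k : nat) (q : nat -> nat) (f : C -> C) :
  Hol plane f -> exp_type f -> exp_type (diff_monomial k q f).
Proof.
  intros Hh Hf. unfold diff_monomial. generalize (S k). intros n.
  induction n as [| n IH]; simpl; [apply exp_type_const |].
  apply exp_type_mult; [exact IH |]. apply exp_type_pow, exp_type_derive_n; auto.
Qed.

(** Where [|g|] exceeds [2], [ln |g|] is positive and harmonic. The largest disc
    about [z] with [|g| > 2] has radius at most [1 + |z|]; near its boundary
    [|g|] is bounded because [g] is tame, and Harnack's inequality carries the
    bound to the centre at the cost of a factor proportional to the radius. *)
Lemma tame_growth (d t : R) :
  0 < d <= 1 -> 0 < t <= / 3 ->
  exists K, 0 < K /\ forall g L, Hol (Disc 0 (L + 1)) g -> tame g d t L ->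
    (exists x, Cmod x < 1 /\ Cmod (g x) < 1) ->
    forall z, 2 * Cmod z + 2 <= L -> Cmod (g z) <= exp (K * (1 + Cmod z)).
Proof.
  intros Hd Ht. set (m := t / 2). set (A := ln 2 - ln m). set (eta := d / 8).
  assert (Hm : 0 < m < 1) by (unfold m; lra).
  assert (Hlm : ln m < 0) by (rewrite <- ln_1; apply ln_increasing; lra).
  assert (Hl2 : 0 < ln 2 < 1).
  { split; [rewrite <- ln_1; apply ln_increasing; lra |].
    rewrite <- (ln_exp 1). apply ln_increasing; [lra |]. generalize (exp_ineq1 1). lra. }
  assert (HA : 0 < A) by (unfold A; lra).
  assert (Heta : 0 < eta) by (unfold eta; lra).
  assert (HAe : 0 < 32 * A / eta) by (apply Rdiv_lt_0_compat; lra).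
  exists (1 + 8 * A + 32 * A / eta). split; [lra |].
  intros g L Hg Htame [x0 [Hx0 Hgx0]] z HzL.
  assert (Hz0 := Cmod_ge_0 z).
  set (K := 1 + 8 * A + 32 * A / eta).
  assert (HK : 1 <= K) by (unfold K; lra).
  destruct (Rle_dec (Cmod (g z)) 2) as [Hle | Hgt].
  { eapply Rle_trans; [exact Hle |]. eapply Rle_trans; [| apply exp_ge]. nra. }
  apply Rnot_le_lt in Hgt.
  assert (Hfin : ln (Cmod (g z)) <= K * (1 + Cmod z) -> Cmod (g z) <= exp (K * (1 + Cmod z))).
  { intros H. rewrite <- (exp_ln (Cmod (g z))) by lra. apply exp_le, H. }
  apply Hfin.
  assert (Hj : exists j : nat, (forall w, Cmod (w - z) < INR j * eta -> 2 < Cmod (g w)) /\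
                exists w, Cmod (w - z) < INR (S j) * eta /\ Cmod (g w) <= 2).
  { apply NNPP. intros Hn.
    assert (All : forall j w, Cmod (w - z) < INR j * eta -> 2 < Cmod (g w)).
    { induction j as [| j IH]; intros w Hw.
      - simpl in Hw. generalize (Cmod_ge_0 (w - z)). lra.
      - apply Rnot_le_lt. intros Hle. apply Hn. exists j. split; [exact IH | eauto]. }
    destruct (nfloor_ex (Cmod (x0 - z) / eta)) as [N HN].
    { apply Rle_div_r; [exact Heta |]. rewrite Rmult_0_l. apply Cmod_ge_0. }
    assert (H1 : 2 < Cmod (g x0)); [| lra]. apply (All (S N)). rewrite S_INR.
    apply Rlt_div_l; lra. }
  destruct Hj as [j [Hbig [w [Hw Hgw]]]]. set (R0 := INR j * eta) in *.
  rewrite S_INR, Rmult_plus_distr_r, Rmult_1_l in Hw. fold R0 in Hw.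
  assert (HR0 : 0 <= R0) by (apply Rmult_le_pos; [apply pos_INR | lra]).
  assert (HRz : R0 <= Cmod z + 1).
  { apply Rnot_lt_le. intros H. assert (2 < Cmod (g x0)); [| lra]. apply Hbig.
    assert (T := Cmod_triangle x0 (- z)). rewrite Cmod_opp in T. unfold Cminus. lra. }
  assert (HwR : R0 <= Cmod (w - z)).
  { apply Rnot_lt_le. intros H. specialize (Hbig w H). lra. }
  assert (HwL : Cmod w < L).
  { assert (T := Cmod_add w z). unfold eta in *. lra. }
  assert (HwD : forall v, Disc w d v -> Disc 0 (L + 1) v).
  { intros v Hv. apply Disc_0. unfold Disc in Hv.
    assert (T := Cmod_add v w). lra. }
  (* the bound transported from the boundary point [w] to a nearby point where [|g| > 2] *)
  assert (Hnear : forall p, Cmod (p - w) <= 4 * eta -> 2 < Cmod (g p) -> ln (Cmod (g p)) <= 8 * A).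
  { intros p Hp Hgp.
    assert (Hlow : forall v, Disc w d v -> m < Cmod (g v)).
    { intros v Hv. apply Rnot_le_lt. intros Hgv.
      assert (Cmod (g p) <= 2 * t); [| lra].
      apply (Htame w HwL v p); auto; [unfold Disc, eta in *; lra | unfold m in *; lra]. }
    destruct (Harnack g w p d (/ 2) m) as [_ B]; auto.
    - apply (Hol_subset (Disc 0 (L + 1))); auto.
    - lra.
    - lra.
    - lra.
    - unfold eta in Hp. lra.
    - assert (Hw2 : ln (Cmod (g w)) <= ln 2).
      { apply ln_le; [| exact Hgw]. assert (m < Cmod (g w)); [| lra].
        apply Hlow. unfold Disc. rewrite Cmod_self. lra. }
      unfold A. lra. }
  destruct (Rle_dec R0 (2 * eta)) as [HR | HR].
  - assert (B : ln (Cmod (g z)) <= 8 * A).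
    { apply Hnear; [rewrite Cmod_sym; lra | exact Hgt]. }
    unfold K. nra.
  - apply Rnot_le_lt in HR.
    set (D := Cmod (w - z)) in *.
    set (p := (z + ((R0 - eta) / D)%R * (w - z))%C).
    assert (Hfr : 0 <= (R0 - eta) / D <= 1).
    { split; [apply Rle_div_r | apply Rle_div_l]; lra. }
    assert (Hpz : Cmod (p - z) = R0 - eta).
    { replace (p - z)%C with (((R0 - eta) / D)%R * (w - z))%C by (unfold p; ring).
      rewrite Cmod_mult, Cmod_RtoC_pos by lra. fold D. field. lra. }
    assert (Hpw : Cmod (p - w) <= 4 * eta).
    { replace (p - w)%C with (((R0 - eta) / D - 1)%R * (w - z))%C by (unfold p; rewrite RtoC_minus; ring).
      rewrite Cmod_mult, Cmod_R, Rabs_left1 by lra. fold D.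
      replace (- ((R0 - eta) / D - 1) * D) with (D - (R0 - eta)) by (field; lra). lra. }
    assert (Hgp : 2 < Cmod (g p)) by (apply Hbig; lra).
    assert (Bp := Hnear p Hpw Hgp).
    destruct (Harnack g z p R0 ((R0 - eta) / R0) 2) as [B _].
    + apply (Hol_subset (Disc 0 (L + 1))); [| exact Hg]. intros v Hv. apply Disc_0. unfold Disc in Hv.
      assert (T := Cmod_add v z). lra.
    + lra.
    + exact Hbig.
    + lra.
    + apply ratio_lt_1. lra.
    + rewrite Hpz. right. field. lra.
    + replace (1 - (R0 - eta) / R0) with (eta / R0) in B by (field; lra).
      assert (B2 : ln (Cmod (g z)) - ln 2 <= 32 * A / eta * R0).
      { apply Rmult_le_reg_l with (eta / R0); [apply Rdiv_lt_0_compat; lra |].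
        replace (eta / R0 * (32 * A / eta * R0)) with (32 * A) by (field; lra). lra. }
      assert (32 * A / eta * R0 <= 32 * A / eta * (Cmod z + 1)) by (apply Rmult_le_compat_l; lra).
      unfold K. nra.
Qed.

(** * Entire limit functions *)

Lemma C_prod_zero (a : nat -> C -> C) (n : nat) :
  (forall i, Hol plane (a i)) -> (forall z, C_prod (fun i => a i z) n = 0%C) ->
  exists i, (i < n)%nat /\ forall z, a i z = 0%C.
Proof.
  intros Ha. induction n as [| n IH]; intros H.
  - exfalso. specialize (H 0%C). simpl in H. apply RtoC_inj in H. lra.
  - destruct (entire_mult_zero (fun z => C_prod (fun i => a i z) n) (a n)) as [Z | Z]; auto.
    + apply Hol_C_prod, Ha.
    + destruct (IH Z) as [i [Hi Hz]]. exists i. split; [lia | exact Hz].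
    + exists n. split; [lia | exact Z].
Qed.

Lemma C_prod_first (a : nat -> C) (n : nat) : C_prod a (S n) = (a 0%nat * C_prod (fun i => a (S i)) n)%C.
Proof.
  induction n as [| n IH]; [simpl; ring |].
  change (C_prod a (S (S n))) with (C_prod a (S n) * a (S n))%C. rewrite IH. simpl. ring.
Qed.

Lemma diff_monomial_double_zero (k : nat) (q : nat -> nat) (f : C -> C) (a : C) :
  Hol plane f -> (2 <= q 0%nat)%nat -> f a = 0%C ->
  diff_monomial k q f a = 0%C /\ C_derive (diff_monomial k q f) a = 0%C.
Proof.
  intros Hf Hq Ha.
  set (P := fun z => C_prod (fun i => (C_derive_n f (S i) z ^ q (S i))%C) k).
  set (N := fun z => (f z * (f z ^ (q 0%nat - 2) * P z))%C).
  assert (E : forall z, diff_monomial k q f z = (f z * N z)%C).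
  { intros z. unfold diff_monomial. rewrite C_prod_first. fold (P z). unfold N.
    change (C_derive_n f 0 z) with (f z). replace (q 0%nat) with (S (S (q 0%nat - 2))) at 1 by lia.
    simpl Cpow. ring. }
  assert (HN : Hol plane N).
  { apply Hol_mult; [exact Hf |]. apply Hol_mult; [apply Hol_pow, Hf |].
    apply (Hol_C_prod plane (fun i z => C_derive_n f (S i) z ^ q (S i))%C).
    intros i. apply Hol_pow, Hol_C_derive_n; [apply open_plane | exact Hf]. }
  assert (N0 : N a = 0%C) by (unfold N; rewrite Ha; ring).
  split; [rewrite E, Ha; ring |].
  apply cdiff_unique. apply cdiff_ext_loc with (fun z => f z * N z)%C.
  - apply filter_forall. intros z. symmetry. apply E.
  - eapply cdiff_eq; [| apply cdiff_mult; apply (Hol_derive plane); auto; exact I].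
    rewrite Ha, N0. ring.
Qed.

Lemma entire_derivs_vanish (h : C -> C) (a : C) (i : nat) :
  Hol plane h -> (forall j, (j < i)%nat -> C_derive_n h j a = 0%C) ->
  (forall z, C_derive_n h i z = 0%C) -> forall z, h z = 0%C.
Proof.
  intros Hh. induction i as [| i IH]; intros Ha Hi; [exact Hi |].
  apply IH; [intros j Hj; apply Ha; lia |]. intros z.
  rewrite <- (Ha i) by lia. apply (zero_derivative_const plane); try exact I; [apply convex_plane |].
  intros w _. rewrite <- (Hi w). apply (Hol_derive plane (C_derive_n h i)); [| exact I].
  apply Hol_C_derive_n; [apply open_plane | exact Hh].
Qed.

Lemma cdiff_pow_exp (f : C -> C) (c z : C) (n : nat) :
  cdiff f z (c * f z)%C -> cdiff (fun w => f w ^ n)%C z (INR n * c * f z ^ n)%C.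
Proof.
  intros H. induction n as [| n IH].
  - simpl. eapply cdiff_eq; [| apply cdiff_const]. ring.
  - rewrite S_INR, RtoC_plus. simpl Cpow. eapply cdiff_eq; cycle 1.
    + apply cdiff_mult; [exact H | exact IH].
    + cbv beta. ring.
Qed.

Lemma C_prod_pow (q : nat -> nat) (a : C) (n : nat) : C_prod (fun i => (a ^ q i)%C) n = (a ^ degree q n)%C.
Proof. induction n as [| n IH]; simpl; [reflexivity | rewrite IH, Cpow_add; reflexivity]. Qed.

Lemma diff_monomial_exponential (k : nat) (q : nat -> nat) (f : C -> C) (c : C) :
  Hol plane f -> (forall z, C_derive f z = (c * f z)%C) ->
  forall z, diff_monomial k q f z = (c ^ weight q (S k) * f z ^ degree q (S k))%C.
Proof.
  intros Hf Hc z.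
  assert (Hn : forall j w, C_derive_n f j w = (c ^ j * f w)%C).
  { induction j as [| j IH]; intros w; [simpl; ring |].
    change (C_derive (C_derive_n f j) w = (c ^ S j * f w)%C). apply cdiff_unique.
    apply cdiff_ext_loc with (fun v => c ^ j * f v)%C.
    - apply filter_forall. intros v. symmetry. apply IH.
    - eapply cdiff_eq; cycle 1.
      + apply cdiff_mult; [apply cdiff_const | apply (Hol_derive plane); [exact Hf | exact I]].
      + cbv beta. rewrite Hc. simpl. ring. }
  unfold diff_monomial.
  transitivity (C_prod (fun i => ((1 * c ^ i * f z) ^ q i)%C) (S k)).
  - apply C_prod_ext. intros i. rewrite Hn. f_equal. ring.
  - rewrite (C_prod_scale q 1 c (fun _ => f z)), C_prod_pow, Cpow_1_l. ring.
Qed.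

(** Let [M] be the monomial in [h]. By Hurwitz [M - 1] is identically 0 or
    zero-free, and in the second case [M' = e (M - 1)] for a constant [e]. At a zero
    of [h] the monomial has a double zero, since [q 0 >= 2]; this excludes
    [M = 1] and forces [e = 0], so [M] vanishes identically, hence some derivative of
    [h], and by the multiplicity of the zero [h] itself. So [h] is zero-free,
    [h' = c h], and [M] is a constant times a power of [h], with [M' = gam c M]. This is
    incompatible with both [M = 1] and [M' = e (M - 1)]. *)
Theorem no_nonconstant_limit (k : nat) (q : nat -> nat) (g : nat -> C -> C) (h : C -> C) :
  (2 <= q 0%nat)%nat ->
  hol_eventually g -> cvg_plane g h ->
  (forall r, exists N, forall n, (N <= n)%nat -> forall a, Cmod a < r -> g n a = 0%C ->
     forall j, (j < k)%nat -> C_derive_n (g n) j a = 0%C) ->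
  (forall r, exists N, forall n, (N <= n)%nat -> forall w, Cmod w < r -> diff_monomial k q (g n) w <> 1%C) ->
  exp_type h -> (exists z w, h z <> h w) -> False.
Proof.
  intros Hq0 Hg Hc Hz Hm Hexp [z1 [z2 Hnc]].
  assert (Hh := cvg_plane_Hol g h Hg Hc).
  set (M := diff_monomial k q h).
  assert (HM : Hol plane M) by (apply Hol_diff_monomial; [apply open_plane | exact Hh]).
  set (W := fun z => (M z + - (1))%C).
  assert (HW : Hol plane W) by (apply Hol_plus; [exact HM | apply Hol_const]).
  assert (HWd : forall z, C_derive W z = C_derive M z).
  { intros z. apply cdiff_unique. eapply cdiff_eq; cycle 1.
    - apply cdiff_plus; [apply (Hol_derive plane M); [exact HM | exact I] | apply cdiff_const].
    - simpl. ring. }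
  assert (HWexp : exp_type W).
  { apply exp_type_plus; [apply exp_type_diff_monomial; auto | apply exp_type_const]. }
  assert (Hdich : (forall z, M z = 1%C) \/ (forall z, M z <> 1%C)).
  { destruct (classic (forall z, M z = 1%C)) as [H | H]; [left; exact H | right].
    apply not_all_ex_not in H. destruct H as [z0 Hz0]. intros a Ha.
    assert (HgW : hol_eventually (fun n z => diff_monomial k q (g n) z + - (1))%C).
    { intros r. destruct (Hg r) as [N HN]. exists N. intros n Hn. apply Hol_plus; [| apply Hol_const].
      apply Hol_diff_monomial; [apply open_disc | auto]. }
    assert (HcW : cvg_plane (fun n z => diff_monomial k q (g n) z + - (1))%C W).
    { intros r eps He. destruct (cvg_plane_diff_monomial k q g h Hg Hc r eps He) as [N HN].
      exists N. intros n Hn z Hzr. unfold W.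
      replace (diff_monomial k q (g n) z + - (1) - (M z + - (1)))%C with (diff_monomial k q (g n) z - M z)%C by ring.
      apply HN; auto. }
    destruct (Hurwitz _ W a 1 HgW HcW) as [N1 H1]; [| unfold W; rewrite Ha; ring | lra |].
    { exists z0. unfold W. intros E. apply Hz0. transitivity (M z0 + - (1) + 1)%C; [ring | rewrite E; ring]. }
    destruct (Hm (Cmod a + 1)) as [N2 H2].
    destruct (H1 (Nat.max N1 N2) ltac:(lia)) as [z [Hza E]].
    apply (H2 (Nat.max N1 N2) ltac:(lia) z).
    - assert (T := Cmod_add z a). lra.
    - transitivity (diff_monomial k q (g (Nat.max N1 N2)) z + - (1) + 1)%C; [ring |]. rewrite E. ring. }
  assert (HWzf : (forall z, M z <> 1%C) -> exists e, forall z, C_derive M z = (e * (M z - 1))%C).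
  { intros H. destruct (zero_free_exp_type W HW HWexp) as [e He].
    - intros z E. apply (H z). transitivity (W z + 1)%C; [unfold W; ring | rewrite E; ring].
    - exists e. intros z. rewrite <- HWd, He. unfold W. ring. }
  assert (Hconst : (forall z, C_derive M z = 0%C) -> forall z w, M z = M w).
  { intros H z w. apply (zero_derivative_const plane); try exact I; [apply convex_plane |].
    intros v _. rewrite <- (H v). apply (Hol_derive plane M); [exact HM | exact I]. }
  assert (Hzf : forall a, h a <> 0%C).
  { intros a Ha.
    destruct (diff_monomial_double_zero k q h a Hh Hq0 Ha) as [M0 M1]. fold M in M0, M1.
    assert (Hne : exists z, h z <> 0%C).
    { destruct (classic (h z1 = 0%C)) as [E | E]; [| eauto]. exists z2. intros E2. apply Hnc. rewrite E, E2. reflexivity. }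
    assert (Hder : forall j, (j < k)%nat -> C_derive_n h j a = 0%C).
    { intros j Hj. destruct (cvg_plane_derive_n g h j Hg Hc) as [_ Hcj].
      assert (Hhj : Hol plane (C_derive_n h j)) by (apply Hol_C_derive_n; [apply open_plane | exact Hh]).
      apply Cmod_arbitrarily_small. intros eps He.
      destruct (proj1 (cont_at_C _ a) (Hol_cont plane _ a Hhj I) (eps / 2)) as [d [Hd Hcont]]; [lra |].
      destruct (Hurwitz g h a (Rmin d 1) Hg Hc Hne Ha) as [N1 H1]; [apply Rmin_glb_lt; lra |].
      destruct (Hz (Cmod a + 1)) as [N2 H2].
      destruct (Hcj (Cmod a + 1) (eps / 2)) as [N3 H3]; [lra |].
      set (n := Nat.max N1 (Nat.max N2 N3)).
      destruct (H1 n ltac:(unfold n; lia)) as [b [Hb Eb]].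
      destruct (Rmin_lt _ _ _ Hb) as [Hb1 Hb2].
      assert (Hbr : Cmod b < Cmod a + 1).
      { assert (T := Cmod_add b a). lra. }
      assert (E0 := H2 n ltac:(unfold n; lia) b Hbr Eb j Hj).
      specialize (H3 n ltac:(unfold n; lia) b Hbr). rewrite E0 in H3.
      specialize (Hcont b Hb1).
      replace (0 - C_derive_n h j b)%C with (- C_derive_n h j b)%C in H3 by ring. rewrite Cmod_opp in H3.
      assert (T := Cmod_rev (C_derive_n h j a) (C_derive_n h j b)). rewrite Cmod_sym in T. lra. }
    assert (Hne1 : forall z, M z <> 1%C).
    { destruct Hdich as [H | H]; [| exact H]. exfalso. rewrite H in M0. apply RtoC_inj in M0. lra. }
    destruct (HWzf Hne1) as [e He].
    assert (e0 : e = 0%C).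
    { specialize (He a). rewrite M0, M1 in He. transitivity (- (e * (0 - 1)))%C; [ring | rewrite <- He; ring]. }
    assert (HM0 : forall z, M z = 0%C).
    { intros z. rewrite (Hconst ltac:(intros w; rewrite He, e0; ring) z a). exact M0. }
    destruct (C_prod_zero (fun i z => C_derive_n h i z ^ q i)%C (S k)) as [i [Hi Hzero]].
    { intros i. apply Hol_pow, Hol_C_derive_n; [apply open_plane | exact Hh]. }
    { exact HM0. }
    apply Hnc. assert (Hall : forall z, h z = 0%C).
    { apply (entire_derivs_vanish h a i Hh).
      - intros j Hj. apply Hder. lia.
      - intros z. apply NNPP. intros Hn. apply (Cpow_nz _ (q i) Hn), Hzero. }
    rewrite !Hall. reflexivity. }
  destruct (zero_free_exp_type h Hh Hexp Hzf) as [c Hcd].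
  assert (Hc0 : c <> 0%C).
  { intros E. apply Hnc. apply (zero_derivative_const plane); try exact I; [apply convex_plane |].
    intros v _. replace (RtoC 0) with (C_derive h v) by (rewrite Hcd, E; ring).
    apply (Hol_derive plane h); [exact Hh | exact I]. }
  assert (HMe := diff_monomial_exponential k q h c Hh Hcd). fold M in HMe.
  set (gam := degree q (S k)) in *.
  assert (Hgam : (1 <= gam)%nat).
  { unfold gam. clear - Hq0. induction k as [| n IH]; [simpl; lia |].
    change (degree q (S (S n))) with (degree q (S n) + q (S n))%nat. lia. }
  assert (Hgc : (INR gam * c)%C <> 0%C).
  { apply Cmult_neq_0; [| exact Hc0]. intros E. apply RtoC_inj in E.
    assert (1 <= INR gam) by (apply (le_INR 1), Hgam). lra. }
  assert (HMd : forall z, C_derive M z = (INR gam * c * M z)%C).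
  { intros z. apply cdiff_unique.
    apply cdiff_ext_loc with (fun w => c ^ weight q (S k) * h w ^ gam)%C.
    - apply filter_forall. intros w. symmetry. apply HMe.
    - eapply cdiff_eq; cycle 1.
      + apply cdiff_mult; [apply cdiff_const |]. apply (cdiff_pow_exp h c). rewrite <- Hcd.
        apply (Hol_derive plane h); [exact Hh | exact I].
      + cbv beta. rewrite HMe. ring. }
  assert (HMn0 : forall z, M z <> 0%C).
  { intros z. rewrite HMe. apply Cmult_neq_0; apply Cpow_nz; auto. }
  assert (HMnc : (forall z w, M z = M w) -> False).
  { intros H. assert (E : C_derive M 0%C = 0%C).
    { apply cdiff_unique. apply cdiff_ext_loc with (fun _ => M 0%C); [| apply cdiff_const].
      apply filter_forall. intros w. apply H. }
    rewrite HMd in E. apply (Cmult_neq_0 _ _ Hgc (HMn0 0%C) E). }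
  destruct Hdich as [H | H].
  - apply HMnc. intros z w. rewrite !H. reflexivity.
  - destruct (HWzf H) as [e He].
    assert (Eq : forall z, ((INR gam * c - e) * M z)%C = (- e)%C).
    { intros z. transitivity (INR gam * c * M z - e * (M z - 1) - e)%C; [ring |].
      rewrite <- HMd, <- He. ring. }
    destruct (classic ((INR gam * c - e)%C = 0%C)) as [E | E].
    + assert (e0 : e = 0%C) by (specialize (Eq 0%C); rewrite E in Eq;
        transitivity (- (- e))%C; [ring | rewrite <- Eq; ring]).
      apply Hgc. rewrite e0 in E. rewrite <- E. ring.
    + apply HMnc. intros z w.
      transitivity ((INR gam * c - e) * M z / (INR gam * c - e))%C; [field; exact E |].
      rewrite (Eq z), <- (Eq w). field. exact E.
Qed.

(** * Uniform absence of bad discs *)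

Lemma bounded_Lipschitz (f : C -> C) (c : C) (r M : R) :
  0 < r -> Hol (Disc c r) f -> (forall w, Disc c r w -> Cmod (f w) <= M) ->
  forall z w, Disc c (r / 2) z -> Disc c (r / 2) w -> Cmod (f w - f z) <= Cmod (w - z) * (4 * M / r).
Proof.
  intros Hr Hf HM z w Hz Hw.
  assert (Hsub : forall v, Disc c (r / 2) v -> Disc c r v) by (unfold Disc; intros; lra).
  rewrite <- (seg_int_derive (C_derive f) f z w).
  - apply seg_int_bound.
    + intros t Ht. apply (Hol_cont (Disc c r)); [apply Hol_C_derive; auto; apply open_disc |].
      apply Hsub, convex_disc; auto.
    + intros t Ht. assert (Hv := convex_disc c (r / 2) z w t Hz Hw Ht).
      set (v := (z + t * (w - z))%C) in *.
      assert (Hin : forall u, Disc v (r / 2) u -> Disc c r u).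
      { intros u Hu. unfold Disc in *. generalize (Cmod_tri_sub u v c). lra. }
      replace (4 * M / r) with (2 * M / (r / 2)) by (field; lra).
      apply Cauchy_estimate_disc; [lra | apply (Hol_subset (Disc c r)); auto | auto].
  - intros t Ht. apply (Hol_derive (Disc c r)); [exact Hf |]. apply Hsub, convex_disc; auto.
  - intros t Ht. apply (Hol_cont (Disc c r)); [apply Hol_C_derive; auto; apply open_disc |].
    apply Hsub, convex_disc; auto.
Qed.

(** Montel's theorem for sequences of functions defined on growing discs. *)
Lemma Montel_plane (g : nat -> C -> C) (B : R -> R) :
  (forall r, exists N, forall n, (N <= n)%nat ->
     Hol (Disc 0 r) (g n) /\ forall z, Cmod z < r -> Cmod (g n z) <= B r) ->
  exists phi h, strict_incr phi /\ cvg_plane (fun n => g (phi n)) h.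
Proof.
  intros H.
  set (u := fun (j n : nat) z => match j with O => fst (g n z) | S _ => snd (g n z) end).
  assert (Hu : forall j n z, Rabs (u j n z) <= Cmod (g n z)).
  { intros [| j] n z; [apply abs_fst_le | apply abs_snd_le]. }
  assert (Hud : forall j n z w, Rabs (u j n w - u j n z) <= Cmod (g n w - g n z)).
  { intros [| j] n z w; [apply (abs_fst_le (g n w - g n z)) | apply (abs_snd_le (g n w - g n z))]. }
  destruct (Arzela_Ascoli plane u) as [phi [Hphi [v Hv]]].
  - apply open_plane.
  - intros j z _. destruct (H (Cmod z + 1)) as [N HN]. exists (B (Cmod z + 1)), N.
    intros n Hn. eapply Rle_trans; [apply Hu |]. apply HN; auto. lra.
  - intros j z eps _ He. set (r := Cmod z + 2). destruct (H r) as [N HN].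
    set (K := Rabs (4 * B r / 2) + 1). assert (HK : 0 < K) by (unfold K; generalize (Rabs_pos (4 * B r / 2)); lra).
    exists (Rmin 1 (eps / K)), N. split; [apply Rmin_glb_lt; [lra | apply Rdiv_lt_0_compat; lra] |].
    intros n Hn w Hw. destruct (Rmin_lt _ _ _ Hw) as [Hw1 Hw2].
    destruct (HN n Hn) as [Hh Hb].
    assert (Hsub : forall x, Disc z 2 x -> Disc 0 r x).
    { intros x Hx. unfold r. apply Disc_0. unfold Disc in Hx.
      assert (T := Cmod_add x z). lra. }
    assert (L := bounded_Lipschitz (g n) z 2 (B r) ltac:(lra) ltac:(apply (Hol_subset (Disc 0 r)); auto)
      ltac:(intros x Hx; apply Hb, Disc_0, Hsub, Hx) z w ltac:(unfold Disc; rewrite Cmod_self; lra) ltac:(unfold Disc; lra)).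
    eapply Rle_lt_trans; [apply Hud |]. eapply Rle_lt_trans; [exact L |].
    assert (P := Cmod_ge_0 (w - z)).
    apply Rle_lt_trans with (Cmod (w - z) * K).
    + apply Rmult_le_compat_l; [exact P |]. unfold K. generalize (Rle_abs (4 * B r / 2)). lra.
    + replace eps with (eps / K * K) by (field; lra). apply Rmult_lt_compat_r; auto.
  - exists phi, (fun z => (v 0%nat z, v 1%nat z)). split; [exact Hphi |].
    intros r eps He.
    destruct (disc_uniform_nat 0 r (fun n z => Cmod (g (phi n) z - (v 0%nat z, v 1%nat z)) < eps)) as [N HN].
    + intros z _. destruct (Hv 0%nat z (eps / 2) I ltac:(lra)) as [r1 [N1 [Hr1 K1]]].
      destruct (Hv 1%nat z (eps / 2) I ltac:(lra)) as [r2 [N2 [Hr2 K2]]].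
      exists (Rmin r1 r2), (Nat.max N1 N2). split; [apply Rmin_glb_lt; auto |]. intros n Hn w Hw.
      specialize (K1 n ltac:(lia) w (Rlt_le_trans _ _ _ Hw (Rmin_l _ _))).
      specialize (K2 n ltac:(lia) w (Rlt_le_trans _ _ _ Hw (Rmin_r _ _))).
      eapply Rle_lt_trans; [apply Cmod_le_abs |]. simpl in *. unfold Rminus in K1, K2. lra.
    + exists N. intros n Hn z Hz. apply HN; [exact Hn |]. replace (z - 0)%C with z by ring. lra.
Qed.

(** Bad discs of arbitrarily small relative size would, chosen nearly minimal and
    rescaled, produce the limit function excluded by [no_nonconstant_limit]. *)
Lemma uniformly_not_bad (D : C -> Prop) (F : (C -> C) -> Prop) (k : nat) (q : nat -> nat) (z0 : C) (r : R) :
  open D -> (forall f, F f -> Hol D f) ->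
  (1 <= k)%nat -> (2 <= q 0%nat)%nat -> (1 <= q k)%nat ->
  (forall f, F f -> zeros_of_multiplicity_ge D f k) ->
  (forall f, F f -> forall z, D z -> diff_monomial k q f z <> 1%C) ->
  0 < r <= 1 -> (forall w, Disc z0 (3 * r) w -> D w) ->
  exists c, 0 < c /\ forall f, F f -> forall z s, Disc z0 r z -> 0 < s -> s < c * (r - Cmod (z - z0)) ->
    ~ bad (degree q (S k)) (weight q (S k)) f z s.
Proof.
  intros Ho HF Hk Hq0 Hqk Hm Hne Hr HD. apply NNPP. intros Hn.
  set (gam := degree q (S k)) in *. set (Gam := weight q (S k)) in *.
  assert (Hgam : (1 <= gam)%nat) by (apply degree_ge_1, Hqk).
  assert (HGam : (1 <= Gam)%nat) by (apply weight_ge_1; auto).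
  assert (HGk : (Gam < k * gam)%nat) by (apply weight_lt; auto; lia).
  set (d := (/ 3) ^ gam). set (t := (/ 3) ^ Gam).
  assert (Hd : 0 < d <= 1).
  { split; [apply pow_lt; lra |]. rewrite <- (pow1 gam). apply pow_incr. lra. }
  assert (Ht : 0 < t <= / 3).
  { split; [apply pow_lt; lra |]. rewrite <- (pow_1 (/ 3)). apply pow_le_1; [lra | exact HGam]. }
  assert (Hseq : forall n : nat, { g : C -> C |
    Hol (Disc 0 (INR (S n) / 4 + 1)) g /\
    (forall a, Cmod a < INR (S n) / 4 -> g a = 0%C -> forall j, (j < k)%nat -> C_derive_n g j a = 0%C) /\
    (forall w, Cmod w < INR (S n) / 4 -> diff_monomial k q g w <> 1%C) /\
    tame g d t (INR (S n) / 4) /\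
    (exists x y, Cmod x < 1 /\ Cmod y < 1 /\ Cmod (g x) < 1 /\ 2 < Cmod (g y)) }).
  { intros n. apply constructive_indefinite_description.
    assert (Hc : 0 < / INR (S n)) by (apply Rinv_0_lt_compat, lt_0_INR; lia).
    assert (Hex : exists f z s, F f /\ Disc z0 r z /\ 0 < s /\ s < / INR (S n) * (r - Cmod (z - z0)) /\ bad gam Gam f z s).
    { apply NNPP. intros Hno. apply Hn. exists (/ INR (S n)). split; [exact Hc |].
      intros f Hf z s Hz Hs Hlt Hb. apply Hno. exists f, z, s. auto. }
    destruct Hex as [f [z [s [Hf [Hz [Hs [Hlt Hb]]]]]]].
    destruct (nearly_minimal_bad gam Gam f z0 r (/ INR (S n))) as [z' [s' [Hz' [Hs' [Hlt' [Hb' Hmin]]]]]]; auto; [lra | | |].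
    - apply (small_not_bad gam Gam k D); auto. intros w Hw. apply HD. unfold Disc. lra.
    - exists z, s. auto.
    - apply (rescaled_functions D k q f z0 z' r s' n); auto. }
  set (g := fun n => proj1_sig (Hseq n)).
  assert (Hg : forall n, Hol (Disc 0 (INR (S n) / 4 + 1)) (g n) /\
    (forall a, Cmod a < INR (S n) / 4 -> g n a = 0%C -> forall j, (j < k)%nat -> C_derive_n (g n) j a = 0%C) /\
    (forall w, Cmod w < INR (S n) / 4 -> diff_monomial k q (g n) w <> 1%C) /\
    tame (g n) d t (INR (S n) / 4) /\
    (exists x y, Cmod x < 1 /\ Cmod y < 1 /\ Cmod (g n x) < 1 /\ 2 < Cmod (g n y))).
  { intros n. apply (proj2_sig (Hseq n)). }
  clearbody g. clear Hseq Hn.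
  assert (Hlarge : forall r0, exists N, forall n, (N <= n)%nat -> r0 < INR (S n) / 4).
  { intros r0. destruct (nfloor_ex (Rmax 0 (4 * r0)) (Rmax_l _ _)) as [N HN]. exists N. intros n Hn.
    assert (INR N <= INR n) by (apply le_INR, Hn). rewrite S_INR. generalize (Rmax_r 0 (4 * r0)). lra. }
  destruct (tame_growth d t Hd Ht) as [K [HK Hgrow]].
  assert (Hb : forall r0, exists N, forall n, (N <= n)%nat -> Hol (Disc 0 r0) (g n) /\
     forall z, Cmod z < r0 -> Cmod (g n z) <= exp (K * (1 + Cmod z))).
  { intros r0. destruct (Hlarge (2 * Rabs r0 + 2)) as [N HN]. exists N. intros n Hn. specialize (HN n Hn).
    assert (A := Rle_abs r0). assert (A' := Rabs_pos r0).
    destruct (Hg n) as [G1 [_ [_ [G4 [x [y [Hx [_ [Hgx _]]]]]]]]]. split.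
    - apply (Hol_subset (Disc 0 (INR (S n) / 4 + 1))); [| exact G1]. intros w Hw. unfold Disc in *. lra.
    - intros z Hz. apply (Hgrow (g n) (INR (S n) / 4)); auto; [eauto | lra]. }
  destruct (Montel_plane g (fun r0 => exp (K * (1 + r0)))) as [phi [h [Hphi Hc]]].
  { intros r0. destruct (Hb r0) as [N HN]. exists N. intros n Hn. destruct (HN n Hn) as [A B].
    split; [exact A |]. intros z Hz. eapply Rle_trans; [apply B, Hz |]. apply exp_le.
    apply Rmult_le_compat_l; lra. }
  assert (Hge := strict_incr_ge phi Hphi).
  apply (no_nonconstant_limit k q (fun n => g (phi n)) h); auto.
  - intros r0. destruct (Hb r0) as [N HN]. exists N. intros n Hn. apply HN. generalize (Hge n). lia.
  - intros r0. destruct (Hlarge r0) as [N HN]. exists N. intros n Hn a Ha H0 j Hj.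
    assert (L := HN (phi n) ltac:(generalize (Hge n); lia)). apply (Hg (phi n)); auto. lra.
  - intros r0. destruct (Hlarge r0) as [N HN]. exists N. intros n Hn w Hw.
    assert (L := HN (phi n) ltac:(generalize (Hge n); lia)). apply (Hg (phi n)). lra.
  - exists K. split; [exact HK |]. intros z. apply le_epsilon. intros eps He.
    destruct (Hc (Cmod z + 1) eps He) as [N1 H1]. destruct (Hb (Cmod z + 1)) as [N2 H2].
    set (n := Nat.max N1 N2). specialize (H1 n ltac:(unfold n; lia) z ltac:(lra)).
    destruct (H2 (phi n) ltac:(generalize (Hge n); unfold n; lia)) as [_ B]. specialize (B z ltac:(lra)).
    assert (T := Cmod_rev (h z) (g (phi n) z)). rewrite Cmod_sym in T. lra.
  - (* a constant limit would have modulus at most 1 and at least 2 *)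
    apply NNPP. intros Hno.
    assert (Hcst : forall z w, h z = h w).
    { intros z w. apply NNPP. intros E. apply Hno. eauto. }
    destruct (Hc 1 (/ 4) ltac:(lra)) as [N H1]. specialize (H1 N (le_n _)).
    destruct (Hg (phi N)) as [_ [_ [_ [_ [x [y [Hx [Hy [Hgx Hgy]]]]]]]]].
    assert (A := H1 x Hx). assert (B := H1 y Hy). rewrite (Hcst y x) in B.
    assert (T1 := Cmod_rev (h x) (g (phi N) x)). rewrite Cmod_sym in T1.
    assert (T2 := Cmod_rev (g (phi N) y) (h x)). lra.
Qed.

(** * The sphere *)

(** Stereographic coordinates. *)
Definition sphere_coord (j : nat) (p : C_sphere) : R :=
  match p with
  | Fin z => match j with
             | O => 2 * fst z / (1 + Cmod z ^ 2)
             | S O => 2 * snd z / (1 + Cmod z ^ 2)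
             | _ => (Cmod z ^ 2 - 1) / (1 + Cmod z ^ 2)
             end
  | Infty => match j with O | S O => 0 | _ => 1 end
  end.

(** The sine of half the spherical distance. *)
Definition half_chord (p p' : C_sphere) : R :=
  match p, p' with
  | Fin z, Fin w => Cmod (z - w) / (sqrt (1 + Cmod z ^ 2) * sqrt (1 + Cmod w ^ 2))
  | Fin z, Infty | Infty, Fin z => 1 / sqrt (1 + Cmod z ^ 2)
  | Infty, Infty => 0
  end.

Lemma spherical_dist_half_chord (p p' : C_sphere) : spherical_dist p p' = 2 * asin (half_chord p p').
Proof. destruct p, p'; simpl; try reflexivity. rewrite asin_0. ring. Qed.

Lemma one_plus_sq_pos (z : C) : 1 <= 1 + Cmod z ^ 2.
Proof. assert (H := Cmod_ge_0 z). nra. Qed.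

Lemma half_chord_ge_0 (p p' : C_sphere) : 0 <= half_chord p p'.
Proof.
  assert (S : forall z, 0 < sqrt (1 + Cmod z ^ 2)).
  { intros z. apply sqrt_lt_R0. generalize (one_plus_sq_pos z). lra. }
  destruct p as [z |], p' as [w |]; cbn [half_chord]; try lra.
  - apply Rmult_le_pos; [apply Cmod_ge_0 | apply Rlt_le, Rinv_0_lt_compat, Rmult_lt_0_compat; apply S].
  - apply Rmult_le_pos; [lra | apply Rlt_le, Rinv_0_lt_compat, S].
  - apply Rmult_le_pos; [lra | apply Rlt_le, Rinv_0_lt_compat, S].
Qed.

Lemma half_chord_sq (p p' : C_sphere) :
  4 * half_chord p p' ^ 2 =
  (sphere_coord 0 p - sphere_coord 0 p') ^ 2 + (sphere_coord 1 p - sphere_coord 1 p') ^ 2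
  + (sphere_coord 2 p - sphere_coord 2 p') ^ 2.
Proof.
  assert (S : forall z, sqrt (1 + Cmod z ^ 2) ^ 2 = 1 + Cmod z ^ 2).
  { intros z. apply pow2_sqrt. generalize (one_plus_sq_pos z). lra. }
  destruct p as [z |], p' as [w |]; cbn [half_chord sphere_coord].
  - assert (Pz := one_plus_sq_pos z). assert (Pw := one_plus_sq_pos w).
    assert (Ez := S z). assert (Ew := S w).
    set (a := sqrt (1 + Cmod z ^ 2)) in *. set (b := sqrt (1 + Cmod w ^ 2)) in *.
    assert (Ha : a <> 0) by (intros E; rewrite E in Ez; simpl in Ez; lra).
    assert (Hb : b <> 0) by (intros E; rewrite E in Ew; simpl in Ew; lra).
    replace ((Cmod (z - w) / (a * b)) ^ 2) with (Cmod (z - w) ^ 2 / (a ^ 2 * b ^ 2)) by (field; auto).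
    rewrite Ez, Ew. clear Ez Ew Ha Hb a b.
    rewrite !Cmod2_alt in *. unfold Re, Im in *. destruct z as [x y], w as [u v]. simpl fst in *; simpl snd in *.
    simpl in *. field. split; nra.
  - assert (Pz := one_plus_sq_pos z). assert (Ez := S z). set (a := sqrt (1 + Cmod z ^ 2)) in *.
    assert (Ha : a <> 0) by (intros E; rewrite E in Ez; simpl in Ez; lra).
    replace ((1 / a) ^ 2) with (1 / a ^ 2) by (field; auto). rewrite Ez. clear Ez Ha a.
    rewrite !Cmod2_alt in *. unfold Re, Im in *. destruct z as [x y]. simpl in *. field. nra.
  - assert (Pz := one_plus_sq_pos w). assert (Ez := S w). set (a := sqrt (1 + Cmod w ^ 2)) in *.
    assert (Ha : a <> 0) by (intros E; rewrite E in Ez; simpl in Ez; lra).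
    replace ((1 / a) ^ 2) with (1 / a ^ 2) by (field; auto). rewrite Ez. clear Ez Ha a.
    rewrite !Cmod2_alt in *. unfold Re, Im in *. destruct w as [x y]. simpl in *. field. nra.
  - ring.
Qed.

Lemma sphere_coord_unit (p : C_sphere) :
  sphere_coord 0 p ^ 2 + sphere_coord 1 p ^ 2 + sphere_coord 2 p ^ 2 = 1.
Proof.
  destruct p as [z |]; cbn [sphere_coord]; [| ring].
  assert (Pz := one_plus_sq_pos z). rewrite !Cmod2_alt in *. unfold Re, Im in *.
  destruct z as [x y]. simpl in *. field. nra.
Qed.

Lemma sphere_coord_ge_2 (j : nat) (p : C_sphere) : sphere_coord (S (S j)) p = sphere_coord 2 p.
Proof. destruct p; reflexivity. Qed.

Lemma Rabs_le_of_sq (x y : R) : 0 <= y -> x ^ 2 <= y ^ 2 -> Rabs x <= y.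
Proof. intros Hy H. apply Rabs_le. split; nra. Qed.

Lemma sphere_coord_bound (j : nat) (p : C_sphere) : Rabs (sphere_coord j p) <= 1.
Proof.
  assert (H := sphere_coord_unit p).
  assert (A0 := pow2_ge_0 (sphere_coord 0 p)). assert (A1 := pow2_ge_0 (sphere_coord 1 p)).
  assert (A2 := pow2_ge_0 (sphere_coord 2 p)).
  apply Rabs_le_of_sq; [lra |]. destruct j as [| [| j]]; [lra | lra |]. rewrite sphere_coord_ge_2. lra.
Qed.

Lemma sphere_coord_diff (j : nat) (p p' : C_sphere) :
  Rabs (sphere_coord j p - sphere_coord j p') <= 2 * half_chord p p'.
Proof.
  assert (H := half_chord_sq p p'). assert (P := half_chord_ge_0 p p').
  assert (A0 := pow2_ge_0 (sphere_coord 0 p - sphere_coord 0 p')).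
  assert (A1 := pow2_ge_0 (sphere_coord 1 p - sphere_coord 1 p')).
  assert (A2 := pow2_ge_0 (sphere_coord 2 p - sphere_coord 2 p')).
  apply Rabs_le_of_sq; [lra |].
  replace ((2 * half_chord p p') ^ 2) with (4 * half_chord p p' ^ 2) by ring.
  destruct j as [| [| j]]; [lra | lra |]. rewrite !(sphere_coord_ge_2 j). lra.
Qed.

Lemma half_chord_le_coords (p p' : C_sphere) (e : R) :
  0 <= e -> (forall j, (j <= 2)%nat -> Rabs (sphere_coord j p - sphere_coord j p') <= e) ->
  half_chord p p' <= e.
Proof.
  intros He H. assert (E := half_chord_sq p p'). assert (P := half_chord_ge_0 p p').
  assert (Q : forall j, (j <= 2)%nat -> (sphere_coord j p - sphere_coord j p') ^ 2 <= e ^ 2).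
  { intros j Hj. rewrite <- pow2_abs. apply pow_incr. split; [apply Rabs_pos | apply H, Hj]. }
  assert (Q0 := Q 0%nat ltac:(lia)). assert (Q1 := Q 1%nat ltac:(lia)). assert (Q2 := Q 2%nat ltac:(lia)).
  nra.
Qed.

Lemma half_chord_Fin (z w : C) : half_chord (Fin z) (Fin w) <= Cmod (z - w).
Proof.
  assert (S : forall v, 1 <= sqrt (1 + Cmod v ^ 2)).
  { intros v. rewrite <- sqrt_1 at 1. apply sqrt_le_1_alt, one_plus_sq_pos. }
  cbn [half_chord]. assert (Sz := S z). assert (Sw := S w). assert (P := Cmod_ge_0 (z - w)).
  set (a := sqrt (1 + Cmod z ^ 2)) in *. set (b := sqrt (1 + Cmod w ^ 2)) in *.
  assert (1 <= a * b) by nra.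
  apply Rle_div_l; nra.
Qed.

(** Inversion is an isometry of the sphere. *)
Lemma half_chord_inv (z w : C) :
  z <> 0%C -> w <> 0%C -> half_chord (Fin z) (Fin w) <= Cmod (/ z - / w).
Proof.
  intros Hz Hw.
  assert (S : forall v : C, v <> 0%C -> 0 < Cmod v <= sqrt (1 + Cmod v ^ 2)).
  { intros v Hv. split; [apply Cmod_gt_0, Hv |]. rewrite <- (sqrt_pow2 (Cmod v)) at 1 by apply Cmod_ge_0.
    apply sqrt_le_1_alt. lra. }
  replace (/ z - / w)%C with (- (z - w) / (z * w))%C by (field; auto).
  rewrite Cmod_div, Cmod_opp, Cmod_mult by (apply Cmult_neq_0; auto).
  cbn [half_chord]. assert (Sz := S z Hz). assert (Sw := S w Hw).
  apply Rmult_le_compat_l; [apply Cmod_ge_0 |].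
  apply Rinv_le_contravar; [apply Rmult_lt_0_compat; lra |]. apply Rmult_le_compat; lra.
Qed.

Lemma asin_small (eps : R) : 0 < eps -> exists e, 0 < e /\ forall x, 0 <= x <= e -> 2 * asin x < eps.
Proof.
  intros He. set (t := Rmin (eps / 4) 1). assert (Ht : 0 < t <= 1) by (unfold t; split; [apply Rmin_glb_lt; lra | apply Rmin_r]).
  assert (HPI := PI2_1).
  assert (Hsin : 0 < sin t) by (apply sin_gt_0; lra).
  exists (sin t). split; [exact Hsin |]. intros x Hx.
  assert (Hs1 := SIN_bound t).
  assert (A : asin x <= asin (sin t)).
  { destruct (Rle_lt_or_eq_dec x (sin t) (proj2 Hx)) as [L | ->]; [| lra].
    apply Rlt_le. apply Rnot_le_lt. intros B. apply (Rlt_irrefl x).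
    apply Rlt_le_trans with (1 := L).
    rewrite <- (sin_asin x), <- (sin_asin (sin t)) by lra.
    assert (B1 := asin_bound x). assert (B2 := asin_bound (sin t)).
    apply sin_incr_1; lra. }
  rewrite asin_sin in A by lra.
  assert (t <= eps / 4) by apply Rmin_l. lra.
Qed.

(** Inverse of the stereographic coordinates on the unit sphere. *)
Definition sphere_point (x y t : R) : C_sphere :=
  if excluded_middle_informative (t = 1) then Infty else Fin ((x / (1 - t))%R, (y / (1 - t))%R).

Lemma sphere_point_coord (x y t : R) :
  x ^ 2 + y ^ 2 + t ^ 2 = 1 ->
  sphere_coord 0 (sphere_point x y t) = x /\ sphere_coord 1 (sphere_point x y t) = y /\
  sphere_coord 2 (sphere_point x y t) = t.
Proof.
  intros H. unfold sphere_point. destruct (excluded_middle_informative (t = 1)) as [-> | n].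
  - simpl. repeat split; nra.
  - assert (Ht : 1 - t <> 0) by lra.
    assert (E : Cmod ((x / (1 - t))%R, (y / (1 - t))%R) ^ 2 = (1 + t) / (1 - t)).
    { rewrite Cmod2_alt. unfold Re, Im; simpl fst; simpl snd.
      replace ((x / (1 - t)) ^ 2 + (y / (1 - t)) ^ 2) with ((x ^ 2 + y ^ 2) / (1 - t) ^ 2) by (field; exact Ht).
      replace (x ^ 2 + y ^ 2) with ((1 - t) * (1 + t)) by lra. field. exact Ht. }
    unfold sphere_coord. rewrite E. simpl fst; simpl snd.
    repeat split; field; split; auto; lra.
Qed.

Lemma list_uniform_bound {A : Type} (P : A -> nat -> Prop) (l : list A) :
  (forall a n m, P a n -> (n <= m)%nat -> P a m) -> (forall a, In a l -> exists n, P a n) ->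
  exists n, forall a, In a l -> P a n.
Proof.
  intros Hmon. induction l as [| a l IH]; intros H; [exists 0%nat; intros a []|].
  destruct (H a (or_introl eq_refl)) as [n Hn]. destruct IH as [m Hm]; [intros b Hb; apply H; right; exact Hb |].
  exists (Nat.max n m). intros b [<- | Hb].
  - apply (Hmon _ _ _ Hn). lia.
  - apply (Hmon _ _ _ (Hm b Hb)). lia.
Qed.

(** The coordinates of a subsequence converge by [Arzela_Ascoli]; their limits lie
    on the unit sphere and so define the limit map. *)
Theorem equicontinuous_normal (D : C -> Prop) (G : (C -> C_sphere) -> Prop) :
  open D ->
  (forall z eps, D z -> 0 < eps -> exists r, 0 < r /\ forall g, G g ->
     forall w, Cmod (w - z) < r -> half_chord (g w) (g z) < eps) ->
  normal_family D G.
Proof.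
  intros Ho He g Hg.
  destruct (Arzela_Ascoli D (fun j n z => sphere_coord j (g n z)) Ho) as [phi [Hphi [v Hv]]].
  { intros j z _. exists 1, 0%nat. intros n _. apply sphere_coord_bound. }
  { intros j z eps Hz Hp. destruct (He z (eps / 2) Hz ltac:(lra)) as [r [Hr H]].
    exists r, 0%nat. split; [exact Hr |]. intros n _ w Hw.
    eapply Rle_lt_trans; [apply sphere_coord_diff |]. specialize (H (g n) (Hg n) w Hw). lra. }
  exists phi. split; [exact Hphi |].
  exists (fun z => sphere_point (v 0%nat z) (v 1%nat z) (v 2%nat z)).
  assert (Hlim : forall j z, D z -> is_lim_seq (fun n => sphere_coord j (g (phi n) z)) (v j z)).
  { intros j z Hz. apply is_lim_seq_spec. intros eps.
    destruct (Hv j z eps Hz (cond_pos eps)) as [r [N [Hr H]]]. exists N. intros n Hn.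
    apply H; auto. rewrite Cmod_self. exact Hr. }
  assert (Hunit : forall z, D z -> v 0%nat z ^ 2 + v 1%nat z ^ 2 + v 2%nat z ^ 2 = 1).
  { intros z Hz.
    assert (Hsq : forall j, is_lim_seq (fun n => sphere_coord j (g (phi n) z) ^ 2) (v j z ^ 2)).
    { intros j. simpl. apply is_lim_seq_mult'; [apply Hlim, Hz |].
      apply is_lim_seq_mult'; [apply Hlim, Hz | apply is_lim_seq_const]. }
    assert (L := is_lim_seq_plus' _ _ _ _ (is_lim_seq_plus' _ _ _ _ (Hsq 0%nat) (Hsq 1%nat)) (Hsq 2%nat)).
    assert (L1 : is_lim_seq (fun _ => 1) (v 0%nat z ^ 2 + v 1%nat z ^ 2 + v 2%nat z ^ 2)).
    { apply is_lim_seq_ext with (2 := L). intros n. apply sphere_coord_unit. }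
    apply is_lim_seq_unique in L1. rewrite Lim_seq_const in L1. injection L1. auto. }
  intros K HK HKD eps Hp.
  destruct (asin_small eps Hp) as [e [He0 Hasin]].
  set (close := fun (U : C -> Prop) N => forall n, (N <= n)%nat -> forall z, U z -> D z ->
     spherical_dist (g (phi n) z) (sphere_point (v 0%nat z) (v 1%nat z) (v 2%nat z)) < eps).
  destruct (HK (fun U => open U /\ exists N, close U N)) as [l [Hl1 Hl2]].
  { intros U [HU _]. exact HU. }
  { intros z Hz. assert (Dz := HKD z Hz).
    destruct (Hv 0%nat z e Dz He0) as [r0 [N0 [Hr0 H0]]].
    destruct (Hv 1%nat z e Dz He0) as [r1 [N1 [Hr1 H1]]].
    destruct (Hv 2%nat z e Dz He0) as [r2 [N2 [Hr2 H2]]].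
    exists (Disc z (Rmin r0 (Rmin r1 r2))). split; [split; [apply open_disc |] |].
    - exists (Nat.max N0 (Nat.max N1 N2)). intros n Hn w Hw Dw. unfold Disc in Hw.
      destruct (Rmin_lt _ _ _ Hw) as [Hw0 Hw'].
      destruct (Rmin_lt _ _ _ Hw') as [Hw1 Hw2].
      destruct (sphere_point_coord _ _ _ (Hunit w Dw)) as [E0 [E1 E2]].
      rewrite spherical_dist_half_chord. apply Hasin. split; [apply half_chord_ge_0 |].
      apply half_chord_le_coords; [lra |]. intros j Hj.
      destruct j as [| [| [| j]]]; [rewrite E0 | rewrite E1 | rewrite E2 | lia]; apply Rlt_le.
      + apply H0; auto; lia.
      + apply H1; auto; lia.
      + apply H2; auto; lia.
    - unfold Disc. rewrite Cmod_self. repeat apply Rmin_glb_lt; auto. }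
  destruct (list_uniform_bound close l) as [N HN].
  { intros U n m Hn Hnm n' Hn'. apply Hn. lia. }
  { intros U HU. apply (Hl1 U HU). }
  exists N. intros n Hn z Hz. destruct (Hl2 z Hz) as [U [HU HUz]].
  apply (HN U HU n Hn z HUz (HKD z Hz)).
Qed.

(** On a disc where [|f|] is bounded above or bounded away from zero, [f] or
    [1 / f] is Lipschitz, hence so is [f] as a map into the sphere. *)
Lemma half_chord_Lipschitz (f : C -> C) (z : C) (r m : R) :
  0 < r -> 0 < m -> Hol (Disc z r) f ->
  (forall w, Disc z r w -> Cmod (f w) <= 2 * m) \/ (forall w, Disc z r w -> m <= Cmod (f w)) ->
  forall w, Disc z (r / 2) w -> half_chord (Fin (f w)) (Fin (f z)) <= Cmod (w - z) * (4 * (2 * m + / m) / r).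
Proof.
  intros Hr Hm Hf Hdich w Hw.
  assert (Hzz : Disc z (r / 2) z) by (unfold Disc; rewrite Cmod_self; lra).
  assert (Him : 0 < / m) by (apply Rinv_0_lt_compat, Hm).
  assert (Hir : 0 < / r) by (apply Rinv_0_lt_compat, Hr).
  assert (P := Cmod_ge_0 (w - z)).
  destruct Hdich as [H | H].
  - eapply Rle_trans; [apply half_chord_Fin |].
    eapply Rle_trans; [apply (bounded_Lipschitz f z r (2 * m) Hr Hf H z w Hzz Hw) |].
    apply Rmult_le_compat_l; [exact P |]. unfold Rdiv. apply Rmult_le_compat_r; lra.
  - assert (H0 : forall v, Disc z r v -> f v <> 0%C).
    { intros v Hv. apply Cmod_gt_0. specialize (H v Hv). lra. }
    assert (Hsub : forall v, Disc z (r / 2) v -> Disc z r v) by (unfold Disc; intros; lra).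
    eapply Rle_trans; [apply half_chord_inv; apply H0; auto |].
    eapply Rle_trans.
    + apply (bounded_Lipschitz (fun v => / f v)%C z r (/ m)); auto.
      * apply Hol_inv; auto.
      * intros v Hv. rewrite Cmod_inv by auto. apply Rinv_le_contravar; auto.
    + apply Rmult_le_compat_l; [exact P |]. unfold Rdiv. apply Rmult_le_compat_r; lra.
Qed.

Theorem theorem1p2 (D : C -> Prop) (F : (C -> C) -> Prop) (k : nat) (q : nat -> nat)
  (hD : C_domain D)
  (hF : forall f : C -> C, F f -> analytic_on D f)
  (hk : (1 <= k)%nat) (hq0 : (2 <= q 0)%nat) (hqk : (1 <= q k)%nat)
  (ha : forall f : C -> C, F f -> zeros_of_multiplicity_ge D f k)
  (hb : forall f : C -> C, F f -> forall z : C, D z -> diff_monomial k q f z <> 1%C) :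
  normal_family D (sphere_valued F).
Proof.
  destruct hD as [_ [Ho _]].
  assert (HF : forall f, F f -> Hol D f) by (intros f Hf; apply Hol_analytic, hF, Hf).
  apply equicontinuous_normal; [exact Ho |]. intros z eps Hz He.
  destruct (open_sub_disc D z Ho Hz) as [r1 [Hr1 HD]].
  set (r := Rmin 1 (r1 / 3)).
  assert (Hr : 0 < r <= 1) by (unfold r; split; [apply Rmin_glb_lt; lra | apply Rmin_l]).
  assert (Hr3 : 3 * r <= r1) by (unfold r; generalize (Rmin_r 1 (r1 / 3)); lra).
  assert (HD3 : forall w, Disc z (3 * r) w -> D w) by (intros w Hw; apply HD; unfold Disc in *; lra).
  destruct (uniformly_not_bad D F k q z r Ho HF hk hq0 hqk ha hb Hr HD3) as [c [Hc Hnb]].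
  set (gam := degree q (S k)) in *. set (Gam := weight q (S k)) in *.
  set (s := Rmin 1 (c * r / 2)).
  assert (Hcr : 0 < c * r) by (apply Rmult_lt_0_compat; lra).
  assert (Hs : 0 < s <= 1) by (unfold s; split; [apply Rmin_glb_lt; lra | apply Rmin_l]).
  assert (Hsc : s < c * (r - Cmod (z - z))).
  { rewrite Cmod_self, Rminus_0_r. unfold s. generalize (Rmin_r 1 (c * r / 2)). lra. }
  set (rho := Rmin (s ^ gam) r1). set (m := s ^ Gam).
  assert (Hm : 0 < m) by (apply pow_lt; lra).
  assert (Hrho : 0 < rho) by (apply Rmin_glb_lt; [apply pow_lt; lra | lra]).
  set (K := 4 * (2 * m + / m) / rho).
  assert (HK : 0 < K).
  { apply Rdiv_lt_0_compat; [| exact Hrho]. generalize (Rinv_0_lt_compat m Hm). lra. }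
  exists (Rmin (rho / 2) (eps / K)). split; [apply Rmin_glb_lt; [lra | apply Rdiv_lt_0_compat; lra] |].
  intros g [f [Hf ->]] w Hw.
  destruct (Rmin_lt _ _ _ Hw) as [Hw1 Hw2].
  eapply Rle_lt_trans.
  - apply (half_chord_Lipschitz f z rho m Hrho Hm).
    + apply (Hol_subset D); [| apply HF, Hf]. intros v Hv. apply HD.
      unfold Disc in *. generalize (Rmin_r (s ^ gam) r1). fold rho. lra.
    + assert (Hnb' := Hnb f Hf z s ltac:(unfold Disc; rewrite Cmod_self; lra) ltac:(lra) Hsc).
      assert (Hin : forall v, Disc z rho v -> Cmod (v - z) < s ^ gam).
      { intros v Hv. eapply Rlt_le_trans; [exact Hv | apply Rmin_l]. }
      destruct (classic (exists x, Disc z rho x /\ Cmod (f x) < m)) as [[x [Hx Hfx]] | Hno].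
      * left. intros y Hy. apply Rnot_lt_le. intros Hfy. apply Hnb'. exists x, y. auto.
      * right. intros y Hy. apply Rnot_lt_le. intros Hfy. apply Hno. eauto.
    + exact Hw1.
  - fold K. replace eps with (eps / K * K) by (field; lra). apply Rmult_lt_compat_r; auto.
Qed.
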